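(* Let $(H,\|\cdot\|)$ be a Hilbert space and $E$ a linear operator in $H$. The following are equivalent. (i) $E$ generates a $C_0$-semigroup $\mathcal T$ similar to a semigroup of isometries (i.e. $(RT(t)R^{-1})_{t\ge0}$ consists of isometries for some invertible $R\in\mathcal L(H)$). (ii) $E$ generates a $C_0$-semigroup $\mathcal T=(T(t))_{t\ge0}$, and there exist a Hilbert space $(K,\|\cdot\|_K)$ and a densely defined linear operator $C:\operatorname{dom}(C)\subseteq H\to K$ with $T(t)(\operatorname{dom}(C))\subseteq\operatorname{dom}(C)$ for all $t\ge0$, with $t\mapsto CT(t)h$ Bochner measurable on $[0,\infty)$ for every $h\in\operatorname{dom}(C)$, and constants $\alpha,\beta>0$ such that either $$\alpha\|h\|^2\le\limsup_{t\to\infty}\frac1t\int_0^t\|CT(s)h\|_K^2\,ds\le\beta\|h\|^2\quad\text{for all }h\in\operatorname{dom}(C),$$ or the same holds with $\liminf$ in place of $\limsup$. (iii) $\sigma(E)\subseteq\{z\in\mathbb C:\operatorname{Re}z\le0\}$ and there exist a Hilbert space $K$ and a densely defined linear operator $C:\operatorname{dom}(C)\subseteq H\to K$ such that (a) $\operatorname{dom}(E)\subseteq\operatorname{dom}(C)$; (b) for each $\varepsilon>0$ and $h\in H$ the map $\mathbb R\ni\xi\mapsto C(\varepsilon+i\xi-E)^{-1}h$ is Bochner measurable; (c) there exist $\alpha,\beta>0$ with $$\limsup_{\varepsilon\to0^+}\varepsilon\int_{-\infty}^\infty\|C(\varepsilon+i\xi-E)^{-1}h\|_K^2\,d\xi\le\beta\|h\|^2,\qquad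 \liminf_{\varepsilon\to0^+}\varepsilon\int_{-\infty}^\infty\|C(\varepsilon+i\xi-E)^{-1}h\|_K^2\,d\xi\ge\alpha\|h\|^2$$ for all $h\in H$.
   Context: $E$ is not assumed a priori to be densely defined; its resolvent set $\rho(E)$ is the set of $\lambda\in\mathbb C$ for which $(\lambda-E)^{-1}$ exists and is bounded on $H$, and $\sigma(E)=\mathbb C\setminus\rho(E)$. *)

(* Defs.v *)
From HB Require Import structures.
From mathcomp Require Import all_boot all_order all_algebra.
From mathcomp Require Import all_classical all_reals.
From mathcomp Require Import ereal topology normedtype measure lebesgue_measure lebesgue_integral.
From mathcomp.real_closed Require Import complex.

Set Implicit Arguments.
Unset Strict Implicit.
Unset Printing Implicit Defensive.

Import Order.TTheory GRing.Theory Num.Theory.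
Local Open Scope ring_scope.
Local Open Scope classical_set_scope.
Local Open Scope complex_scope.

Record preHilbert (R : realType) := PreHilbert {
  ph_car :> lmodType R[i];
  inner : ph_car -> ph_car -> R[i];
  inner_linear : forall (a : R[i]) (x y z : ph_car),
      inner (a *: x + y) z = a * inner x z + inner y z;
  inner_conj : forall x y : ph_car, inner y x = (inner x y)^*;
  inner_pos : forall x : ph_car, x != 0 -> 0 < complex.Re (inner x x)
}.

Definition hnorm (R : realType) (X : preHilbert R) (x : X) : R :=
  Num.sqrt (complex.Re (inner x x)).

Definition seq_lim (R : realType) (X : preHilbert R) (u : nat -> X) (l : X) :=
  forall e : R, 0 < e -> exists N : nat, forall n, (N <= n)%N -> hnorm (u n - l) < e.

Definition norm_complete (R : realType) (X : preHilbert R) :=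
  forall u : nat -> X,
    (forall e : R, 0 < e -> exists N : nat, forall m n, (N <= m)%N -> (N <= n)%N ->
        hnorm (u m - u n) < e) ->
    exists l : X, seq_lim u l.

Record hilbertSpace (R : realType) := HilbertSpace {
  hs_pre :> preHilbert R;
  hs_complete : norm_complete hs_pre
}.

Record linop (R : realType) (X Y : hilbertSpace R) := LinOp {
  ldom : set X;
  lapp : X -> Y     (* the action of A (only meaningful on dom(A)) *)
}.

Definition is_linop (R : realType) (X Y : hilbertSpace R) (A : linop X Y) :=
  ldom A 0 /\
  forall (a : R[i]) (x y : X), ldom A x -> ldom A y ->
    ldom A (a *: x + y) /\ lapp A (a *: x + y) = a *: lapp A x + lapp A y.

Definition densely_defined (R : realType) (X Y : hilbertSpace R) (A : linop X Y) :=
  forall (h : X) (e : R), 0 < e -> exists x, ldom A x /\ hnorm (h - x) < e.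

Definition bounded_op (R : realType) (X Y : hilbertSpace R) (f : X -> Y) :=
  (forall (a : R[i]) (x y : X), f (a *: x + y) = a *: f x + f y) /\
  exists M : R, forall x, hnorm (f x) <= M * hnorm x.

Definition right_lim0 (R : realType) (X : hilbertSpace R) (g : R -> X) (y : X) :=
  forall e : R, 0 < e -> exists d : R, 0 < d /\
    forall t : R, 0 < t -> t < d -> hnorm (g t - y) < e.

(** T = (T(t))_{t >= 0} is a C0-semigroup on X (values of T at t < 0 are
    irrelevant) *)
Definition c0_semigroup (R : realType) (X : hilbertSpace R) (T : R -> X -> X) :=
  (forall t, 0 <= t -> bounded_op (T t)) /\
  (forall h, T 0 h = h) /\
  (forall t s h, 0 <= t -> 0 <= s -> T (t + s) h = T t (T s h)) /\
  (forall h, right_lim0 (fun t => T t h) h).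

Definition generates (R : realType) (X : hilbertSpace R) (T : R -> X -> X)
    (E : linop X X) :=
  forall h : X,
    (ldom E h <-> exists y, right_lim0 (fun t => (t^-1)%:C *: (T t h - h)) y) /\
    (ldom E h -> right_lim0 (fun t => (t^-1)%:C *: (T t h - h)) (lapp E h)).

Definition similar_to_isometries (R : realType) (X : hilbertSpace R)
    (T : R -> X -> X) :=
  exists Rm Ri : X -> X,
    bounded_op Rm /\ bounded_op Ri /\
    (forall x, Rm (Ri x) = x) /\ (forall x, Ri (Rm x) = x) /\
    (forall t x, 0 <= t -> hnorm (Rm (T t (Ri x))) = hnorm x).

Definition is_resolvent (R : realType) (X : hilbertSpace R) (E : linop X X)
    (l : R[i]) (Rl : X -> X) :=
  bounded_op Rl /\
  (forall y, ldom E (Rl y) /\ l *: Rl y - lapp E (Rl y) = y) /\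
  (forall x, ldom E x -> Rl (l *: x - lapp E x) = x).

Definition resolvent_set (R : realType) (X : hilbertSpace R) (E : linop X X) :
  set R[i] := [set l | exists Rl, is_resolvent E l Rl].

Definition spectrum (R : realType) (X : hilbertSpace R) (E : linop X X) :
  set R[i] := ~` resolvent_set E.

(** (l - E)^{-1} y : the (unique, when l is in the resolvent set) x in dom(E)
    with l x - E x = y *)
Definition resolvent (R : realType) (X : hilbertSpace R) (E : linop X X)
    (l : R[i]) (y : X) : X :=
  xget 0 [set x | ldom E x /\ l *: x - lapp E x = y].

Definition simple_fun (R : realType) (X : hilbertSpace R) (f : R -> X) :=
  exists (n : nat) (v : 'I_n -> X) (A : 'I_n -> set R),
    (forall i, measurable (A i)) /\
    forall x, f x = \sum_(i < n | `[< A i x >]) v i.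

Definition bochner_measurable (R : realType) (X : hilbertSpace R) (D : set R)
    (f : R -> X) :=
  exists s : nat -> R -> X, (forall n, simple_fun (s n)) /\
    exists N : set R, measurable N /\ (@lebesgue_measure R N = 0)%E /\
      forall x, D x -> ~ N x -> seq_lim (fun n => s n x) (f x).

Definition limsup_pinfty (R : realType) (g : R -> \bar R) : \bar R :=
  ereal_inf [set ereal_sup [set g t | t in [set t | M <= t]] | M in [set: R]].

Definition liminf_pinfty (R : realType) (g : R -> \bar R) : \bar R :=
  ereal_sup [set ereal_inf [set g t | t in [set t | M <= t]] | M in [set: R]].

Definition limsup_0plus (R : realType) (g : R -> \bar R) : \bar R :=
  ereal_inf [set ereal_sup [set g t | t in [set t | 0 < t < d]] | d in [set d | 0 < d]].

Definition liminf_0plus (R : realType) (g : R -> \bar R) : \bar R :=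
  ereal_sup [set ereal_inf [set g t | t in [set t | 0 < t < d]] | d in [set d | 0 < d]].

Definition time_avg (R : realType) (H K : hilbertSpace R) (T : R -> H -> H)
    (C : linop H K) (h : H) (t : R) : \bar R :=
  ((t^-1)%:E * \int[@lebesgue_measure R]_(s in `[0%R, t]) ((hnorm (lapp C (T s h)))^+2)%:E)%E.

Definition resolvent_energy (R : realType) (H K : hilbertSpace R) (E : linop H H)
    (C : linop H K) (h : H) (eps : R) : \bar R :=
  (eps%:E * \int[@lebesgue_measure R]_(xi in [set: R])
      ((hnorm (lapp C (resolvent E (eps +i* xi) h)))^+2)%:E)%E.

(* Main.v *)
(* From (iii) to (i): an ultrafilter limit as [eps -> 0+] of [eps * int <C R(eps+i xi)x, C R(eps+i xi)y> d xi]
   is an equivalent scalar product for which [E] is skew, because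
   [C R(l)Ex = l C R(l)x - Cx] and the contribution of the constant [Cx] is [O(sqrt eps)]; implicit Euler steps
   then generate an isometric semigroup. From (ii) to (i): time averages are shift invariant, so
   [c|h| <= |T(t)h| <= C|h|], and an ultrafilter limit of Cesaro means of [<T(t)x, T(t)y>] is an equivalent
   invariant scalar product. Every equivalent scalar product is [<Rx, Ry>] for a positive square root [R].
   From (i) to (iii): for skew [G], [eps |u|^2 = Re <y, u>] with [u = (eps+i xi-G)^-1 y], and Cauchy-Riemann makes
   [int Re <y, u> d xi] independent of [eps]; for large [eps] it is comparable to [pi |y|^2]. *)
Require Import Defs.
From HB Require Import structures.
From mathcomp Require Import all_boot all_order all_algebra.
From mathcomp Require Import all_classical all_reals.
From mathcomp Require Import ereal topology normedtype sequences measure lebesgue_measure lebesgue_integral.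
From mathcomp Require Import numfun derive realfun exp trigo ftc measurable_realfun.
From mathcomp Require Import ring lra zify.
From mathcomp.real_closed Require Import complex.
Set Implicit Arguments.
Unset Strict Implicit.
Unset Printing Implicit Defensive.
Import Order.TTheory GRing.Theory Num.Theory.
Import numFieldNormedType.Exports.
Local Open Scope ring_scope.
Local Open Scope classical_set_scope.

(** All forms are treated as real bilinear forms invariant under ['i], the imaginary part being
    recovered by rotating one argument; estimates thus stay in an ordered field. The ultrafilter is
    there because limsup and liminf are not additive: the hypotheses control diagonal values only,
    and a linear limit is what turns them into a bilinear form. For a fixed eps energies may be
    infinite, and exceptional null sets depend on the vector, so the approximating forms satisfy
    each identity only eventually, with a threshold depending on the vectors. The obstacle to
    skewness is that [Cx] is constant in xi, hence not square integrable unless zero; in the cross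
    term, rewriting the resolvent by its own equation gains the missing decay [1/|xi|]. Density of
    the domain of [E] has to be derived: a vector [y = z - G z] orthogonal to the domain is
    orthogonal to [z], and skewness gives [z = 0]. For a skew generator, how large eps must be for
    the energy to compare with [pi |y|^2] depends on [y], which must lie in the domain; the
    extension to all [y] by density costs a factor 4 in each constant. *)

Section InnerProduct.
Variables (R : realType) (V : preHilbert R).
Implicit Types (x y z : V) (a : R[i]) (r : R).
Local Notation "r %:C" := (real_complex R r) : ring_scope.

Lemma innerDl x y z : inner (x + y) z = inner x z + inner y z.
Proof. by have := inner_linear 1 x y z; rewrite scale1r mul1r. Qed.

Lemma inner0l z : inner (0 : V) z = 0.
Proof. by apply: (addrI (inner 0 z)); rewrite -innerDl !addr0. Qed.

Lemma innerZl a x z : inner (a *: x) z = a * inner x z.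
Proof. by have := inner_linear a x 0 z; rewrite addr0 inner0l addr0. Qed.

Lemma innerNl x z : inner (- x) z = - inner x z.
Proof. by rewrite -scaleN1r innerZl mulN1r. Qed.

Definition innerE := (innerDl, innerZl, innerNl, inner0l).

(** Turns a vector identity into a scalar one: after pairing with an arbitrary [z], [ring] finishes.
    [rip_ext] serves the same purpose for real coefficients. *)
Lemma inner_ext x y : (forall z, inner x z = inner y z) -> x = y.
Proof.
move=> h; apply/eqP; rewrite -subr_eq0; apply/negPn/negP => /inner_pos.
by rewrite innerDl innerNl h subrr ltxx.
Qed.

Definition rip x y : R := complex.Re (inner x y).

Lemma ripC x y : rip x y = rip y x.
Proof. by rewrite /rip inner_conj; case: (inner y x). Qed.

Lemma ripDl x y z : rip (x + y) z = rip x z + rip y z.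
Proof. by rewrite /rip innerDl raddfD. Qed.

Lemma ripNl x z : rip (- x) z = - rip x z.
Proof. by rewrite /rip innerNl raddfN. Qed.

Lemma rip0l z : rip 0 z = 0.
Proof. by rewrite /rip inner0l. Qed.

Lemma ripZl r x z : rip (r%:C *: x) z = r * rip x z.
Proof. by rewrite /rip innerZl; case: (inner x z) => u v /=; rewrite mul0r subr0. Qed.

Lemma ripDr x y z : rip z (x + y) = rip z x + rip z y.
Proof. by rewrite !(ripC z) ripDl. Qed.

Lemma ripNr x z : rip z (- x) = - rip z x.
Proof. by rewrite !(ripC z) ripNl. Qed.

Lemma rip0r z : rip z 0 = 0.
Proof. by rewrite ripC rip0l. Qed.

Lemma ripZr r x z : rip z (r%:C *: x) = r * rip z x.
Proof. by rewrite !(ripC z) ripZl. Qed.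

Definition ripE := (ripDl, ripNl, ripZl, rip0l, ripDr, ripNr, ripZr, rip0r).

(** [inner] is conjugate linear on the right, so pairing with ['i *: y] rotates the imaginary part
    of [inner x y] into the real part. *)
Lemma inner_rip x y : inner x y = Complex (rip x y) (rip x ('i%C *: y)).
Proof.
rewrite /rip (inner_conj ('i%C *: y) x) innerZl (inner_conj x y).
by case: (inner x y) => u v /=; congr Complex; ring.
Qed.

Lemma rip_ext x y : (forall z, rip x z = rip y z) -> x = y.
Proof. by move=> h; apply: inner_ext => z; rewrite !inner_rip !h. Qed.

Lemma ripii x y : rip ('i%C *: x) ('i%C *: y) = rip x y.
Proof.
rewrite /rip innerZl (inner_conj ('i%C *: y) x) innerZl (inner_conj x y).
by case: (inner x y) => u v /=; ring.
Qed.

Lemma ripil x y : rip ('i%C *: x) y = - rip x ('i%C *: y).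
Proof.
by rewrite -[LHS]ripii scalerA -expr2 sqr_i scaleN1r ripNl.
Qed.

Lemma ripi0 x : rip ('i%C *: x) x = 0.
Proof. by have := ripil x x; rewrite (ripC x) => h; lra. Qed.

Lemma scale_cplx (u v : R) x :
  Complex u v *: x = u%:C *: x + v%:C *: ('i%C *: x).
Proof.
rewrite scalerA -scalerDl; congr (_ *: _).
by rewrite [LHS]complexE /= mulrC.
Qed.

Lemma rip_gt0 x : x != 0 -> 0 < rip x x.
Proof. exact: inner_pos. Qed.

Lemma rip_ge0 x : 0 <= rip x x.
Proof. by have [->|/rip_gt0/ltW//] := eqVneq x 0; rewrite rip0l. Qed.

Lemma rip_eq0 x : rip x x <= 0 -> x = 0.
Proof.
by move=> h; apply/eqP/negPn/negP => /rip_gt0; rewrite ltNge h.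
Qed.

Lemma hnorm_ge0 x : 0 <= hnorm x.
Proof. exact: sqrtr_ge0. Qed.

Lemma hnorm2 x : hnorm x ^+ 2 = rip x x.
Proof. by rewrite sqr_sqrtr ?rip_ge0. Qed.

Lemma hnorm0 : hnorm (0 : V) = 0.
Proof. by rewrite /hnorm inner0l sqrtr0. Qed.

Lemma hnorm_eq0 x : hnorm x <= 0 -> x = 0.
Proof.
move=> h; apply: rip_eq0; rewrite -hnorm2.
have -> : hnorm x = 0 by apply/le_anti; rewrite h hnorm_ge0.
by rewrite expr0n.
Qed.

Lemma le_hnorm x (c : R) : 0 <= c -> rip x x <= c ^+ 2 -> hnorm x <= c.
Proof.
by move=> c0 h; rewrite -(ler_sqr (hnorm_ge0 x) c0) hnorm2.
Qed.

Lemma eq_hnorm x (W : preHilbert R) (y : W) :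
  complex.Re (inner x x) = complex.Re (inner y y) -> hnorm x = hnorm y.
Proof. by rewrite /hnorm => ->. Qed.

Lemma hnormN x : hnorm (- x) = hnorm x.
Proof. by apply: eq_hnorm; rewrite -/(rip _ _) !ripE opprK. Qed.

Lemma hnorm_sub x y : hnorm (x - y) = hnorm (y - x).
Proof. by rewrite -hnormN opprB. Qed.

Lemma hnormZ r x : hnorm (r%:C *: x) = `|r| * hnorm x.
Proof.
rewrite /hnorm -!/(rip _ _) !ripE mulrA -expr2 sqrtrM ?sqr_ge0//.
by rewrite sqrtr_sqr.
Qed.

Lemma hnormi x : hnorm ('i%C *: x) = hnorm x.
Proof. by apply: eq_hnorm; rewrite -!/(rip _ _) ripii. Qed.

Lemma ripZc (u v : R) x : rip (Complex u v *: x) (Complex u v *: x) = (u ^+ 2 + v ^+ 2) * rip x x.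
Proof.
rewrite scale_cplx !ripE ripii (ripC x) ripi0 !mulr0 addr0 add0r; ring.
Qed.

Lemma CauchySchwarz x y : `|rip x y| <= hnorm x * hnorm y.
Proof.
rewrite -(ler_sqr (normr_ge0 _)) ?nnegrE ?mulr_ge0 ?hnorm_ge0// exprMn !hnorm2.
rewrite real_normK ?num_real//.
have [->|/rip_gt0 y0] := eqVneq y 0; first by rewrite !rip0r expr0n mulr0.
(* Up to the factor [rip y y], this vector is the component of [x] orthogonal to [y]; keeping the
   factor avoids a division. *)
have := rip_ge0 ((rip y y)%:C *: x - (rip x y)%:C *: y).
rewrite !ripE (ripC y x) => h.
have : 0 <= rip y y * (rip x x * rip y y - rip x y ^+ 2) by nra.
by rewrite pmulr_rge0// subr_ge0.
Qed.

Lemma rip_le x y : rip x y <= hnorm x * hnorm y.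
Proof. exact: le_trans (ler_norm _) (CauchySchwarz x y). Qed.

Lemma hnormD x y : hnorm (x + y) <= hnorm x + hnorm y.
Proof.
apply: le_hnorm; rewrite ?addr_ge0 ?hnorm_ge0//.
rewrite sqrrD !hnorm2 !ripE (ripC y x); have := rip_le x y; lra.
Qed.

Lemma hnormB x y : hnorm (x - y) <= hnorm x + hnorm y.
Proof. by rewrite -(hnormN y) hnormD. Qed.

Lemma hnorm_tri z x y : hnorm (x - y) <= hnorm (x - z) + hnorm (z - y).
Proof. by have := hnormD (x - z) (z - y); rewrite addrA subrK. Qed.

Lemma hnorm_le_add x y : hnorm x <= hnorm y + hnorm (x - y).
Proof. by rewrite -{1}(subrK y x) addrC hnormD. Qed.

Lemma parallelogram x y :
  rip (x + y) (x + y) + rip (x - y) (x - y) = 2 * (rip x x + rip y y).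
Proof. rewrite !ripE; ring. Qed.

Lemma hnorm_sqD x y : rip (x + y) (x + y) <= 2 * rip x x + 2 * rip y y.
Proof. have := parallelogram x y; have := rip_ge0 (x - y); lra. Qed.

Lemma rip_sum n (f : 'I_n -> V) z : rip (\sum_i f i) z = \sum_i rip (f i) z.
Proof.
apply: (big_ind2 (fun u v => rip u z = v)) => //; first exact: rip0l.
by move=> x1 x2 y1 y2 h1 h2; rewrite ripDl h1 h2.
Qed.

Lemma seq_lim_unique (u : nat -> V) l m : seq_lim u l -> seq_lim u m -> l = m.
Proof.
move=> ul um; apply/eqP; rewrite -subr_eq0; apply/eqP/hnorm_eq0.
rewrite leNgt; apply/negP => d0.
have d2 : 0 < hnorm (l - m) / 2 by lra.
have [N hN] := ul _ d2; have [M hM] := um _ d2.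
have := hN (maxn N M) (leq_maxl _ _); have := hM (maxn N M) (leq_maxr _ _).
have := hnorm_tri (u (maxn N M)) l m; rewrite (hnorm_sub l (u _)); lra.
Qed.

Lemma seq_lim_eq (u v : nat -> V) l : (forall n, u n = v n) -> seq_lim u l -> seq_lim v l.
Proof. by move=> h; have -> : u = v by apply/funext. Qed.

Lemma seq_lim_squeeze (u : nat -> V) l (e : nat -> R) :
  (forall n, hnorm (u n - l) <= e n) ->
  (forall d, 0 < d -> exists N, forall n, (N <= n)%N -> e n < d) -> seq_lim u l.
Proof.
move=> h he d d0; have [N hN] := he d d0; exists N => n Nn.
exact: le_lt_trans (h n) (hN n Nn).
Qed.

Lemma seq_limD (u v : nat -> V) l m :
  seq_lim u l -> seq_lim v m -> seq_lim (fun n => u n + v n) (l + m).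
Proof.
move=> ul vm d d0; have d2 : 0 < d / 2 by lra.
have [N hN] := ul _ d2; have [M hM] := vm _ d2.
exists (maxn N M) => n; rewrite geq_max => /andP[Nn Mn].
rewrite opprD addrACA; apply: le_lt_trans (hnormD _ _) _.
have := hN n Nn; have := hM n Mn; lra.
Qed.

Lemma seq_lim_cst (l : V) : seq_lim (fun=> l) l.
Proof. by move=> d d0; exists 0%N => n _; rewrite subrr hnorm0. Qed.

Lemma seq_lim_lip (W : preHilbert R) (f : V -> W) (M : R) (u : nat -> V) l :
  (forall x y, hnorm (f x - f y) <= M * hnorm (x - y)) ->
  seq_lim u l -> seq_lim (fun n => f (u n)) (f l).
Proof.
move=> hf ul d d0; have M1 : 0 < `|M| + 1 by have := normr_ge0 M; lra.
have [|N hN] := ul (d / (`|M| + 1)); first exact: divr_gt0.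
exists N => n /hN; rewrite ltr_pdivlMr// => h.
apply: le_lt_trans (hf _ _) _; apply: le_lt_trans h; rewrite mulrC ler_wpM2l ?hnorm_ge0//.
have := ler_norm M; lra.
Qed.

Lemma seq_limZ (u : nat -> V) l a : seq_lim u l -> seq_lim (fun n => a *: u n) (a *: l).
Proof.
apply: (@seq_lim_lip _ (fun x => a *: x) (Num.sqrt (complex.Re a ^+ 2 + complex.Im a ^+ 2))).
move=> x y; rewrite -scalerBr; case: a => p q.
by rewrite /hnorm -!/(rip _ _) ripZc sqrtrM// addr_ge0 ?sqr_ge0.
Qed.

Lemma seq_lim_hnorm_le (u : nat -> V) l (c : R) (N0 : nat) :
  (forall n, (N0 <= n)%N -> hnorm (u n) <= c) -> seq_lim u l -> hnorm l <= c.
Proof.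
move=> h ul; apply/ler_addgt0Pr => e e0; have [N hN] := ul _ e0.
have := hN (maxn N0 N) (leq_maxr _ _); have := h (maxn N0 N) (leq_maxl _ _).
have := hnorm_le_add l (u (maxn N0 N)); rewrite (hnorm_sub l (u _)); lra.
Qed.

End InnerProduct.

(** * Geometric convergence and fixed points *)

Section RealSeq.
Variable R : realType.

Lemma geom_small (C q e : R) : 0 <= q -> q < 1 -> 0 < e ->
  exists N, forall n, (N <= n)%N -> C * q ^+ n < e.
Proof.
move=> q0 q1 e0.
have : (fun n => C * q ^+ n) @ \oo --> (C * 0).
  by apply: cvgMr => //; apply: cvg_expr; rewrite ger0_norm.
rewrite mulr0 => /cvgrPdist_lt /(_ _ e0)[N _ hN]; exists N => n /hN /=.
by rewrite sub0r normrN => /(le_lt_trans (ler_norm _)).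
Qed.

Lemma inv_nat_small (e : R) : 0 < e -> exists N, forall n, (N <= n)%N -> n.+1%:R^-1 < e.
Proof.
move=> e0; exists (Num.truncn e^-1) => n hn; rewrite invf_plt ?posrE//.
apply: lt_le_trans (truncnS_gt _) _; by rewrite ler_nat ltnS.
Qed.

End RealSeq.

Section Completeness.
Variables (R : realType) (H : hilbertSpace R).

Lemma geom_cauchy (u : nat -> H) (C q : R) : 0 <= q -> q < 1 ->
  (forall n, hnorm (u n.+1 - u n) <= C * q ^+ n) ->
  exists l, seq_lim u l /\ forall n, hnorm (l - u n) <= C / (1 - q) * q ^+ n.
Proof.
move=> q0 q1 hu; have q1' : 0 < 1 - q by lra.
have C0 : 0 <= C by have := hu 0%N; rewrite expr0 mulr1; exact: le_trans (hnorm_ge0 _).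
(* Keeping the difference of powers makes the induction close; the bound by [q ^+ n] alone is not
   stable under adding a term. *)
have step n k : hnorm (u (n + k)%N - u n) <= C / (1 - q) * (q ^+ n - q ^+ (n + k)).
  elim: k => [|k ih]; first by rewrite addn0 subrr hnorm0 subrr mulr0.
  apply: le_trans (hnorm_tri (u (n + k)%N) _ _) _; rewrite addnS.
  apply: le_trans (lerD (hu _) ih) _; rewrite exprS.
  rewrite le_eqVlt; apply/orP; left; apply/eqP; field; lra.
have K0 : 0 <= C / (1 - q) by apply: divr_ge0 => //; lra.
have bd n k : hnorm (u (n + k)%N - u n) <= C / (1 - q) * q ^+ n.
  apply: le_trans (step n k) _; apply: ler_wpM2l => //.
  by have := exprn_ge0 (n + k) q0; lra.
have [l ul] : exists l, seq_lim u l.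
  apply: (@hs_complete R H) => e e0; have e2 : 0 < e / 2 by lra.
  have [N hN] := geom_small (C / (1 - q)) q0 q1 e2.
  exists N => m n Nm Nn.
  have := bd N (m - N)%N; have := bd N (n - N)%N; rewrite !subnKC// => h1 h2.
  have := hnorm_tri (u N) (u m) (u n); rewrite (hnorm_sub (u N) (u n)).
  have := hN N (leqnn _); lra.
exists l; split=> // n; apply: (@seq_lim_hnorm_le R H (fun k => u k - u n) _ _ n).
  by move=> k nk; have := bd n (k - n)%N; rewrite subnKC.
by apply: seq_limD ul _; exact: seq_lim_cst.
Qed.

(** The inversion device of the whole development: for [1 - Y] in the renorming, for [1 - V (h n)]
    in the Laplace transform, and for moving a resolvent from a real to a complex point. *)
Lemma banach_fixpoint (f : H -> H) (q : R) : 0 <= q -> q < 1 ->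
  (forall x y, hnorm (f x - f y) <= q * hnorm (x - y)) -> exists x, f x = x.
Proof.
move=> q0 q1 hf; pose u n := iter n f 0.
have [|l [ul _]] := @geom_cauchy u (hnorm (f 0 - 0)) q q0 q1.
  elim=> [|n ih]; first by rewrite expr0 mulr1.
  apply: le_trans (hf _ _) _; rewrite exprS mulrCA; exact: ler_wpM2l.
exists l; apply: (@seq_lim_unique R H (fun n => u n.+1)).
  exact: seq_lim_lip hf ul.
by move=> e /ul[N hN]; exists N => n Nn; apply: hN; exact: leqW.
Qed.

End Completeness.

(** * Riesz representation and density by orthogonality *)

Section Riesz.
Variables (R : realType) (H : hilbertSpace R).
Implicit Types (x y z : H).
Local Notation "r %:C" := (real_complex R r) : ring_scope.

(* The minimiser of [|x|^2 - 2 f x] over the closure of [D]; for [f = rip h] it is the orthogonal projection of [h]. *)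
Lemma riesz_closure (D : set H) (f : H -> R) (M : R) :
  D 0 -> (forall r x y, D x -> D y -> D (r%:C *: x + y)) ->
  (forall r x y, f (r%:C *: x + y) = r * f x + f y) ->
  (forall x, f x <= M * hnorm x) ->
  exists u y, (forall n : nat, D (u n)) /\ seq_lim u y /\ forall x, D x -> rip y x = f x.
Proof.
move=> D0 DD fl fM; pose phi x := rip x x - 2 * f x.
have phi_ge x : - M ^+ 2 <= phi x.
  by rewrite /phi -hnorm2; have := fM x; have := sqr_ge0 (hnorm x - M); nra.
pose S := [set phi x | x in D].
have Sinf : has_inf S.
  split; first by exists (phi 0), 0.
  by exists (- M ^+ 2) => _ [x _ <-].
have mle x : D x -> inf S <= phi x.
  by move=> Dx; apply: ge_inf; [exact: (proj2 Sinf)|exists x].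
have [iv [iv0 ivs]] : exists iv : nat -> R, (forall n, 0 < iv n) /\
    forall e, 0 < e -> exists N, forall n, (N <= n)%N -> iv n < e.
  exists (fun n => n.+1%:R^-1); split=> [n|e e0]; first by rewrite invr_gt0.
  exact: inv_nat_small.
have /boolp.choice[u hu] : forall n, exists x, D x /\ phi x < inf S + iv n.
  move=> n; have n0 := iv0 n.
  by have [_ [x Dx <-] h] := inf_adherent n0 Sinf; exists x.
have f0 : f 0 = 0 by have := fl 1 0 0; rewrite scaler0 addr0; lra.
have fZ r x : f (r%:C *: x) = r * f x by have := fl r x 0; rewrite addr0 f0 addr0.
have fD x y : f (x + y) = f x + f y by have := fl 1 x y; rewrite scale1r mul1r.
have DZ r x : D x -> D (r%:C *: x) by move=> Dx; rewrite -[_ *: _]addr0; exact: DD.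
have D_D x y : D x -> D y -> D (x + y).
  by move=> Dx Dy; have := DD 1 x y Dx Dy; rewrite scale1r.
(* Parallelogram law at the midpoint, where [phi] is at least the infimum: a minimising sequence is
   Cauchy. *)
have para x y : D x -> D y -> rip (x - y) (x - y) <= 2 * (phi x - inf S) + 2 * (phi y - inf S).
  move=> Dx Dy; have := mle _ (DZ (2^-1) _ (D_D _ _ Dx Dy)).
  rewrite /phi fZ fD !ripE (ripC y x); lra.
have [y uy] : exists y, seq_lim u y.
  apply: (@hs_complete R H) => e e0.
  have e4 : 0 < e ^+ 2 / 4 by rewrite divr_gt0 ?exprn_gt0.
  have [N hN] := ivs _ e4; exists N => m n Nm Nn.
  rewrite -(ltr_sqr) ?nnegrE ?hnorm_ge0 ?(ltW e0)// hnorm2.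
  have [Dm um] := hu m; have [Dn un] := hu n.
  have := para _ _ Dm Dn; have := hN m Nm; have := hN n Nn; lra.
exists u, y; split; first by move=> n; case: (hu n).
split=> // z Dz.
(* First variation at the minimiser: [phi (y + t z) - phi y] is nonnegative. It is tested on
   [u n + t z], which stays in [D], because the limit [y] need not lie in [D]. *)
have quad (t : R) : 0 <= t ^+ 2 * rip z z + 2 * t * (rip y z - f z).
  rewrite -(lerD2r 0) add0r; apply/ler_addgt0Pr => e e0.
  have z1 : 0 < 4 * (`|t| + 1) * (hnorm z + 1).
    by rewrite !mulr_gt0// ltr_pwDr ?hnorm_ge0.
  have e2 : 0 < e / 2 by lra.
  have [N1 hN1] := ivs _ e2; have [N2 hN2] := uy _ (divr_gt0 e0 z1).
  pose n := maxn N1 N2.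
  have [Dn un] := hu n.
  have := mle _ (D_D _ _ Dn (DZ t _ Dz)); rewrite /phi fD fZ !ripE (ripC z).
  have := hN1 n (leq_maxl _ _); have := hN2 n (leq_maxr _ _).
  rewrite ltr_pdivlMr// => h2 h1 h3.
  have : 2 * (t * (rip (u n) z - rip y z)) <= e / 2.
    have -> : rip (u n) z - rip y z = rip (u n - y) z by rewrite !ripE.
    have := CauchySchwarz (u n - y) z => cs.
    have : t * rip (u n - y) z <= `|t| * (hnorm (u n - y) * hnorm z).
      by apply: le_trans (ler_norm _) _; rewrite normrM ler_wpM2l.
    have := hnorm_ge0 z; have := hnorm_ge0 (u n - y); have := normr_ge0 t.
    move: h2; set p := hnorm _; set q := hnorm z; set s := `|t| => h2 s0 p0 q0 h4.
    have : 0 <= p * s by exact: mulr_ge0.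
    have : 0 <= p * q by exact: mulr_ge0.
    nra.
  move: un; rewrite /phi; nra.
set d := rip y z - f z in quad; suff : d = 0 by rewrite /d => /eqP; rewrite subr_eq0 => /eqP.
have z1 : 0 < rip z z + 1 by have := rip_ge0 z; lra.
(* The [+ 1] in the denominator gives a usable step even for [z = 0]; the quadratic becomes a
   negative multiple of [d ^+ 2]. *)
have := quad (- d / (rip z z + 1)).
have -> : (- d / (rip z z + 1)) ^+ 2 * rip z z + 2 * (- d / (rip z z + 1)) * d =
  - (d ^+ 2 * ((rip z z + 2) / (rip z z + 1) ^+ 2)) by field; lra.
rewrite oppr_ge0 pmulr_lle0; last by rewrite divr_gt0 ?exprn_gt0//; lra.
by move=> d2; apply/eqP; rewrite -sqrf_eq0 eq_le d2 sqr_ge0.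
Qed.

Lemma riesz (f : H -> R) (M : R) :
  (forall r x y, f (r%:C *: x + y) = r * f x + f y) ->
  (forall x, f x <= M * hnorm x) -> exists y, forall x, rip y x = f x.
Proof.
move=> fl fM.
have [//|//|u [y [_ [_ h]]]] := @riesz_closure setT f M _ _ fl fM.
by exists y => x; exact: h.
Qed.

(** The Riesz vector of [rip h] on the closure of [D] is the orthogonal projection of [h]. Its
    residual is orthogonal to [D], hence zero, and the minimising sequence then approximates [h]. *)
Lemma dense_of_orthogonal (D : set H) :
  D 0 -> (forall r x y, D x -> D y -> D (r%:C *: x + y)) ->
  (forall y, (forall x, D x -> rip y x = 0) -> y = 0) ->
  forall (h : H) (e : R), 0 < e -> exists x, D x /\ hnorm (h - x) < e.
Proof.
move=> D0 DD Dp h e e0.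
have [||u [y [Du [uy hy]]]] := @riesz_closure D (rip h) (hnorm h) D0 DD.
- by move=> r x y; rewrite !ripE.
- by move=> x; exact: rip_le.
have yh : y = h.
  apply/eqP; rewrite -subr_eq0; apply/eqP/Dp => x Dx.
  by rewrite !ripE hy// subrr.
have [N hN] := uy e e0; exists (u N); split=> //.
by rewrite hnorm_sub -yh hN.
Qed.

End Riesz.

Section BoundedOps.
Variables (R : realType) (X Y : hilbertSpace R) (f : X -> Y).
Hypothesis bf : bounded_op f.

Lemma bop_lin a x y : f (a *: x + y) = a *: f x + f y.
Proof. by case: bf. Qed.

Lemma bopD x y : f (x + y) = f x + f y.
Proof. by have := bop_lin 1 x y; rewrite !scale1r. Qed.

Lemma bop0 : f 0 = 0.
Proof. by apply: (addrI (f 0)); rewrite -bopD !addr0. Qed.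

Lemma bopZ a x : f (a *: x) = a *: f x.
Proof. by have := bop_lin a x 0; rewrite bop0 !addr0. Qed.

Lemma bopN x : f (- x) = - f x.
Proof. by rewrite -scaleN1r bopZ scaleN1r. Qed.

Lemma bopB x y : f (x - y) = f x - f y.
Proof. by rewrite bopD bopN. Qed.

Lemma bop_bound : exists M : R, 0 < M /\ forall x, hnorm (f x) <= M * hnorm x.
Proof.
case: bf => _ [M hM]; exists (`|M| + 1); split; first by rewrite ltr_pwDr.
move=> x; apply: le_trans (hM x) _; apply: ler_wpM2r; first exact: hnorm_ge0.
by have := ler_norm M; lra.
Qed.

Lemma bop_seq_lim (u : nat -> X) l : seq_lim u l -> seq_lim (fun n => f (u n)) (f l).
Proof.
have [M [_ hM]] := bop_bound.
by apply: (@seq_lim_lip _ _ _ _ M) => x y; rewrite -bopB.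
Qed.

End BoundedOps.

Lemma bounded_op_comp (R : realType) (X Y Z : hilbertSpace R) (f : X -> Y) (g : Y -> Z) :
  bounded_op f -> bounded_op g -> bounded_op (fun x => g (f x)).
Proof.
move=> bf bg; split; first by move=> a x y; rewrite (bop_lin bf) (bop_lin bg).
have [M [M0 hM]] := bop_bound bf; have [N [N0 hN]] := bop_bound bg.
exists (N * M) => x; apply: le_trans (hN _) _; rewrite -mulrA; apply: ler_wpM2l => //.
exact: ltW.
Qed.

(** * Square roots and equivalent scalar products *)

Section EquivalentForm.
Variables (R : realType) (H : hilbertSpace R).
Implicit Types (x y z : H).
Local Notation "r %:C" := (real_complex R r) : ring_scope.

(* Square root of [1 - A] for a self-adjoint [A] with [|A| <= th < 1]: the operator [Y] solving
   [Y = (A + Y^2) / 2] satisfies [(1 - Y)^2 = 1 - A]; [y] solves the scalar equation for [th]. *)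
Lemma half_square_fixpoint (A : H -> H) (th : R) : 0 <= th -> th < 1 ->
  (forall a x z, A (a *: x + z) = a *: A x + A z) ->
  (forall x z, rip (A x) z = rip x (A z)) ->
  (forall x, hnorm (A x) <= th * hnorm x) ->
  exists (Y : H -> H) (y : R), [/\ 0 <= y < 1,
   forall a x z, Y (a *: x + z) = a *: Y x + Y z,
   forall x z, rip (Y x) z = rip x (Y z),
   forall x, hnorm (Y x) <= y * hnorm x &
   forall x, Y (Y x) = 2%:C *: Y x - A x].
Proof.
move=> th0 th1 Al As Ab.
pose y := 1 - Num.sqrt (1 - th).
have s2 : Num.sqrt (1 - th) ^+ 2 = 1 - th by rewrite sqr_sqrtr//; lra.
have s0 : 0 < Num.sqrt (1 - th) by rewrite sqrtr_gt0; lra.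
have s1 : Num.sqrt (1 - th) <= 1 by nra.
have y0 : 0 <= y by rewrite /y; lra.
have y1 : y < 1 by rewrite /y; lra.
(* Fixed-point equation for the bound: if [Yn n] has norm at most [y], the next iterate has norm at
   most [(th + y ^+ 2) / 2 = y]. As [y < 1], the increments decay geometrically too. *)
have yE : 2 * y = th + y ^+ 2 by rewrite /y; nra.
pose Yn := fix F n (x : H) : H :=
  if n is m.+1 then (2^-1)%:C *: (A x + F m (F m x)) else 0.
have YnS n x : Yn n.+1 x = (2^-1)%:C *: (A x + Yn n (Yn n x)) by [].
have Ynl n : forall a x z, Yn n (a *: x + z) = a *: Yn n x + Yn n z.
  elim: n => [|n ih] a x z; first by rewrite /= scaler0 addr0.
  rewrite !YnS Al !ih; apply: inner_ext => w; rewrite !innerE; ring.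
have Yns n : forall x z, rip (Yn n x) z = rip x (Yn n z).
  elim: n => [|n ih] x z; first by rewrite /= rip0l rip0r.
  by rewrite !YnS !ripE As !ih.
have Ynb n : forall x, hnorm (Yn n x) <= y * hnorm x.
  elim: n => [|n ih] x; first by rewrite /= hnorm0 mulr_ge0 ?hnorm_ge0.
  rewrite YnS hnormZ ger0_norm; last lra.
  have := hnormD (A x) (Yn n (Yn n x)); have := Ab x.
  have := ih (Yn n x); have := ih x; have := hnorm_ge0 x; nra.
have YnB n x z : Yn n (x - z) = Yn n x - Yn n z.
  by rewrite -[LHS]/(Yn n (x - z)) addrC -scaleN1r Ynl scaleN1r addrC.
have Ynd n : forall x, hnorm (Yn n.+1 x - Yn n x) <= hnorm x * y ^+ n.
  elim: n => [|n ih] x.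
    rewrite /= subr0 addr0 expr0 mulr1 hnormZ ger0_norm; last lra.
    by have := Ab x; have := hnorm_ge0 x; nra.
  (* Difference of squares without commutation: [Y'^2 - Y^2 = Y' (Y' - Y) + (Y' - Y) Y]. Each
     summand is at most [hnorm x * y ^+ n.+1], and the factor one half absorbs their number. *)
  have -> : Yn n.+2 x - Yn n.+1 x = (2^-1)%:C *: (Yn n.+1 (Yn n.+1 x - Yn n x)
      + (Yn n.+1 (Yn n x) - Yn n (Yn n x))).
    rewrite YnB [Yn n.+2 x]YnS [X in _ - X = _]YnS; apply: inner_ext => w; rewrite !innerE; ring.
  rewrite hnormZ ger0_norm; last lra.
  set p := Yn n.+1 (_ - _); set q := _ - _ in p *; have := hnormD p (Yn n.+1 (Yn n x) - Yn n (Yn n x)).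
  have := Ynb n.+1 q; have := ih x; have := ih (Yn n x); have := Ynb n x.
  rewrite exprS -/p -/q; have := exprn_ge0 n y0; nra.
have /boolp.choice[Y YE] : forall x, exists l, seq_lim (fun n => Yn n x) l /\
    forall n, hnorm (l - Yn n x) <= hnorm x / (1 - y) * y ^+ n.
  by move=> x; exact: geom_cauchy y0 y1 (fun n => Ynd n x).
have Yl a x z : Y (a *: x + z) = a *: Y x + Y z.
  apply: (seq_lim_unique (proj1 (YE _))).
  apply: (@seq_lim_eq _ _ (fun n => a *: Yn n x + Yn n z)) => [n|]; first by rewrite Ynl.
  apply: seq_limD (proj1 (YE z)).
  exact: seq_limZ (proj1 (YE x)).
have Yb x : hnorm (Y x) <= y * hnorm x.
  exact: (@seq_lim_hnorm_le _ _ _ _ _ 0) (fun n _ => Ynb n x) (proj1 (YE x)).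
exists Y, y; split=> //; first by rewrite y0.
- move=> x z; apply/eqP; rewrite -subr_eq0 -normr_le0; apply/ler_addgt0Pr => e e0.
  have [N hN] := geom_small (2 * (hnorm x * hnorm z / (1 - y))) y0 y1 e0.
  have -> : rip (Y x) z - rip x (Y z) = rip (Y x - Yn N x) z - rip x (Y z - Yn N z).
    by rewrite !ripE Yns; ring.
  rewrite add0r; apply/ltW; apply: le_lt_trans (hN N (leqnn _)).
  apply: le_trans (ler_normB _ _) _.
  have := CauchySchwarz (Y x - Yn N x) z; have := CauchySchwarz x (Y z - Yn N z).
  have := ler_wpM2l (hnorm_ge0 x) (proj2 (YE z) N).
  have := ler_wpM2l (hnorm_ge0 z) (proj2 (YE x) N).
  have -> : hnorm z * (hnorm x / (1 - y) * y ^+ N) = hnorm x * hnorm z / (1 - y) * y ^+ N by ring.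
  have -> : hnorm x * (hnorm z / (1 - y) * y ^+ N) = hnorm x * hnorm z / (1 - y) * y ^+ N by ring.
  rewrite (mulrC (hnorm z)); lra.
- move=> x; have hl : seq_lim (fun n => Yn n.+1 x) (Y x).
    by move=> e /(proj1 (YE x))[N hN]; exists N => n Nn; apply: hN; exact: leqW.
  have hyy : seq_lim (fun n => Yn n (Yn n x)) (Y (Y x)).
    pose C := (y * (hnorm x / (1 - y)) + hnorm (Y x) / (1 - y)).
    apply: (@seq_lim_squeeze _ _ _ _ (fun n => C * y ^+ n)) => [n|d d0]; last exact: geom_small.
    have -> : Yn n (Yn n x) - Y (Y x) = Yn n (Yn n x - Y x) + (Yn n (Y x) - Y (Y x)).
      by rewrite YnB; apply: inner_ext => w; rewrite !innerE; ring.
    apply: le_trans (hnormD _ _) _; rewrite (hnorm_sub _ (Y (Y x))) /C.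
    have := Ynb n (Yn n x - Y x); rewrite (hnorm_sub (Yn n x)).
    have := proj2 (YE (Y x)) n; have := ler_wpM2l y0 (proj2 (YE x) n); lra.
  have hr : seq_lim (fun n => Yn n.+1 x) ((2^-1)%:C *: (A x + Y (Y x))).
    apply: (@seq_lim_lip _ _ H (fun x => (2^-1)%:C *: x) 1 (fun n => A x + Yn n (Yn n x))).
      move=> u v; rewrite -scalerBr hnormZ ger0_norm; last lra.
      have := hnorm_ge0 (u - v); lra.
    by apply: seq_limD => //; exact: seq_lim_cst.
  have h := seq_lim_unique hl hr; rewrite {2}h.
  by apply: rip_ext => w; rewrite !ripE; lra.
Qed.

(* Sz.-Nagy's renorming step: an equivalent scalar product [b] is the pullback of the original one. *)
Lemma equivalent_form (b : H -> H -> R) (a c : R) : 0 < a -> 0 < c ->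
  (forall r x y z, b (r%:C *: x + y) z = r * b x z + b y z) ->
  (forall x y, b x y = b y x) ->
  (forall x y, b ('i%C *: x) ('i%C *: y) = b x y) ->
  (forall x, a * rip x x <= b x x) -> (forall x, b x x <= c * rip x x) ->
  exists Rm Ri : H -> H, [/\ bounded_op Rm, bounded_op Ri,
    forall x, Rm (Ri x) = x, forall x, Ri (Rm x) = x &
    forall x, rip (Rm x) (Rm x) = b x x].
Proof.
move=> a0 c0 bl bC bi ba bc.
(* Taking [a + c] instead of [c] forces [a / k < 1], so that [th] is positive and may be inverted in
   the norm bound for [A]. *)
pose k := a + c; have k0 : 0 < k by rewrite /k; lra.
have bk x : b x x <= k * rip x x.
  by have := bc x; have := rip_ge0 x; rewrite /k; nra.
pose th := 1 - a / k.
have thk : a / k < 1 by rewrite ltr_pdivrMr// /k; lra.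
have thk0 : 0 < a / k by exact: divr_gt0.
have th0 : 0 < th by rewrite /th; lra.
have th1 : th < 1 by rewrite /th; lra.
have b0 z : b 0 z = 0 by have := bl 1 0 0 z; rewrite scaler0 addr0; lra.
have bD x y z : b (x + y) z = b x z + b y z by have := bl 1 x y z; rewrite scale1r mul1r.
have bZ r x z : b (r%:C *: x) z = r * b x z by have := bl r x 0 z; rewrite addr0 b0 addr0.
have bDr x y z : b z (x + y) = b z x + b z y by rewrite !(bC z) bD.
have bZr r x z : b z (r%:C *: x) = r * b z x by rewrite !(bC z) bZ.
have bN x z : b (- x) z = - b x z.
  by have := bD x (- x) z; rewrite subrr b0; lra.
have bNr x z : b z (- x) = - b z x by rewrite !(bC z) bN.
have b_ge0 x : 0 <= b x x.
  by apply: le_trans (ba x); rewrite mulr_ge0 ?rip_ge0 ?ltW.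
have bpol x y : 2 * b x y <= k * (rip x x + rip y y).
  have := b_ge0 (x - y); rewrite !(bD, bDr, bN, bNr) (bC y x).
  have := bk x; have := bk y; lra.
have bbound x y : b x y <= (k * hnorm x) * hnorm y.
  have [->|x0] := eqVneq x 0; first by rewrite b0 hnorm0 mulr0 mul0r.
  have [->|y0] := eqVneq y 0; first by rewrite bC b0 hnorm0 mulr0.
  have nx : 0 < hnorm x by rewrite sqrtr_gt0 rip_gt0.
  have ny : 0 < hnorm y by rewrite sqrtr_gt0 rip_gt0.
  have := bpol ((hnorm x)^-1%:C *: x) ((hnorm y)^-1%:C *: y).
  rewrite bZ bZr !ripE -!hnorm2.
  have nV (t : R) : 0 < t -> t^-1 * (t^-1 * t ^+ 2) = 1 by move=> t0; field; lra.
  rewrite !nV// => h.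
  have -> : b x y = (hnorm x)^-1 * ((hnorm y)^-1 * b x y) * (hnorm x * hnorm y).
    by field; rewrite !lt0r_neq0.
  by rewrite -(mulrA k) ler_pM2r ?mulr_gt0//; lra.
(* [A] represents [rip - b / k], so [b x y = k * rip (x - A x) y], and the two bounds on [b] become
   [0 <= A <= th] in the sense of forms. *)
have /boolp.choice[A AE] : forall x, exists l, forall y, rip l y = rip x y - b x y / k.
  move=> x; apply: (@riesz _ _ _ (hnorm x + hnorm x)).
    by move=> r u v; rewrite !ripE (bC x) bl !(bC x); ring.
  move=> y; have := rip_le x y; have := bbound (- x) y.
  rewrite bN hnormN => h1 h2; rewrite mulrDl; apply: lerD => //.
  by rewrite -mulNr ler_pdivrMr// mulrC mulrA.
have Ai x : A ('i%C *: x) = 'i%C *: A x.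
  apply: rip_ext => z; rewrite ripil !AE ripil.
  suff -> : b ('i%C *: x) z = - b x ('i%C *: z) by ring.
  by rewrite -[LHS]bi scalerA -expr2 sqr_i scaleN1r bN.
have Al p x z : A (p *: x + z) = p *: A x + A z.
  case: p => u v; rewrite (scale_cplx u v x) (scale_cplx u v (A x)) -Ai; apply: rip_ext => w.
  by rewrite !(ripE, AE) !(bD, bZ); ring.
have As x z : rip (A x) z = rip x (A z) by rewrite (ripC x) !AE bC (ripC x).
have Aq z : 0 <= rip (A z) z <= th * rip z z.
  rewrite AE /th mulrBl mul1r subr_ge0 ler_pdivrMr// mulrC bk /=.
  by rewrite lerD2l lerN2 mulrAC ler_pM2r ?invr_gt0.
have Ab x : hnorm (A x) <= th * hnorm x.
  apply: le_hnorm; first by rewrite mulr_ge0 ?hnorm_ge0 ?ltW.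
  rewrite exprMn hnorm2.
  (* The form bound yields the norm bound: compare the form of [A] at [x + y] and at [x - y], then
     put [y = A x / th]. *)
  have key y : 4 * rip (A x) y <= 2 * th * (rip x x + rip y y).
    have /andP[_] := Aq (x + y); have /andP[] := Aq (x - y); have := rip_ge0 (x - y).
    have Ayx : rip (A y) x = rip (A x) y by rewrite As ripC.
    have AB u v : A (u + v) = A u + A v by have := Al 1 u v; rewrite !scale1r.
    have A0 : A 0 = 0 by apply: (addrI (A 0)); rewrite -AB !addr0.
    have AN u : A (- u) = - A u by have := Al (-1) u 0; rewrite A0 !addr0 !scaleN1r.
    rewrite !(AB, AN) !ripE Ayx (ripC y x) => h1 h2 h3 h4.
    have : 0 <= th * (rip x x + - rip x y + - (rip x y + - rip y y)) by apply: mulr_ge0; lra.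
    lra.
  have := key (th^-1%:C *: A x); rewrite !ripE => h.
  have thV : th * th^-1 = 1 by rewrite mulfV ?lt0r_neq0.
  have {}h : 2 * (th^-1 * rip (A x) (A x)) <= 2 * th * rip x x.
    have E : 2 * th * (th^-1 * (th^-1 * rip (A x) (A x))) = 2 * (th^-1 * rip (A x) (A x)).
      by rewrite !mulrA -(mulrA 2) thV mulr1.
    by move: h; rewrite mulrDr E; lra.
  have := ler_wpM2l (ltW th0) h.
  have -> : th * (2 * (th^-1 * rip (A x) (A x))) = 2 * rip (A x) (A x) * (th * th^-1) by ring.
  rewrite thV; lra.
have [Y [y [/andP[y0 y1] Yl Ys Yb YY]]] := half_square_fixpoint (ltW th0) th1 Al As Ab.
pose P x := x - Y x.
have PP x : rip (P x) (P x) = b x x / k.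
  have -> : rip (P x) (P x) = rip x x - 2 * rip (Y x) x + rip (Y (Y x)) x.
    by rewrite /P !ripE (ripC x) Ys (Ys (Y x)) ; ring.
  by rewrite YY !ripE AE; ring.
have Pl p x z : P (p *: x + z) = p *: P x + P z.
  by rewrite /P Yl; apply: inner_ext => w; rewrite !innerE; ring.
have Pinj x z : P x = P z -> x = z.
  move=> Pxz; apply/eqP; rewrite -subr_eq0; apply/eqP/rip_eq0.
  have P0 : P (x - z) = 0 by have := Pl (-1) z x; rewrite !scaleN1r !(addrC (- _)) Pxz subrr.
  have := PP (x - z); rewrite P0 rip0l => /esym/eqP; rewrite mulf_eq0 invr_eq0.
  rewrite (gt_eqF k0) orbF => /eqP h.
  by have := ba (x - z); rewrite h pmulr_rle0.
(* [P = 1 - Y] is onto because [x = z + Y x] is solvable: [Y] contracts by [y < 1]. *)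
have /boolp.choice[Pi PPi] : forall z, exists x, P x = z.
  move=> z; have [x1 x2|x xE] := @banach_fixpoint _ H (fun x => z + Y x) y y0 y1.
    rewrite opprD addrACA subrr add0r.
    have -> : Y x1 - Y x2 = Y (x1 - x2) by have := Yl (-1) x2 x1; rewrite !scaleN1r !(addrC (- _)).
    exact: Yb.
  by exists x; rewrite /P -{1}xE addrK.
have PiP x : Pi (P x) = x by apply: Pinj; rewrite PPi.
have Pil p x z : Pi (p *: x + z) = p *: Pi x + Pi z.
  by apply: Pinj; rewrite Pl !PPi.
(* [P] realises [b / k]; the factor [sqrt k] restores [b]. *)
pose s := Num.sqrt k; have s0 : 0 < s by rewrite sqrtr_gt0.
have s2 : s ^+ 2 = k by rewrite sqr_sqrtr// ltW.
have sV : s * s^-1 = 1 by rewrite mulfV ?lt0r_neq0.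
have sC (u v : R) x : u * v = 1 -> u%:C *: (v%:C *: x) = x.
  by move=> uv; apply: rip_ext => w; rewrite !ripE mulrA uv mul1r.
have PZ p x : P (p *: x) = p *: P x.
  have P0 : P 0 = 0 by apply: (addrI (P 0)); have := Pl 1 0 0; rewrite !scale1r !addr0.
  by have := Pl p x 0; rewrite P0 !addr0.
have RR x : rip (s%:C *: P x) (s%:C *: P x) = b x x.
  by rewrite ripZl ripZr PP mulrA -expr2 s2; field; rewrite lt0r_neq0.
have RiE z : P (Pi (s^-1%:C *: z)) = s^-1%:C *: z by [].
exists (fun x => s%:C *: P x), (fun z => Pi (s^-1%:C *: z)); split.
- split; first by move=> p x z; rewrite Pl; apply: inner_ext => w; rewrite !innerE; ring.
  exists (Num.sqrt c) => x; apply: le_hnorm; first by rewrite mulr_ge0 ?sqrtr_ge0 ?hnorm_ge0.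
  by rewrite RR exprMn hnorm2 sqr_sqrtr ?(ltW c0).
- split.
    move=> p x z; rewrite -Pil; congr Pi; apply: inner_ext => w; rewrite !innerE; ring.
  exists (Num.sqrt a^-1) => x; apply: le_hnorm; first by rewrite mulr_ge0 ?sqrtr_ge0 ?hnorm_ge0.
  rewrite exprMn hnorm2 sqr_sqrtr ?invr_ge0 ?(ltW a0)// ler_pdivlMl//.
  by apply: le_trans (ba _) _; rewrite -RR RiE sC.
- by move=> x; rewrite RiE sC.
- by move=> x; rewrite sC ?PiP// mulrC.
- exact: RR.
Qed.
End EquivalentForm.

(** * Linear limits along an ultrafilter *)

Section FilterLimit.
Variables (R : realType) (T : Type) (F : set_system T).
Context {FF : ProperFilter F}.

Definition bounded_near (g : T -> R) := exists M : R, F [set t | `|g t| <= M].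

Lemma bounded_nearD g h : bounded_near g -> bounded_near h ->
  bounded_near (fun t => g t + h t).
Proof.
move=> [M hM] [N hN]; exists (M + N); apply: filterS2 hM hN => t /= h1 h2.
by apply: le_trans (ler_normD _ _) _; exact: lerD.
Qed.

Lemma bounded_nearZ c g : bounded_near g -> bounded_near (fun t => c * g t).
Proof.
move=> [M hM]; exists (`|c| * M); apply: filterS hM => t /= h1.
by rewrite normrM ler_wpM2l.
Qed.

Lemma filter_limit_functional : exists L : (T -> R) -> R,
  [/\ forall g h, bounded_near g -> bounded_near h -> L (fun t => g t + h t) = L g + L h,
      forall c g, bounded_near g -> L (fun t => c * g t) = c * L g,
      forall g c, bounded_near g -> F [set t | g t <= c] -> L g <= c &
      forall g c, bounded_near g -> F [set t | c <= g t] -> c <= L g].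
Proof.
have [G [UG FG]] := ultraFilterLemma FF.
have cvgG (g : T -> R) : bounded_near g -> exists l : R, g @ G --> l.
  move=> [M hM]; have := @segment_compact R (- M) M.
  move=> /(_ (g @ G) _); case.
    by apply: FG; apply: filterS hM => t /=; rewrite in_itv /= ler_norml.
  move=> l [_ cl]; exists l => B Bl.
  have [//|GB] := in_ultra_setVsetC (g @^-1` B) UG.
  have [z [/= h1 h2]] := cl (~` B) B GB Bl.
  by case: h1.
pose L (g : T -> R) : R := lim (g @ G).
have LE g : bounded_near g -> g @ G --> L g.
  by move=> /cvgG[l hl]; rewrite /L (cvg_lim _ hl).
exists L; split.
- move=> g h bg bh; apply: (@cvg_lim _ _) => //.
  by apply: cvgD; exact: LE.
- move=> c g bg; apply: (@cvg_lim _ _) => //.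
  by apply: cvgMr => //; exact: LE.
- move=> g c bg Fc; rewrite leNgt; apply/negP => cL.
  have /cvgrPdist_lt /(_ (L g - c)) := LE g bg.
  rewrite subr_gt0 => /(_ cL) h1.
  have [t [/= h2 h3]] := @filter_ex _ G _ _ (filterI h1 (FG _ Fc)).
  by have := ler_norm (L g - g t); lra.
- move=> g c bg Fc; rewrite leNgt; apply/negP => cL.
  have /cvgrPdist_lt /(_ (c - L g)) := LE g bg.
  rewrite subr_gt0 => /(_ cL) h1.
  have [t [/= h2 h3]] := @filter_ex _ G _ _ (filterI h1 (FG _ Fc)).
  by have := ler_norm (g t - L g); rewrite distrC; lra.
Qed.

End FilterLimit.

(** * Dyadic grids *)

Section Dyadic.
Variable R : realType.
Implicit Types (t : R) (n : nat).

(** Powers of one half make coarse grids part of finer ones; shifting averages, halving Euler steps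
    and comparing Riemann sums all rely on this nesting. *)
Definition mesh n : R := 2^-1 ^+ n.

Lemma mesh_gt0 n : 0 < mesh n.
Proof. by rewrite exprn_gt0// invr_gt0. Qed.

Lemma meshS n : mesh n = mesh n.+1 + mesh n.+1.
Proof. by rewrite /mesh exprS; lra. Qed.

Lemma mesh_small (C e : R) : 0 < e -> exists N, forall n, (N <= n)%N -> C * mesh n < e.
Proof. by apply: geom_small; lra. Qed.

Definition floor_idx t n : nat := Num.truncn (t / mesh n).

Lemma floor_idx_le t n : 0 <= t -> (floor_idx t n)%:R * mesh n <= t.
Proof.
move=> t0; rewrite -ler_pdivlMr ?mesh_gt0//.
by rewrite truncn_le; apply: divr_ge0 => //; exact/ltW/mesh_gt0.
Qed.

Lemma floor_idx_gt t n : t < (floor_idx t n)%:R * mesh n + mesh n.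
Proof.
have := truncnS_gt (t / mesh n); rewrite ltr_pdivrMr ?mesh_gt0//.
by rewrite -/(floor_idx t n) -natr1 mulrDl mul1r.
Qed.

Lemma mesh_pow j n : (j <= n)%N -> mesh j = (2 ^ (n - j))%:R * mesh n.
Proof.
move=> jn; rewrite -{2}(subnKC jn) /mesh exprD mulrCA natrX -exprMn mulfV ?pnatr_eq0//.
by rewrite expr1n mulr1.
Qed.

End Dyadic.

(** * Semigroups with two-sided orbit bounds *)

Section Semigroup.
Variables (R : realType) (H : hilbertSpace R) (T : R -> H -> H).
Implicit Types (x y z : H) (t s : R).
Local Notation "r %:C" := (real_complex R r) : ring_scope.
Hypothesis cT : c0_semigroup T.

Lemma sg_bop t : 0 <= t -> bounded_op (T t).
Proof. by case: cT => h _; exact: h. Qed.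

Lemma sg0 x : T 0 x = x.
Proof. by case: cT => _ [h _]; exact: h. Qed.

Lemma sgD t s x : 0 <= t -> 0 <= s -> T (t + s) x = T t (T s x).
Proof. by case: cT => _ [_ []] h _; exact: h. Qed.

Lemma sg_lim0 x : right_lim0 (fun t => T t x) x.
Proof. by case: cT => _ [_ [_ h]]; exact: h. Qed.

(** From the right, [T (u n) x] is [T (u n - t)] applied to the fixed vector [T t x], so continuity
    at zero suffices and no bound uniform in time enters. *)
Lemma sg_right_continuous (t : R) x (u : nat -> R) : 0 <= t ->
  (forall n, t < u n) ->
  (forall e, 0 < e -> exists N, forall n, (N <= n)%N -> u n - t < e) ->
  seq_lim (fun n => T (u n) x) (T t x).
Proof.
move=> t0 tu ut e e0; have [d [d0 hd]] := sg_lim0 (T t x) e0.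
have [N hN] := ut d d0; exists N => n Nn.
have -> : T (u n) x = T (u n - t) (T t x) by rewrite -sgD ?subrK// subr_ge0 ltW.
by apply: hd; [rewrite subr_gt0|exact: hN].
Qed.

(** The successor index matters: it places the grid point strictly to the right of [t], where
    continuity is known. *)
Lemma sg_dyadic (t : R) x : 0 <= t ->
  seq_lim (fun n => T ((floor_idx t n).+1%:R * mesh R n) x) (T t x).
Proof.
move=> t0; apply: sg_right_continuous => // [n|e e0].
  by rewrite -natr1 mulrDl mul1r floor_idx_gt.
have [N hN] := mesh_small 1 e0; exists N => n /hN.
by have := floor_idx_le n t0; rewrite -natr1; lra.
Qed.

Lemma seq_lim_hnorm_eq (V : preHilbert R) (u : nat -> V) l (c : R) :
  (forall n, hnorm (u n) = c) -> seq_lim u l -> hnorm l = c.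
Proof.
move=> uc ul; apply/eqP; rewrite eq_le; apply/andP; split.
  by apply: (@seq_lim_hnorm_le _ _ _ _ _ 0%N) ul => n _; rewrite uc.
apply/ler_addgt0Pr => e e0; have [N hN] := ul e e0.
by have := hN N (leqnn _); have := hnorm_le_add (u N) l; rewrite uc; lra.
Qed.

(* Shifting by [m / 2^j] moves the grid of mesh [2^-n] onto itself once [j <= n], so averages over
   [4^n] grid points become invariant in the limit. *)
Lemma bounded_semigroup_similar (a c : R) : 0 < a -> 0 < c ->
  (forall t x, 0 <= t -> a * rip x x <= rip (T t x) (T t x) <= c * rip x x) ->
  similar_to_isometries T.
Proof.
move=> a0 c0 Tac.
have Tb t x : 0 <= t -> hnorm (T t x) <= Num.sqrt c * hnorm x.
  move=> t0; apply: le_hnorm; first by rewrite mulr_ge0 ?sqrtr_ge0 ?hnorm_ge0.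
  by rewrite exprMn hnorm2 sqr_sqrtr ?(ltW c0)//; case/andP: (Tac t x t0).
pose tm n k : R := k%:R * mesh R n.
have tm0 n k : 0 <= tm n k by rewrite mulr_ge0// ltW ?mesh_gt0.
(* [4 ^ n] points at distance [2^-n] span a window of length [2 ^ n]: the mesh shrinks while the
   window grows. *)
pose g x y n : R := ((4 ^ n)%N%:R)^-1 * \sum_(k < 4 ^ n) rip (T (tm n k) x) (T (tm n k) y).
have p4 n : 0 < (4 ^ n)%N%:R :> R by rewrite ltr0n expn_gt0.
have avg (lo hi : R) (p : nat -> R) n : (forall k, lo <= p k <= hi) ->
    lo <= ((4 ^ n)%N%:R)^-1 * (\sum_(k < 4 ^ n) p k) <= hi.
  move=> h; rewrite ler_pdivlMl// ler_pdivrMl//; apply/andP; split.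
    have -> : (4 ^ n)%:R * lo = \sum_(k < 4 ^ n) lo by rewrite sumr_const card_ord mulr_natl.
    by apply: ler_sum => k _; case/andP: (h k).
  have -> : (4 ^ n)%:R * hi = \sum_(k < 4 ^ n) hi by rewrite sumr_const card_ord mulr_natl.
  by apply: ler_sum => k _; case/andP: (h k).
have gb x y : bounded_near \oo (g x y).
  exists (c * hnorm x * hnorm y); exists 0%N => // n _ /=; rewrite ler_norml.
  apply: (avg _ _ (fun k => rip (T (tm n k) x) (T (tm n k) y))) => k.
  rewrite -ler_norml; apply: le_trans (CauchySchwarz _ _) _.
  have := Tb _ x (tm0 n k); have := Tb _ y (tm0 n k).
  have h2 : Num.sqrt c ^+ 2 = c by rewrite sqr_sqrtr ?ltW.
  move=> hy hx; apply: le_trans (ler_pM (hnorm_ge0 _) (hnorm_ge0 _) hx hy) _.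
  by rewrite -[in leRHS]h2 le_eqVlt; apply/orP; left; apply/eqP; ring.
have [L [LD LZ Lle Lge]] := @filter_limit_functional R nat \oo _.
pose b x y := L (g x y).
have bl r x y z : b (r%:C *: x + y) z = r * b x z + b y z.
  rewrite /b -LZ// -LD//; last exact: bounded_nearZ.
  congr L; apply/funext => n; rewrite /g mulrCA -mulrDr; congr (_ * _).
  rewrite mulr_sumr -big_split /=; apply: eq_bigr => k _.
  by rewrite (bop_lin (sg_bop (tm0 n k))) !ripE.
have bC x y : b x y = b y x.
  by congr L; apply/funext => n; rewrite /g; congr (_ * _); apply: eq_bigr => k _; rewrite ripC.
have bi x y : b ('i%C *: x) ('i%C *: y) = b x y.
  congr L; apply/funext => n; rewrite /g; congr (_ * _); apply: eq_bigr => k _.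
  by rewrite !(bopZ (sg_bop (tm0 n k))) ripii.
have gac n x : a * rip x x <= g x x n <= c * rip x x.
  by apply: (avg _ _ (fun k => rip (T (tm n k) x) (T (tm n k) x))) => k; exact: Tac.
have ba x : a * rip x x <= b x x.
  by apply: Lge => //; exists 0%N => // n _ /=; case/andP: (gac n x).
have bc x : b x x <= c * rip x x.
  by apply: Lle => //; exists 0%N => // n _ /=; case/andP: (gac n x).
have binv m j x : b (T (tm j m) x) (T (tm j m) x) = b x x.
  set y := T _ x.
  (* Shifting the window by [s] grid points exchanges [s] terms at one end for [s] terms at the
     other; divided by [4 ^ n] this leaves at most [m * 2^-n] times the bound of a term. *)
  have dE n : (j <= n)%N -> `|g y y n + (- 1) * g x x n| <= m%:R * (c * rip x x) * mesh R n.
    move=> jn; pose s := (m * 2 ^ (n - j))%N; pose p k := rip (T (tm n k) x) (T (tm n k) x).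
    have py k : rip (T (tm n k) y) (T (tm n k) y) = p (s + k)%N.
      suff E : T (tm n k) y = T (tm n (s + k)%N) x by rewrite /p -E.
      rewrite /y -sgD//; congr (T _ x).
      by rewrite /tm (mesh_pow R jn) /s natrD natrM; ring.
    have pb k : 0 <= p k <= c * rip x x.
      by rewrite rip_ge0 /=; case/andP: (Tac _ x (tm0 n k)).
    have sumS u v : \sum_(i < u + v) p i = \sum_(i < u) p i + \sum_(i < v) p (u + i)%N.
      by rewrite big_split_ord.
    have split2 := sumS (4 ^ n)%N s; rewrite addnC sumS in split2.
    have E : g y y n + (-1) * g x x n = ((4 ^ n)%N%:R)^-1 *
        (\sum_(i < s) p (4 ^ n + i)%N - \sum_(i < s) p i).
      rewrite mulN1r /g -mulrBr; congr (_ * _); rewrite (eq_bigr (fun k : 'I__ => p (s + k)%N)).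
        by move: split2; lra.
      by move=> k _; exact: py.
    have bs (f : 'I_s -> nat) : 0 <= \sum_(i < s) p (f i) <= s%:R * (c * rip x x).
      apply/andP; split; first by apply: sumr_ge0 => i _; case/andP: (pb (f i)).
      have -> : s%:R * (c * rip x x) = \sum_(i < s) (c * rip x x).
        by rewrite sumr_const card_ord mulr_natl.
      by apply: ler_sum => i _; case/andP: (pb (f i)).
    rewrite E normrM gtr0_norm ?invr_gt0// ler_pdivrMl//.
    have -> : (4 ^ n)%:R * (m%:R * (c * rip x x) * mesh R n) = m%:R * (2 ^ n)%:R * (c * rip x x).
      have -> : (4 ^ n)%:R = (2 ^ n)%:R * (2 ^ n)%:R :> R by rewrite -natrM -expnMn.
      have : (2 ^ n)%:R * mesh R n = 1 by rewrite /mesh natrX -exprMn mulfV ?expr1n.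
      set P := _%:R => h; transitivity (m%:R * P * (c * rip x x) * (P * mesh R n)); first by ring.
      by rewrite h mulr1.
    apply: (@le_trans _ _ (s%:R * (c * rip x x))).
      have /andP[h1 h2] := bs (fun i => (4 ^ n + i)%N); have /andP[h3 h4] := bs (fun i : 'I_s => i : nat).
      by rewrite ler_norml; apply/andP; split; lra.
    apply: ler_wpM2r; first by rewrite mulr_ge0 ?rip_ge0 ?ltW.
    by rewrite -natrM ler_nat leq_mul// leq_exp2l// leq_subr.
  have : b y y + (-1) * b x x = 0; last by lra.
  rewrite /b -LZ// -LD//; last exact: bounded_nearZ.
  have bdd : @bounded_near R nat \oo (fun t : nat => g y y t + (-1) * g x x t).
    by apply: bounded_nearD => //; exact: bounded_nearZ.
  apply/eqP; rewrite eq_le; apply/andP; split.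
    apply/ler_addgt0Pr => e e0; rewrite add0r; apply: Lle => //.
    have [N hN] := mesh_small (m%:R * (c * rip x x)) e0.
    exists (maxn N j) => // n /=; rewrite geq_max => /andP[Nn jn].
    by apply: le_trans (ler_norm _) (le_trans (dE n jn) (ltW (hN n Nn))).
  rewrite -oppr_le0; apply/ler_addgt0Pr => e e0; rewrite add0r lerNl; apply: Lge => //.
  have [N hN] := mesh_small (m%:R * (c * rip x x)) e0.
  exists (maxn N j) => // n /=; rewrite geq_max => /andP[Nn jn].
  have := le_trans (dE n jn) (ltW (hN n Nn)).
  by rewrite ler_norml => /andP[].
have [Rm [Ri [bRm bRi RmK RiK RR]]] := equivalent_form a0 c0 bl bC bi ba bc.
exists Rm, Ri; split=> //; split=> //; split=> //; split=> // t x t0.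
(* Invariance of [b] is known at dyadic times only; right continuity carries the equality of norms
   to every [t]. *)
apply: seq_lim_hnorm_eq (bop_seq_lim bRm (sg_dyadic (Ri x) t0)) => n.
by apply: eq_hnorm; rewrite -!/(rip _ _) RR binv -RR RmK.
Qed.

End Semigroup.

(** Accounts for rounding: the floor of a sum of times, or of a time on the halved grid, exceeds the
    expected index by at most one. *)
Lemma eq_or_succ (p q : nat) : (p < q + 2)%N -> (q < p + 1)%N -> p = q \/ p = q.+1.
Proof. by lia. Qed.

(** * Algebra of unbounded operators *)

Section LinearOperators.
Variables (R : realType) (X Y : hilbertSpace R) (G : linop X Y).
Implicit Types (x y : X) (a : R[i]).
Local Notation D := (ldom G).
Local Notation g := (lapp G).
Hypothesis linG : is_linop G.

Lemma dom_lin a x y : D x -> D y -> D (a *: x + y).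
Proof. by move=> Dx Dy; case: linG => _ /(_ a x y Dx Dy)[]. Qed.

Lemma app_lin a x y : D x -> D y -> g (a *: x + y) = a *: g x + g y.
Proof. by move=> Dx Dy; case: linG => _ /(_ a x y Dx Dy)[]. Qed.

Lemma dom0 : D 0.
Proof. by case: linG. Qed.

Lemma domZ a x : D x -> D (a *: x).
Proof. by move=> Dx; have := dom_lin a Dx dom0; rewrite addr0. Qed.

Lemma domB x y : D x -> D y -> D (x - y).
Proof. by move=> Dx Dy; have := dom_lin (-1) Dy Dx; rewrite scaleN1r addrC. Qed.

Lemma appD x y : D x -> D y -> g (x + y) = g x + g y.
Proof. by move=> Dx Dy; have := app_lin 1 Dx Dy; rewrite !scale1r. Qed.

Lemma app0 : g 0 = 0.
Proof. by apply: (addrI (g 0)); rewrite -appD ?addr0//; exact: dom0. Qed.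

Lemma appZ a x : D x -> g (a *: x) = a *: g x.
Proof. by move=> Dx; have := app_lin a Dx dom0; rewrite app0 !addr0. Qed.

Lemma appB x y : D x -> D y -> g (x - y) = g x - g y.
Proof.
by move=> Dx Dy; have := app_lin (-1) Dy Dx; rewrite !scaleN1r !(addrC (- _)).
Qed.

End LinearOperators.

(** * Generation of an isometric semigroup by a skew operator *)

Section Generation.
Variables (R : realType) (H : hilbertSpace R) (G : linop H H).
Implicit Types (x y z : H) (t s : R) (n m : nat).
Local Notation "r %:C" := (real_complex R r) : ring_scope.
Local Notation D := (ldom G).
Local Notation g := (lapp G).
Local Notation h := (mesh R).
Hypothesis linG : is_linop G.
Hypothesis skewG : forall x, D x -> rip (g x) x = 0.
Hypothesis rangeG : forall (r : R) y, 0 < r -> exists x, D x /\ x - r%:C *: g x = y.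

(** Skewness kills the cross term. The identity yields injectivity, contractivity of the Euler step,
    and the exact loss of squared norm in one step, which is of second order in [r]. *)
Lemma skew_pyth (r : R) x : D x ->
  rip (x - r%:C *: g x) (x - r%:C *: g x) = rip x x + r ^+ 2 * rip (g x) (g x).
Proof. by move=> Dx; rewrite !ripE (ripC x (g x)) skewG//; ring. Qed.

Lemma skew_inj (r : R) x y : D x -> D y -> x - r%:C *: g x = y - r%:C *: g y -> x = y.
Proof.
move=> Dx Dy e; apply/eqP; rewrite -subr_eq0; apply/eqP/rip_eq0.
have := skew_pyth r (domB linG Dx Dy); rewrite (appB linG)//.
have -> : x - y - r%:C *: (g x - g y) = (x - r%:C *: g x) - (y - r%:C *: g y).
  by apply: inner_ext => w; rewrite !innerE; ring.
rewrite e subrr rip0l; have := rip_ge0 (g x - g y); have := sqr_ge0 r; nra.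
Qed.

(* [J n] is the implicit Euler step [(1 - 2^-n G)^-1]. *)
Lemma generation : exists S : R -> H -> H,
  [/\ c0_semigroup S, generates S G & forall t x, 0 <= t -> hnorm (S t x) = hnorm x].
Proof.
have /boolp.choice[J0 J0E] : forall p : nat * H, exists x, D x /\ x - (h p.1)%:C *: g x = p.2.
  by move=> [n y]; apply: rangeG; exact: mesh_gt0.
pose J n y := J0 (n, y).
have JD n y : D (J n y) by case: (J0E (n, y)).
have JE n y : J n y - (h n)%:C *: g (J n y) = y by case: (J0E (n, y)).
have Ju n x y : D x -> x - (h n)%:C *: g x = y -> x = J n y.
  by move=> Dx e; apply: (@skew_inj (h n)) => //; rewrite JE.
clearbody J; clear J0 J0E.
have h0 n : 0 < h n by exact: mesh_gt0.
have Jl n a x y : J n (a *: x + y) = a *: J n x + J n y.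
  apply/esym/Ju; first exact: (dom_lin linG).
  rewrite (app_lin linG)// -[in RHS](JE n x) -[in RHS](JE n y).
  by apply: inner_ext => w; rewrite !innerE; ring.
have JDd n x y : J n (x + y) = J n x + J n y by have := Jl n 1 x y; rewrite !scale1r.
have JB n x y : J n (x - y) = J n x - J n y.
  by have := Jl n (-1) y x; rewrite !scaleN1r !(addrC (- _)).
have J0 n : J n 0 = 0 by have := JB n 0 0; rewrite !subrr.
have JZ n a x : J n (a *: x) = a *: J n x by have := Jl n a x 0; rewrite J0 !addr0.
have Jpy n y : rip y y = rip (J n y) (J n y) + h n ^+ 2 * rip (g (J n y)) (g (J n y)).
  by rewrite -skew_pyth// JE.
have Jc n y : hnorm (J n y) <= hnorm y.
  apply: le_hnorm; first exact: hnorm_ge0.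
  by rewrite hnorm2 (Jpy n y) lerDl mulr_ge0 ?sqr_ge0 ?rip_ge0.
have sE n x : g (J n x) = (h n)^-1%:C *: (J n x - x).
  rewrite -{3}(JE n x) opprB addrC subrK scalerA.
  by apply: rip_ext => w; rewrite -rmorphM mulVf ?lt0r_neq0// scale1r.
have JG n x : D x -> D (g (J n x)) /\ g (J n x) = J n (g x).
  move=> Dx; have Dg : D (g (J n x)) by rewrite sE; apply: (domZ linG); apply: (domB linG).
  split=> //; apply: Ju => //.
  by rewrite -[in RHS](JE n x) (appB linG)// ?(appZ linG)//; exact: (domZ linG).
have Jx n x : D x -> J n x - x = (h n)%:C *: J n (g x).
  by move=> Dx; rewrite -(proj2 (JG n x Dx)) -{2}(JE n x) opprB addrC subrK.
pose It n m x := iter m (J n) x.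
have Itl n m a x y : It n m (a *: x + y) = a *: It n m x + It n m y.
  by elim: m => [//|m ih]; rewrite /It /= -/(It n m _) ih Jl.
have ItB n m x y : It n m (x - y) = It n m x - It n m y.
  by have := Itl n m (-1) y x; rewrite !scaleN1r !(addrC (- _)).
have Itc n m x : hnorm (It n m x) <= hnorm x.
  by elim: m => [//|m ih]; apply: le_trans (Jc _ _) ih.
have ItD n m x : D x -> D (It n m x) /\ g (It n m x) = It n m (g x).
  elim: m => [//|m ih] Dx; rewrite /It /= -!/(It n m _).
  by have [Dm <-] := ih Dx; split; [exact: JD|exact: (proj2 (JG _ _ _))].
have Ita n m k x : It n (m + k)%N x = It n m (It n k x) by rewrite /It iterD.
pose D2 x := D x /\ D (g x).
have ItD2 n m x : D2 x -> D2 (It n m x) /\ g (g (It n m x)) = It n m (g (g x)).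
  move=> [Dx Dgx]; have [a b] := ItD n m x Dx; have [c d] := ItD n m _ Dgx.
  by rewrite /D2 b d.
(* Two half steps solve [(1 - k G)^2 v = x], that is [v - 2 k G v = x - k^2 G^2 v]: they differ from
   one full step by a term of second order. *)
have halve n x : D2 x -> hnorm (J n.+1 (J n.+1 x) - J n x) <= h n.+1 ^+ 2 * hnorm (g (g x)).
  move=> D2x; set k := h n.+1; set v := J n.+1 (J n.+1 x).
  have [[Dv Dgv] ggv] := ItD2 n.+1 2%N x D2x; rewrite -/v in Dv Dgv ggv.
  have e1 : J n.+1 x = v - k%:C *: g v by rewrite JE.
  have e2 : x = J n.+1 x - k%:C *: g (J n.+1 x) by rewrite JE.
  have hk : h n = 2 * k by rewrite (meshS R n) -/k; ring.
  have -> : v = J n (x - (k ^+ 2)%:C *: g (g v)).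
    apply: Ju => //; rewrite [X in _ = X - _]e2 e1 (appB linG)// ?(appZ linG)//; last exact: (domZ linG).
    by apply: rip_ext => w; rewrite !ripE hk; ring.
  rewrite JB JZ addrC addKr hnormN hnormZ ger0_norm ?sqr_ge0//.
  apply: ler_wpM2l; first exact: sqr_ge0.
  by apply: le_trans (Jc _ _) _; rewrite ggv.
(* Contractivity lets the local errors add up without amplification. *)
have step n x m : D2 x ->
    hnorm (It n.+1 (m * 2)%N x - It n m x) <= m%:R * (h n.+1 ^+ 2 * hnorm (g (g x))).
  move=> D2x; elim: m => [|m ih]; first by rewrite subrr hnorm0 mul0r.
  rewrite mulSn /It /= -!/(It _ _ _).
  apply: le_trans (hnorm_tri (J n (It n.+1 (m * 2)%N x)) _ _) _.
  rewrite -natr1 mulrDl mul1r addrC; apply: lerD; first by rewrite -JB; apply: le_trans (Jc _ _) ih.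
  have [D2m E] := ItD2 n.+1 (m * 2)%N x D2x.
  apply: le_trans (halve n _ D2m) _; apply: ler_wpM2l; first exact: sqr_ge0.
  by rewrite E.
have one n x : D x -> hnorm (J n x - x) <= h n * hnorm (g x).
  move=> Dx; rewrite Jx// hnormZ gtr0_norm//; apply: ler_wpM2l (Jc _ _); exact: ltW.
have oneI n m x : D x -> hnorm (It n m.+1 x - It n m x) <= h n * hnorm (g x).
  move=> Dx; have [Dm E] := ItD n m x Dx; apply: le_trans (one n _ Dm) _.
  by rewrite E; apply: ler_wpM2l (Itc _ _ _); exact: ltW.
have manyI n m x : D x -> hnorm (It n m x - x) <= m%:R * h n * hnorm (g x).
  move=> Dx; elim: m => [|m ih]; first by rewrite subrr hnorm0 !mul0r.
  have := hnorm_tri (It n m x) (It n m.+1 x) x; have := oneI n m x Dx; rewrite -natr1; lra.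
pose F n t x := It n (floor_idx t n) x.
(* On halving the mesh the number of steps becomes [2 f] or [2 f + 1]. The odd step and the [f]
   accumulated local errors are both of the order of the mesh, so the increments are summable. *)
have close n t x : 0 <= t -> D2 x ->
    hnorm (F n.+1 t x - F n t x) <= (t * hnorm (g (g x)) + hnorm (g x)) * 2^-1 ^+ n.
  move=> t0 D2x; rewrite /F; set f := floor_idx t n; set f' := floor_idx t n.+1.
  have fle := floor_idx_le n t0; have fgt := floor_idx_gt t n.
  have fle' := floor_idx_le n.+1 t0; have fgt' := floor_idx_gt t n.+1.
  rewrite -/f -/f' in fle fgt fle' fgt'.
  have hk := meshS R n; have k0 := h0 n.+1.
  have l1 : (f' < f * 2 + 2)%N.
    rewrite -(ltr_nat R) natrD natrM -(ltr_pM2r k0); rewrite hk in fgt; lra.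
  have l2 : (f * 2 < f' + 1)%N.
    rewrite -(ltr_nat R) natrD natrM -(ltr_pM2r k0); rewrite hk in fle; lra.
  have b1 := step n x f D2x.
  have b2 : hnorm (It n.+1 f' x - It n.+1 (f * 2)%N x) <= h n.+1 * hnorm (g x).
    have [->|->] := eq_or_succ l1 l2.
      by rewrite subrr hnorm0 mulr_ge0 ?hnorm_ge0 ?ltW.
    by apply: oneI; case: D2x.
  have := hnorm_tri (It n.+1 (f * 2)%N x) (It n.+1 f' x) (It n f x).
  have e3 : f%:R * h n.+1 <= t by rewrite hk in fle; have := mulr_ge0 (ler0n R f) (ltW k0); lra.
  have e4 : f%:R * (h n.+1 ^+ 2 * hnorm (g (g x))) <= t * hnorm (g (g x)) * h n.+1.
    have := ler_wpM2r (ltW k0) (ler_wpM2r (hnorm_ge0 (g (g x))) e3).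
    apply: le_trans; rewrite le_eqVlt; apply/orP; left; apply/eqP; ring.
  have e5 : 0 <= (t * hnorm (g (g x)) + hnorm (g x)) * h n.+1.
    by rewrite mulr_ge0 ?addr_ge0 ?mulr_ge0 ?hnorm_ge0// ltW.
  rewrite -/(mesh R n) hk; lra.
have Fc n t x : hnorm (F n t x) <= hnorm x by exact: Itc.
have FB n t x y : F n t (x - y) = F n t x - F n t y by exact: ItB.
have densD x e : 0 < e -> exists z, D z /\ hnorm (x - z) < e.
  apply: dense_of_orthogonal; first exact: (dom0 linG).
    by move=> *; exact: (dom_lin linG).
  move=> y yD; have [z [Dz zE]] := rangeG y ltr01.
  have := yD z Dz; rewrite -zE !ripE skewG// mulr0 subr0 => z0.
  have z00 : z = 0 by apply: rip_eq0; rewrite z0.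
  by rewrite z00 (app0 linG) scaler0 subr0.
have Jlim x e : 0 < e -> exists n, hnorm (J n x - x) < e.
  move=> e0; have e3 : 0 < e / 3 by lra.
  have [z [Dz xz]] := densD x _ e3; have [n hn] := mesh_small (hnorm (g z)) e3.
  exists n; have := hn n (leqnn _); have := one n z Dz; have := Jc n (x - z); rewrite JB.
  have := hnorm_tri (J n z) (J n x) x; have := hnorm_tri z (J n z) x.
  rewrite (hnorm_sub z x); lra.
have densD2 x e : 0 < e -> exists z, D2 z /\ hnorm (x - z) < e.
  move=> e0; have e2 : 0 < e / 2 by lra.
  have [n hn] := Jlim x _ e2; exists (J n (J n x)); split.
    by split=> //; case: (JG n (J n x)).
  have := hnorm_tri (J n x) (J n (J n x)) x; have := Jc n (J n x - x); rewrite JB.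
  rewrite (hnorm_sub x); lra.
have q0 : 0 <= 2^-1 :> R by lra.
have q1 : 2^-1 < 1 :> R by lra.
have cvgF t x : exists l, 0 <= t -> seq_lim (fun n => F n t x) l.
  have [t0|] := boolP (0 <= t); last by exists 0.
  have [l hl] : exists l, seq_lim (fun n => F n t x) l; last by exists l.
  apply: (@hs_complete R H) => e e0; have e4 : 0 < e / 4 by lra.
  have [z [D2z xz]] := densD2 x _ e4.
  have [l [hl _]] := @geom_cauchy R H (fun n => F n t z) _ _ q0 q1
     (fun n => close n t z t0 D2z).
  have [N hN] := hl _ e4; exists N => m n Nm Nn.
  have := hN m Nm; have := hN n Nn; have := Fc m t (x - z); have := Fc n t (x - z).
  have := hnorm_tri (F m t z) (F m t x) (F n t x); have := hnorm_tri l (F m t z) (F n t x).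
  have := hnorm_tri (F n t z) l (F n t x).
  rewrite !FB (hnorm_sub l (F n t z)) (hnorm_sub (F n t z) (F n t x)); lra.
have /boolp.choice[S' S'E] : forall p : R * H, exists l, 0 <= p.1 -> seq_lim (fun n => F n p.1 p.2) l.
  by move=> [t x]; exact: cvgF.
pose S t x := S' (t, x).
have SE t x : 0 <= t -> seq_lim (fun n => F n t x) (S t x) by exact: S'E (t, x).
clearbody S; clear S' S'E.
have Sc t x : 0 <= t -> hnorm (S t x) <= hnorm x.
  by move=> t0; apply: (@seq_lim_hnorm_le _ _ _ _ _ 0%N _ (SE t x t0)) => n _; exact: Fc.
have Sl t a x y : 0 <= t -> S t (a *: x + y) = a *: S t x + S t y.
  move=> t0; apply: seq_lim_unique (SE _ _ t0) _.
  apply: (@seq_lim_eq _ _ (fun n => a *: F n t x + F n t y)) => [n|].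
    by rewrite /F Itl.
  by apply: seq_limD (SE _ _ t0); apply: seq_limZ (SE _ _ t0).
have SB t x y : 0 <= t -> S t (x - y) = S t x - S t y.
  by move=> t0; have := Sl t (-1) y x t0; rewrite !scaleN1r !(addrC (- _)).
have fh n t : 0 <= t -> 0 <= (floor_idx t n)%:R * h n <= t.
  by move=> t0; rewrite floor_idx_le// mulr_ge0// ltW.
have Snear t x : 0 <= t -> D x -> hnorm (S t x - x) <= t * hnorm (g x).
  move=> t0 Dx; apply: (@seq_lim_hnorm_le _ _ (fun n => F n t x - x) _ _ 0%N).
    move=> n _; apply: le_trans (manyI n _ x Dx) _; apply: ler_wpM2r; first exact: hnorm_ge0.
    by case/andP: (fh n t t0).
  by apply: seq_limD (SE _ _ t0) _; exact: seq_lim_cst.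
have bop t : 0 <= t -> bounded_op (S t).
  move=> t0; split; first by move=> *; exact: Sl.
  by exists 1 => x; rewrite mul1r Sc.
have S0 x : S 0 x = x.
  apply: (@seq_lim_unique _ _ (fun n => F n 0 x)); first exact: SE.
  apply: (@seq_lim_eq _ _ (fun=> x)) => [n|]; last exact: seq_lim_cst.
  by rewrite /F /floor_idx mul0r truncn0.
(* The floor of [t + s] may exceed the sum of the floors by one step; on the domain that step
   vanishes with the mesh, and contractivity extends the law to all vectors. *)
have SD t s x : 0 <= t -> 0 <= s -> S (t + s) x = S t (S s x).
  move=> t0 s0; have ts0 : 0 <= t + s by exact: addr_ge0.
  have onD z : D z -> S (t + s) z = S t (S s z).
    move=> Dz; apply: seq_lim_unique (SE _ _ ts0) _ => e e0; have e3 : 0 < e / 3 by lra.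
    have [N1 h1] := SE _ (S s z) t0 _ e3; have [N2 h2] := SE s z s0 _ e3.
    have [N3 h3] := mesh_small (hnorm (g z)) e3.
    exists (maxn N1 (maxn N2 N3)) => n; rewrite !geq_max => /and3P[n1 n2 n3].
    have e4 : hnorm (F n (t + s) z - F n t (F n s z)) <= h n * hnorm (g z).
      rewrite /F -Ita.
      have := floor_idx_le n t0; have := floor_idx_gt t n.
      have := floor_idx_le n s0; have := floor_idx_gt s n.
      have := floor_idx_le n ts0; have := floor_idx_gt (t + s) n.
      set p := floor_idx (t + s) n; set q := floor_idx t n; set r := floor_idx s n.
      move=> a1 a2 a3 a4 a5 a6.
      have l1 : (p < q + r + 2)%N.
        by rewrite -(ltr_nat R) !natrD -(ltr_pM2r (h0 n)); lra.
      have l2 : (q + r < p + 1)%N.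
        by rewrite -(ltr_nat R) !natrD -(ltr_pM2r (h0 n)); lra.
      have [->|->] := eq_or_succ l1 l2.
        by rewrite subrr hnorm0 mulr_ge0 ?hnorm_ge0 ?ltW.
      exact: oneI.
    have := h1 n n1; have := h2 n n2; have := h3 n n3; have := Fc n t (F n s z - S s z); rewrite FB.
    have := hnorm_tri (F n t (F n s z)) (F n (t + s) z) (S t (S s z)).
    have := hnorm_tri (F n t (S s z)) (F n t (F n s z)) (S t (S s z)); lra.
  apply/eqP; rewrite -subr_eq0; apply/eqP/hnorm_eq0/ler_addgt0Pr => e e0; rewrite add0r.
  have e2 : 0 < e / 2 by lra.
  have [z [Dz xz]] := densD x _ e2.
  have := hnorm_tri (S t (S s z)) (S (t + s) x) (S t (S s x)).
  have := Sc _ (x - z) ts0; have := Sc _ (S s x - S s z) t0; have := Sc _ (x - z) s0.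
  rewrite !SB// -{1 2}(onD z Dz) (hnorm_sub (S t (S s z))) onD//; lra.
have Slim0 x : right_lim0 (fun t => S t x) x.
  move=> e e0; have e3 : 0 < e / 3 by lra.
  have [z [Dz xz]] := densD x _ e3; have c1 : 0 < hnorm (g z) + 1 by have := hnorm_ge0 (g z); lra.
  exists (e / 3 / (hnorm (g z) + 1)); split; first exact: divr_gt0.
  move=> t t0; rewrite ltr_pdivlMr// => te.
  have := Snear t z (ltW t0) Dz; have := Sc t (x - z) (ltW t0); rewrite SB ?(ltW t0)//.
  have := hnorm_tri (S t z) (S t x) x; have := hnorm_tri z (S t z) x; rewrite (hnorm_sub z x).
  lra.
have c0S : c0_semigroup S by split=> //; split=> //; split.
(* [g x] need not lie in the domain, so the drift of [It n m (g x)] away from [g x] is measured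
   through an approximation [z] of [g x] inside the domain. *)
have taylorI n m x z : D x -> D z ->
    hnorm (It n m x - x - (m%:R * h n)%:C *: g x) <=
    m%:R * h n * (2 * hnorm (g x - z) + m%:R * h n * hnorm (g z)).
  move=> Dx Dz; elim: m => [|m ih].
    by rewrite !mul0r scale0r subr0 subrr hnorm0.
  have [Dm E] := ItD n m x Dx.
  have -> : It n m.+1 x - x - (m.+1%:R * h n)%:C *: g x =
      (It n m x - x - (m%:R * h n)%:C *: g x) + (h n)%:C *: (It n m.+1 (g x) - g x).
    have -> : It n m.+1 x = It n m x + (h n)%:C *: It n m.+1 (g x).
      rewrite /It /= -!/(It _ _ _) -E -Jx// addrC subrK//.
    by apply: rip_ext => w; rewrite !ripE -natr1; ring.
  apply: le_trans (hnormD _ _) _; rewrite hnormZ gtr0_norm//.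
  have b1 : hnorm (It n m.+1 (g x) - g x) <= 2 * hnorm (g x - z) + m.+1%:R * h n * hnorm (g z).
    have := manyI n m.+1 z Dz; have := Itc n m.+1 (g x - z); rewrite ItB.
    have := hnorm_tri (It n m.+1 z) (It n m.+1 (g x)) (g x).
    have := hnorm_tri z (It n m.+1 z) (g x); rewrite (hnorm_sub z (g x)); lra.
  have := ler_wpM2l (ltW (h0 n)) b1; move: ih.
  set A := hnorm (g x - z); set B := hnorm (g z); set M := m%:R : R; rewrite -natr1 -/M.
  have A0 : 0 <= A by exact: hnorm_ge0. have B0 : 0 <= B by exact: hnorm_ge0.
  have M0 : 0 <= M by exact: ler0n.
  have : 0 <= M * h n * h n * B by rewrite !mulr_ge0// ltW.
  by move=> p1 p2 p3; lra.
have taylor t x z : 0 <= t -> D x -> D z ->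
    hnorm (S t x - x - t%:C *: g x) <= t * (2 * hnorm (g x - z) + t * hnorm (g z)).
  move=> t0 Dx Dz; pose u n := (floor_idx t n)%:R * h n.
  apply: (@seq_lim_hnorm_le _ _ (fun n => F n t x - x - (u n)%:C *: g x) _ _ 0%N).
    move=> n _; apply: le_trans (taylorI n _ x z Dx Dz) _.
    have /andP[u0 ut] := fh n t t0; apply: ler_pM => //.
      by apply: addr_ge0; apply: mulr_ge0 => //; exact: hnorm_ge0.
    by rewrite lerD2l ler_wpM2r ?hnorm_ge0.
  apply: seq_limD.
    by apply: seq_limD (SE _ _ t0) _; exact: seq_lim_cst.
  apply: (@seq_lim_squeeze _ _ _ _ (fun n => hnorm (g x) * h n)); last first.
    by move=> d; exact: mesh_small.
  move=> n; have -> : - ((u n)%:C *: g x) - - (t%:C *: g x) = (t - u n)%:C *: g x.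
    by apply: rip_ext => w; rewrite !ripE; ring.
  rewrite hnormZ mulrC; apply: ler_wpM2l; first exact: hnorm_ge0.
  have /andP[u0 ut] := fh n t t0; rewrite ger0_norm ?subr_ge0//.
  by have := floor_idx_gt t n; rewrite -/(u n); lra.
have gen x : D x -> right_lim0 (fun t => (t^-1)%:C *: (S t x - x)) (g x).
  move=> Dx e e0; have e4 : 0 < e / 4 by lra.
  have [z [Dz xz]] := densD (g x) _ e4; have c1 : 0 < hnorm (g z) + 1 by have := hnorm_ge0 (g z); lra.
  exists (e / 4 / (hnorm (g z) + 1)); split; first exact: divr_gt0.
  move=> t t0; rewrite ltr_pdivlMr// => te.
  have -> : (t^-1)%:C *: (S t x - x) - g x = (t^-1)%:C *: (S t x - x - t%:C *: g x).
    by apply: rip_ext => w; rewrite !ripE; field; rewrite lt0r_neq0.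
  rewrite hnormZ gtr0_norm ?invr_gt0// ltr_pdivrMl//.
  apply: le_lt_trans (taylor t x z (ltW t0) Dx Dz) _; rewrite ltr_pM2l//; lra.
(* Dissipativity of the true generator of [S]: the right derivative is taken at any vector where it
   exists, before that vector is known to lie in the domain of [G]. *)
have contr_diss x y : right_lim0 (fun t => (t^-1)%:C *: (S t x - x)) y -> rip y x <= 0.
  move=> xy; apply/ler_addgt0Pr => e e0; rewrite add0r.
  have c1 : 0 < hnorm x + 1 by have := hnorm_ge0 x; lra.
  have [d [d0 hd]] := xy _ (divr_gt0 e0 c1).
  have d2 : 0 < d / 2 by lra.
  have dd : d / 2 < d by lra.
  have := hd _ d2 dd; rewrite ltr_pdivlMr//; set q := _ *: _ => h1.
  have h2 : rip q x <= 0.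
    rewrite /q ripZl ripDl ripNl; apply: mulr_ge0_le0; first by rewrite invr_ge0 ltW.
    rewrite subr_le0; apply: le_trans (rip_le _ _) _; rewrite -hnorm2 expr2.
    by apply: ler_wpM2r (Sc _ _ (ltW d2)); exact: hnorm_ge0.
  have -> : y = q - (q - y) by rewrite opprB addrC subrK.
  rewrite ripDl; have := rip_le (- (q - y)) x; rewrite hnormN.
  have := hnorm_ge0 (q - y); have := hnorm_ge0 x; nra.
exists S; split=> //; last first.
  move=> t x t0; apply/eqP; rewrite eq_le Sc//=; apply/ler_addgt0Pr => e e0.
  have e2 : 0 < e / 2 by lra.
  have [z [Dz xz]] := densD x _ e2.
  (* By the exact balance of squared norms, [f] steps lose at most [f * h^2 * rip (g z) (g z)],
     which is at most [t * h] times a constant and vanishes with the mesh. *)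
  have isoD : rip z z <= rip (S t z) (S t z).
    have It2 n m : rip z z <= rip (It n m z) (It n m z) + m%:R * h n ^+ 2 * rip (g z) (g z).
      elim: m => [|m ih]; first by rewrite !mul0r addr0.
      apply: le_trans ih _; rewrite (Jpy n (It n m z)) -[J n _]/(It n m.+1 z).
      have [_ ->] := ItD n m.+1 z Dz.
      have : rip (It n m.+1 (g z)) (It n m.+1 (g z)) <= rip (g z) (g z).
        by rewrite -!hnorm2 ler_sqr ?nnegrE ?hnorm_ge0.
      by rewrite -natr1; have := sqr_ge0 (h n); nra.
    apply/ler_addgt0Pr => d d0.
    have c1 : 0 < 2 * (2 * hnorm z + 1) by have := hnorm_ge0 z; lra.
    have [N1 h1] := SE t z t0 _ (divr_gt0 d0 c1); have d2 : 0 < d / 2 by lra.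
    have [N2 h2] := mesh_small (t * rip (g z) (g z)) d2.
    pose n := maxn N1 N2; have := h1 n (leq_maxl _ _); have := h2 n (leq_maxr _ _).
    rewrite (ltr_pdivlMr _ _ c1) => a1 a2.
    have a3 : rip z z <= rip (F n t z) (F n t z) + (floor_idx t n)%:R * h n ^+ 2 * rip (g z) (g z).
      exact: It2.
    have /andP[f0 ft] := fh n t t0.
    have a4 : (floor_idx t n)%:R * h n ^+ 2 * rip (g z) (g z) <= t * rip (g z) (g z) * h n.
      have := ler_wpM2r (mulr_ge0 (rip_ge0 (g z)) (ltW (h0 n))) ft.
      by rewrite (mulrA t); apply: le_trans; rewrite le_eqVlt; apply/orP; left; apply/eqP; ring.
    have a5 : rip (F n t z) (F n t z) - rip (S t z) (S t z) <= hnorm (F n t z - S t z) * (2 * hnorm z).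
      rewrite -!hnorm2 subr_sqr.
      have := hnorm_le_add (F n t z) (S t z); have := Fc n t z; have := Sc t z t0.
      have := hnorm_ge0 (F n t z); have := hnorm_ge0 (S t z); have := hnorm_ge0 (F n t z - S t z); nra.
    have := hnorm_ge0 (F n t z - S t z); move: a1 a2 a3 a4 a5.
    set p := hnorm (_ - _); set q := hnorm z; move: (rip z z) (rip (S t z) _) (rip (F n t z) _) => u v w.
    move: (_ * rip (g z) _) (_ * rip (g z) _ * _) => a b a1 a2 a3 a4 a5 p0; lra.
  have : hnorm z <= hnorm (S t z) by rewrite -ler_sqr ?nnegrE ?hnorm_ge0// !hnorm2.
  have := Sc t (x - z) t0; rewrite SB// (hnorm_sub (S t x)).
  have := hnorm_le_add (S t z) (S t x); have := hnorm_le_add x z; lra.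
move=> x; split; last exact: gen.
split; first by move=> Dx; exists (g x); exact: gen.
(* Maximality: solve [w - G w = x - y] inside the domain. Then [y - G w = x - w], while
   dissipativity gives [rip (y - G w) (x - w) <= 0]; hence [x = w]. *)
move=> [y xy]; have [w [Dw wE]] := rangeG (x - y) ltr01.
have d_diss : rip (y - g w) (x - w) <= 0.
  apply: contr_diss => e e0; have e2 : 0 < e / 2 by lra.
  have [d1 [d10 h1]] := xy _ e2; have [d2 [d20 h2]] := gen w Dw _ e2.
  exists (Num.min d1 d2); split; first by rewrite lt_min d10.
  move=> t t0; rewrite lt_min => /andP[t1 t2].
  have := h1 t t0 t1; have := h2 t t0 t2.
  have -> : (t^-1)%:C *: (S t (x - w) - (x - w)) - (y - g w) =
     ((t^-1)%:C *: (S t x - x) - y) - ((t^-1)%:C *: (S t w - w) - g w).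
    by rewrite SB ?(ltW t0)//; apply: rip_ext => v; rewrite !ripE; ring.
  have := hnormB ((t^-1)%:C *: (S t x - x) - y) ((t^-1)%:C *: (S t w - w) - g w); lra.
suff -> : x = w by [].
apply/eqP; rewrite -subr_eq0; apply/eqP/rip_eq0.
suff e : y - g w = x - w by rewrite -{1}e.
have : w - g w = x - y by move: wE; rewrite scale1r.
move=> e; have -> : g w = w - (x - y) by rewrite -e opprB addrC subrK.
by apply: rip_ext => v; rewrite !ripE; ring.
Qed.

End Generation.

Section RightLimits.
Variables (R : realType) (H : hilbertSpace R).
Local Notation "r %:C" := (real_complex R r) : ring_scope.

Lemma right_lim0_unique (f : R -> H) (x y : H) :
  right_lim0 f x -> right_lim0 f y -> x = y.
Proof.
move=> fx fy; apply/eqP; rewrite -subr_eq0; apply/eqP/hnorm_eq0.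
apply/ler_addgt0Pr => e e0; rewrite add0r; have e2 : 0 < e / 2 by lra.
have [d1 [d10 h1]] := fx _ e2; have [d2 [d20 h2]] := fy _ e2.
pose t := Num.min d1 d2 / 2.
have m0 : 0 < Num.min d1 d2 by rewrite lt_min d10.
have t0 : 0 < t by rewrite /t; lra.
have /andP[t1 t2] : (t < d1) && (t < d2) by rewrite -lt_min /t; lra.
have := h1 t t0 t1; have := h2 t t0 t2; have := hnorm_tri (f t) x y.
rewrite (hnorm_sub x (f t)); lra.
Qed.

Lemma hnormZc (V : preHilbert R) (u v : R) (x : V) :
  hnorm (Complex u v *: x) = Num.sqrt (u ^+ 2 + v ^+ 2) * hnorm x.
Proof.
by rewrite /hnorm -!/(rip _ _) ripZc sqrtrM// addr_ge0 ?sqr_ge0.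
Qed.

End RightLimits.

(** * Resolvents of the generator of an isometric semigroup *)

Section Isometric.
Variables (R : realType) (H : hilbertSpace R) (S : R -> H -> H) (G : linop H H).
Implicit Types (x y z : H) (t s : R) (n m : nat).
Local Notation "r %:C" := (real_complex R r) : ring_scope.
Hypothesis cS : c0_semigroup S.
Hypothesis genS : generates S G.
Hypothesis isoS : forall t x, 0 <= t -> hnorm (S t x) = hnorm x.

(** Conservation of the norm gives [rip q x = - (t / 2) * rip q q] for the difference quotient [q];
    since [q] stays bounded, the right side vanishes as [t] tends to zero. *)
Lemma isometric_generator_skew x : ldom G x -> rip (lapp G x) x = 0.
Proof.
move=> Dx; have lG := proj2 (genS x) Dx; set y := lapp G x in lG *.
apply/eqP; rewrite -normr_le0; apply/ler_addgt0Pr => e e0; rewrite add0r.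
have c1 : 0 < 2 * (hnorm x + 1) by have := hnorm_ge0 x; lra.
have c2 : 0 < (hnorm y + 1) ^+ 2 by rewrite exprn_gt0//; have := hnorm_ge0 y; lra.
pose e' := Num.min 1 (e / (2 * (hnorm x + 1))).
have e'0 : 0 < e' by rewrite lt_min ltr01 divr_gt0.
have [d [d0 hd]] := lG _ e'0.
pose t := Num.min (d / 2) (e / (hnorm y + 1) ^+ 2).
have t0 : 0 < t by rewrite lt_min !divr_gt0.
have td : t < d by rewrite /t gt_min; apply/orP; left; lra.
have te : t <= e / (hnorm y + 1) ^+ 2 by rewrite ge_min lexx orbT.
have := hd t t0 td; set q := _ *: _; rewrite lt_min => /andP[q1 q2].
have qx : rip q x = - (t / 2) * rip q q.
  have := isoS x (ltW t0) => /(congr1 (fun r => r ^+ 2)); rewrite !hnorm2.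
  rewrite /q !ripE (ripC x (S t x)) => ->; field; exact: lt0r_neq0.
have qn : hnorm q <= hnorm y + 1 by have := hnorm_le_add q y; lra.
have qq : rip q q <= (hnorm y + 1) ^+ 2.
  by rewrite -hnorm2 ler_sqr ?nnegrE ?hnorm_ge0//; have := hnorm_ge0 y; lra.
have -> : rip y x = - rip (q - y) x + rip q x by rewrite !ripE; ring.
apply: le_trans (ler_normD _ _) _; rewrite normrN qx.
have := CauchySchwarz (q - y) x; rewrite ltr_pdivlMr// in q2; rewrite ler_pdivlMr// in te.
have tn : `|t / 2| = t / 2 by rewrite ger0_norm//; lra.
rewrite normrM normrN tn (ger0_norm (rip_ge0 q)) => h1.
have := hnorm_ge0 x; have := hnorm_ge0 (q - y); have := ler_wpM2l (ltW t0) qq; nra.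
Qed.

Section Laplace.
Variable l : R.
Hypothesis l0 : 0 < l.
(** Discounting turns isometries into strict contractions at positive times, so that [1 - W t]
    becomes invertible. *)
Let W t x := (expR (- (l * t)))%:C *: S t x.

Lemma discounted_norm t x : 0 <= t -> hnorm (W t x) = expR (- (l * t)) * hnorm x.
Proof. by move=> t0; rewrite /W hnormZ isoS// ger0_norm// expR_ge0. Qed.

Lemma discount_le1 t : 0 <= t -> expR (- (l * t)) <= 1.
Proof. by move=> t0; rewrite -expR0 ler_expR oppr_le0 mulr_ge0// ltW. Qed.

Lemma discount_ge t : 1 - l * t <= expR (- (l * t)).
Proof. exact: expR_ge1Dx. Qed.

(** With [discount_ge] this pins [expR (- (l * t))] to [1 - l * t] up to [(l * t) ^+ 2], the
    precision needed to differentiate the orbit of the resolvent vector. *)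
Lemma discount_le t : 0 <= t -> expR (- (l * t)) * (1 + l * t) <= 1.
Proof.
move=> t0; rewrite expRN mulrC ler_pdivrMr ?expR_gt0// mul1r.
exact: expR_ge1Dx.
Qed.

Lemma discounted_semigroup : c0_semigroup W.
Proof.
split.
  move=> t t0; split.
    move=> a x y; rewrite /W (bop_lin (sg_bop cS t0)).
    by apply: inner_ext => w; rewrite !innerE; ring.
  exists 1 => x; rewrite discounted_norm//; apply: ler_wpM2r; first exact: hnorm_ge0.
  exact: discount_le1.
split; first by move=> x; rewrite /W mulr0 oppr0 expR0 scale1r (sg0 cS).
split.
  move=> t s x t0 s0; rewrite /W (bopZ (sg_bop cS t0)) scalerA -(sgD cS)//.
  by rewrite -rmorphM -expRD mulrDr opprD.
move=> x e e0; have e2 : 0 < e / 2 by lra.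
have [d [d0 hd]] := sg_lim0 cS x e2.
have c1 : 0 < 2 * (l * (hnorm x + 1)) by rewrite !mulr_gt0// ltr_pwDr ?hnorm_ge0.
exists (Num.min d (e / (2 * (l * (hnorm x + 1))))); split; first by rewrite lt_min d0 divr_gt0.
move=> t t0; rewrite lt_min => /andP[td te]; rewrite ltr_pdivlMr// in te.
have := hd t t0 td; have := discount_ge t; have := discount_le1 (ltW t0).
set r := expR _ => r1 r2 h1.
have -> : W t x - x = r%:C *: (S t x - x) + (r - 1)%:C *: x.
  by apply: rip_ext => w; rewrite /W -/r !ripE; ring.
apply: le_lt_trans (hnormD _ _) _; rewrite !hnormZ.
rewrite ger0_norm ?expR_ge0// ler0_norm; last lra.
have := hnorm_ge0 x; have := hnorm_ge0 (S t x - x) => p0 x0.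
have : r * hnorm (S t x - x) <= hnorm (S t x - x) by rewrite ler_piMl.
have : - (r - 1) * hnorm x <= l * t * hnorm x by apply: ler_wpM2r => //; lra.
have : 0 <= l * t by rewrite ltW// mulr_gt0.
nra.
Qed.

(* [u n] is the Riemann sum [h (1 - W h)^-1 x] of [int_0^oo e^(-l t) S t x dt] with step [h = 2^-n]. *)
Lemma resolvent_real x : exists u, ldom G u /\ l%:C *: u - lapp G u = x.
Proof.
have [V [cW Vn VE]] : exists V, [/\ c0_semigroup V,
    forall t x, 0 <= t -> hnorm (V t x) = expR (- (l * t)) * hnorm x &
    forall t x, V t x = (expR (- (l * t)))%:C *: S t x].
  by exists W; split=> //; [exact: discounted_semigroup|exact: discounted_norm].
pose h := mesh R; have h0 n : 0 < h n by exact: mesh_gt0.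
(* [V (h n)] scales norms by [expR (- (l * h n))], so [1 - V (h n)] is bounded below by a multiple
   of [h n]; [h n <= 1] makes the constant [(1 + l) / l] uniform in [n]. *)
have gap n v (d : R) : hnorm (v - V (h n) v) <= h n * d -> hnorm v <= (1 + l) / l * d.
  move=> hv; have := hnorm_le_add v (V (h n) v); rewrite Vn ?(ltW (h0 n))// => h1.
  have := discount_le (ltW (h0 n)); move: h1; set r := expR _ => h1 r1.
  have h11 : h n <= 1 by rewrite /h /mesh exprn_ile1//; lra.
  have v0 := hnorm_ge0 v.
  have r0 : 0 < r by exact: expR_gt0.
  have lh : 0 < l * h n by exact: mulr_gt0.
  have a1 : hnorm v * (1 - r) <= h n * d by lra.
  have hd0 : 0 <= h n * d by apply: le_trans hv; exact: hnorm_ge0.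
  have a2 : l * h n <= (1 - r) * (1 + l * h n) by nra.
  have a3 : hnorm v * (l * h n) <= h n * d * (1 + l * h n).
    apply: le_trans (ler_wpM2l v0 a2) _; rewrite (mulrA (hnorm v)).
    by apply: ler_wpM2r a1; lra.
  have a4 : h n * (l * hnorm v) <= h n * (d * (1 + l)).
    have : h n * d * (l * h n) <= h n * d * l by apply: ler_wpM2l => //; rewrite ler_piMr// ltW.
    lra.
  by rewrite mulrAC ler_pdivlMr// mulrC (mulrC _ d); rewrite ler_pM2l in a4.
have /boolp.choice[u uE] : forall n, exists u, u - V (h n) u = (h n)%:C *: x.
  move=> n; have hn := ltW (h0 n).
  have q0 : 0 <= expR (- (l * h n)) by exact: expR_ge0.
  have q1 : expR (- (l * h n)) < 1 by rewrite -expR0 ltr_expR oppr_lt0 mulr_gt0.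
  have [v1 v2|v vE] := @banach_fixpoint R H (fun v => (h n)%:C *: x + V (h n) v) _ q0 q1.
    by rewrite opprD addrACA subrr add0r -(bopB (sg_bop cW hn)) Vn.
  by exists v; rewrite -{1}vE addrK.
(* Telescoping [u - V (h n) u = h n *: x] along the orbit makes [u - V (m h) u] the Riemann sum of
   [V s x] over [[0, m h]], compared here with the constant [x]. *)
have riemann n m (om : R) : (forall s, 0 <= s <= m%:R * h n -> hnorm (V s x - x) <= om) ->
    hnorm (u n - V (m%:R * h n) (u n) - (m%:R * h n)%:C *: x) <= m%:R * h n * om.
  elim: m => [_|m ih hom].
    by rewrite !mul0r (sg0 cW) scale0r !subr0 subrr hnorm0.
  have hn := ltW (h0 n).
  have mh : 0 <= m%:R * h n by rewrite mulr_ge0.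
  have mS : m.+1%:R * h n = m%:R * h n + h n by rewrite -natr1 mulrDl mul1r.
  have -> : u n - V (m.+1%:R * h n) (u n) - (m.+1%:R * h n)%:C *: x =
     (u n - V (m%:R * h n) (u n) - (m%:R * h n)%:C *: x) + (h n)%:C *: (V (m%:R * h n) x - x).
    rewrite mS (sgD cW)//.
    have -> : V (h n) (u n) = u n - (h n)%:C *: x by rewrite -uE opprB addrC subrK.
    rewrite (bopB (sg_bop cW mh)) (bopZ (sg_bop cW mh)).
    by apply: rip_ext => w; rewrite !ripE; ring.
  apply: le_trans (hnormD _ _) _; rewrite mS mulrDl hnormZ (gtr0_norm (h0 n)); apply: lerD.
    by apply: ih => s /andP[s0 s1]; apply: hom; rewrite s0 mS /=; apply: le_trans s1 _; rewrite lerDl.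
  by apply: ler_wpM2l => //; apply: hom; rewrite mh mS lerDl.
have om_ex (e : R) : 0 < e -> exists d, 0 < d /\ forall s, 0 <= s <= d -> hnorm (V s x - x) <= e.
  move=> e0; have [d [d0 hd]] := sg_lim0 cW x e0; exists (d / 2); split; first lra.
  move=> s /andP[]; rewrite le_eqVlt => /predU1P[<- _|s0 sd].
    by rewrite (sg0 cW) subrr hnorm0 ltW.
  by apply/ltW/hd => //; lra.
have K0 : 0 < (1 + l) / l by rewrite divr_gt0// addr_gt0.
have [v uv] : exists v, seq_lim u v.
  apply: (@hs_complete R H) => e e0.
  pose e' := e / (4 * ((1 + l) / l)).
  have e'0 : 0 < e' by rewrite /e' divr_gt0// mulr_gt0.
  have [d [d0 hd]] := om_ex _ e'0; have [N hN] := mesh_small 1 d0.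
  (* Both solutions are compared at the coarse step: [h N] is a multiple of [h n], so by [riemann]
     the vector [u n - u N] is almost fixed by [V (h N)], and [gap] makes it small. *)
  have near n : (N <= n)%N -> hnorm (u n - u N) <= e / 4.
    move=> Nn; have hNn := mesh_pow R Nn.
    have : hnorm (u n - u N - V (h N) (u n - u N)) <= h N * e'.
      have := riemann n (2 ^ (n - N))%N e'; rewrite -hNn => /(_ _).
      have -> : u n - u N - V (h N) (u n - u N) = u n - V (h N) (u n) - (h N)%:C *: x.
        rewrite (bopB (sg_bop cW (ltW (h0 N)))) -uE opprB.
        by apply: rip_ext => w; rewrite !ripE; ring.
      apply=> s /andP[s0 s1]; apply: hd; rewrite s0 /=.
      by have := hN N (leqnn _); rewrite -/(h N); move: s1; rewrite -/(h N); lra.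
    move/gap => /le_trans -> //; rewrite /e' le_eqVlt; apply/orP; left; apply/eqP.
    by field; rewrite (lt0r_neq0 l0) lt0r_neq0// addr_gt0.
  exists N => m n Nm Nn; have := near m Nm; have := near n Nn.
  have := hnorm_tri (u N) (u m) (u n); rewrite (hnorm_sub (u N) (u n)); lra.
(* The window is [2 t] because the grid times [tn n] lie above [t], within one mesh. *)
have main t (om : R) : 0 < t -> (forall s, 0 <= s <= 2 * t -> hnorm (V s x - x) <= om) ->
    hnorm (v - V t v - t%:C *: x) <= 2 * t * om.
  move=> t0 hom; pose tn n := (floor_idx t n).+1%:R * mesh R n.
  have tn1 n : t < tn n by rewrite /tn -natr1 mulrDl mul1r floor_idx_gt.
  have tn2 n : tn n <= t + h n.
    by rewrite /tn -natr1 mulrDl mul1r lerD2r floor_idx_le// ltW.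
  have om0 : 0 <= om.
    by apply: le_trans (hom 0 _); [exact: hnorm_ge0|lra].
  have [N hN] := mesh_small 1 t0.
  apply: (@seq_lim_hnorm_le _ _ (fun n => u n - V (tn n) (u n) - (tn n)%:C *: x) _ _ N).
    move=> n /hN; rewrite mul1r => hn; have t2 := tn2 n.
    have tn2' : tn n <= 2 * t by rewrite /h in t2; lra.
    apply: le_trans (riemann n _ om _) _.
      by move=> s /andP[s0 s1]; apply: hom; rewrite s0 /=; apply: le_trans s1 _.
    by apply: ler_wpM2r.
  have Wlim := sg_dyadic cW v (ltW t0).
  have tn0 n : 0 <= tn n by apply: ltW; exact: lt_trans (tn1 n).
  apply: seq_limD; first apply: seq_limD => //.
    move=> e e0; have e2 : 0 < e / 2 by lra.
    have [N1 h1] := Wlim _ e2; have [N2 h2] := uv _ e2.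
    exists (maxn N1 N2) => n; rewrite geq_max => /andP[n1 n2].
    rewrite opprK addrC.
    have := h1 n n1; have := h2 n n2; rewrite -/(tn n).
    have := hnorm_tri (V (tn n) v) (V t v) (V (tn n) (u n)).
    rewrite -(bopB (sg_bop cW (tn0 n)) v) Vn//.
    have := discount_le1 (tn0 n); have := hnorm_ge0 (v - u n).
    rewrite (hnorm_sub v) (hnorm_sub (V t v) (V (tn n) v)) (hnorm_sub (V t v) (V (tn n) (u n))); nra.
  apply: (@seq_lim_squeeze _ _ _ _ (fun n => hnorm x * h n)); last first.
    by move=> d; exact: mesh_small.
  move=> n; have -> : - ((tn n)%:C *: x) - - (t%:C *: x) = (t - tn n)%:C *: x.
    by apply: rip_ext => w; rewrite !ripE; ring.
  rewrite hnormZ mulrC; apply: ler_wpM2l; first exact: hnorm_ge0.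
  by rewrite ler0_norm; have := tn1 n; have := tn2 n; lra.
have dv : right_lim0 (fun t => (t^-1)%:C *: (S t v - v)) (l%:C *: v - x).
  move=> e e0.
  have e8 : 0 < e / 8 by lra.
  have [d1 [d10 hd1]] := om_ex _ e8.
  have el : 0 < e / (4 * l) by rewrite divr_gt0 ?mulr_gt0.
  have [d2 [d20 hd2]] := sg_lim0 cS v el.
  have c3 : 0 < 4 * (l ^+ 2 * (hnorm v + 1)).
    by rewrite !mulr_gt0 ?exprn_gt0// ltr_pwDr ?hnorm_ge0.
  pose d := Num.min (d1 / 2) (Num.min d2 (e / (4 * (l ^+ 2 * (hnorm v + 1))))).
  exists d; split; first by rewrite !lt_min !divr_gt0// d20.
  move=> t t0; rewrite !lt_min => /and3P[td1 td2 td3].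
  have m1 : hnorm (v - V t v - t%:C *: x) <= 2 * t * (e / 8).
    by apply: main => // s /andP[s0 s1]; apply: hd1; rewrite s0 /=; lra.
  have m2 := hd2 t t0 td2; rewrite ltr_pdivlMr// in td3; rewrite ltr_pdivlMr ?mulr_gt0// in m2.
  have r1 := discount_ge t; have r2 := discount_le (ltW t0).
  (* Each piece is small against [t]: [S t v - v] tends to zero, the scalar in front of [S t v] is
     of second order, and the last bracket is controlled by [main]. *)
  have -> : (t^-1)%:C *: (S t v - v) - (l%:C *: v - x) = (t^-1)%:C *:
      ((l * t)%:C *: (S t v - v) + (1 - expR (- (l * t)) - l * t)%:C *: S t v
        - (v - V t v - t%:C *: x)).
    by apply: rip_ext => w; rewrite VE !ripE; field; exact: lt0r_neq0.
  rewrite hnormZ gtr0_norm ?invr_gt0// ltr_pdivrMl//.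
  apply: le_lt_trans (hnormB _ _) _; apply: le_lt_trans (lerD (hnormD _ _) m1) _.
  have lt0 : 0 < l * t by exact: mulr_gt0.
  rewrite !hnormZ (gtr0_norm lt0) (isoS _ (ltW t0)).
  set r := expR _ in r1 r2 *.
  have r3 : `|1 - r - l * t| <= (l * t) ^+ 2.
    rewrite ler_norml; apply/andP; split; last by have := sqr_ge0 (l * t); lra.
    have : r * (1 + l * t) <= (1 - l * t + (l * t) ^+ 2) * (1 + l * t).
      have : 0 <= (l * t) ^+ 3 by rewrite exprn_ge0// ltW.
      lra.
    by rewrite ler_pM2r; lra.
  have := ler_wpM2r (hnorm_ge0 v) r3; have v0 := hnorm_ge0 v => r4.
  have : (l * t) ^+ 2 * hnorm v <= t * e / 4.
    have := ler_wpM2l (ltW t0) (ltW td3); have := sqr_ge0 (l * t); lra.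
  have : l * t * hnorm (S t v - v) < t * e / 4.
    by rewrite -(ltr_pM2l t0) in m2; lra.
  have : 0 < t * e by exact: mulr_gt0.
  lra.
have Dv : ldom G v by apply/(proj1 (genS v)); exists (l%:C *: v - x).
exists v; split=> //.
rewrite (right_lim0_unique (proj2 (genS v) Dv) dv).
by rewrite opprB addrC subrK.
Qed.

End Laplace.

(** A real [l] is chosen closer to [Complex a b] than its own size: [|l - (a + i b)|^2 = l^2 - 2 a].
    Since the resolvent at [l] has norm at most [1 / l], the equation perturbed from [l] is a
    contraction. *)
Lemma isometric_range (a b : R) y : is_linop G -> 0 < a ->
  exists x, ldom G x /\ Complex a b *: x - lapp G x = y.
Proof.
move=> linG a0.
have skewG := isometric_generator_skew.
pose l := (a ^+ 2 + b ^+ 2) / (2 * a) + 1.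
have ab0 : 0 <= (a ^+ 2 + b ^+ 2) / (2 * a) by rewrite divr_ge0 ?addr_ge0 ?sqr_ge0//; lra.
have l0 : 0 < l by rewrite /l; lra.
have lE : 2 * a * l = a ^+ 2 + b ^+ 2 + 2 * a by rewrite /l; field; lra.
have /boolp.choice[R0 R0E] := fun z => resolvent_real l0 z.
have bnd w z : ldom G w -> l%:C *: w - lapp G w = z -> l * hnorm w <= hnorm z.
  move=> Dw wE; have : l * hnorm w ^+ 2 <= hnorm z * hnorm w.
    by apply: le_trans (rip_le _ _); rewrite hnorm2 -wE ripDl ripNl ripZl skewG// oppr0 addr0.
  have [->|w0] := eqVneq w 0; first by rewrite hnorm0 !mulr0 => _; exact: hnorm_ge0.
  by rewrite expr2 mulrA ler_pM2r// sqrtr_gt0 rip_gt0.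
have R0b z1 z2 : l * hnorm (R0 z1 - R0 z2) <= hnorm (z1 - z2).
  have [D1 E1] := R0E z1; have [D2 E2] := R0E z2.
  apply: bnd; first exact: domB.
  rewrite (appB linG)// -[in RHS]E1 -[in RHS]E2.
  by apply: inner_ext => v; rewrite !innerE; ring.
pose c := Complex (l - a) (- b).
pose k := Num.sqrt ((l - a) ^+ 2 + (- b) ^+ 2).
have kl : k < l.
  rewrite -ltr_sqr ?nnegrE ?sqrtr_ge0 ?(ltW l0)// sqr_sqrtr ?addr_ge0 ?sqr_ge0//; nra.
have [||x1 x2|x xE] := @banach_fixpoint R H (fun x => R0 (y + c *: x)) (k / l).
- by rewrite divr_ge0 ?sqrtr_ge0 ?(ltW l0).
- by rewrite ltr_pdivrMr// mul1r.
- rewrite mulrAC ler_pdivlMr// mulrC; apply: le_trans (R0b _ _) _.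
  by rewrite opprD addrACA subrr add0r -scalerBr hnormZc.
exists x; have [Dx E] := R0E (y + c *: x); rewrite xE in Dx E; split=> //.
have -> : lapp G x = l%:C *: x - (y + c *: x) by rewrite -E opprB addrC subrK.
have -> : Complex a b = l%:C - c.
  by apply/eqP; rewrite eq_complex /=; apply/andP; split; apply/eqP; ring.
by apply: inner_ext => v; rewrite !innerE; ring.
Qed.

End Isometric.

(** * Conjugation by an invertible operator *)

Section Transport.
Variables (R : realType) (H : hilbertSpace R) (P Q : H -> H).
Hypotheses (bP : bounded_op P) (bQ : bounded_op Q).
Hypotheses (PQ : forall x, P (Q x) = x) (QP : forall x, Q (P x) = x).
Local Notation "r %:C" := (real_complex R r) : ring_scope.

Definition conj_linop (E : linop H H) : linop H H :=
  LinOp [set x | ldom E (Q x)] (fun x => P (lapp E (Q x))).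

Definition conj_semigroup (T : R -> H -> H) t x := P (T t (Q x)).

Lemma conj_linop_linear E : is_linop E -> is_linop (conj_linop E).
Proof.
move=> linE; split; first by rewrite /= (bop0 bQ); case: linE.
move=> a x y /= Dx Dy; have [_ /(_ a _ _ Dx Dy)[D1 e1]] := linE.
by rewrite (bop_lin bQ) e1 (bop_lin bP).
Qed.

Lemma right_lim0_bop (f : R -> H) (y : H) (B : H -> H) : bounded_op B ->
  right_lim0 f y -> right_lim0 (fun t => B (f t)) (B y).
Proof.
move=> bB fy e e0; have [M [M0 hM]] := bop_bound bB.
have [d [d0 hd]] := fy _ (divr_gt0 e0 M0); exists d; split=> // t t0 td.
rewrite -(bopB bB); apply: le_lt_trans (hM _) _.
by have := hd t t0 td; rewrite ltr_pdivlMr// mulrC.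
Qed.

Lemma right_lim0_ext (f g : R -> H) (y : H) : (forall t, 0 < t -> f t = g t) ->
  right_lim0 f y -> right_lim0 g y.
Proof.
move=> fg fy e /fy[d [d0 hd]]; exists d; split=> // t t0 td.
by rewrite -fg//; exact: hd.
Qed.

Lemma conj_semigroup_c0 T : c0_semigroup T -> c0_semigroup (conj_semigroup T).
Proof.
move=> cT; rewrite /conj_semigroup; split.
  move=> t t0; apply: bounded_op_comp bP; apply: bounded_op_comp bQ _.
  exact: (sg_bop cT).
split; first by move=> x; rewrite (sg0 cT).
split; first by move=> t s x t0 s0; rewrite QP (sgD cT).
move=> x; have := right_lim0_bop bP (sg_lim0 cT (Q x)); by rewrite PQ.
Qed.

Lemma conj_semigroup_generates T E : c0_semigroup T -> generates T E ->
  generates (conj_semigroup T) (conj_linop E).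
Proof.
move=> cT gT x.
have quo (y : H) : right_lim0 (fun t => t^-1%:C *: (T t (Q x) - Q x)) y ->
    right_lim0 (fun t => t^-1%:C *: (conj_semigroup T t x - x)) (P y).
  move=> /(right_lim0_bop bP); apply: right_lim0_ext => t t0.
  by rewrite (bopZ bP) (bopB bP) PQ.
have quo' (y : H) : right_lim0 (fun t => t^-1%:C *: (conj_semigroup T t x - x)) y ->
    right_lim0 (fun t => t^-1%:C *: (T t (Q x) - Q x)) (Q y).
  move=> /(right_lim0_bop bQ); apply: right_lim0_ext => t t0.
  by rewrite (bopZ bQ) (bopB bQ) /conj_semigroup QP.
split=> /=.
  split=> [/(proj1 (gT (Q x)))[y yE]|[y yE]]; first by exists (P y); exact: quo.
  by apply/(proj1 (gT (Q x))); exists (Q y); exact: quo'.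
by move=> /(proj2 (gT (Q x))); exact: quo.
Qed.

End Transport.

(** * Integrals up to null sets *)

Section NullModification.
Context {d : measure_display} {T : measurableType d} {R : realType}.
Variable mu : {measure set T -> \bar R}.
Import HBNNSimple.
Local Open Scope ereal_scope.

(* No measurability of [f] and [g]: the integral is a supremum over simple minorants. *)
Lemma le_integral_off_null (D N : set T) (f g : T -> \bar R) :
  measurable N -> mu N = 0 -> (forall x, D x -> 0 <= f x) -> (forall x, D x -> 0 <= g x) ->
  (forall x, D x -> ~ N x -> f x <= g x) ->
  \int[mu]_(x in D) f x <= \int[mu]_(x in D) g x.
Proof.
move=> mN N0 f0 g0 fg; rewrite !ge0_integralE//; apply: ge_ereal_sup => _ [h /= hf <-].
(* Cutting the simple minorant [h] to zero on [N] keeps its integral and makes it a minorant of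
   [g]. *)
pose h' := proj_nnsfun h (measurableC mN).
have -> : sintegral mu h = sintegral mu h'.
  rewrite -!integralT_nnsfun; apply: ge0_ae_eq_integral => //.
  - exact/measurable_EFinP.
  - exact/measurable_EFinP.
  - by move=> x _; rewrite lee_fin.
  - by move=> x _; rewrite lee_fin.
  exists N; split=> // x /= hx; apply: contrapT => Nx; apply: hx => _.
  by rewrite /h' /= mindicE mem_set// mulr1.
apply: ereal_sup_ubound; exists h' => //= x.
rewrite mindicE; have [xN|xN] := boolP (x \in ~` N); last first.
  by rewrite mulr0 patchE; case: ifPn => // /set_mem; exact: g0.
rewrite mulr1; apply: le_trans (hf x) _; rewrite !patchE; case: ifPn => // /set_mem Dx.
by apply: fg => //; exact: set_mem xN.
Qed.

Lemma eq_integral_off_null (D N : set T) (f g : T -> \bar R) :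
  measurable N -> mu N = 0 -> (forall x, D x -> 0 <= f x) -> (forall x, D x -> 0 <= g x) ->
  (forall x, D x -> ~ N x -> f x = g x) ->
  \int[mu]_(x in D) f x = \int[mu]_(x in D) g x.
Proof.
move=> mN N0 f0 g0 fg; apply/eqP; rewrite eq_le; apply/andP; split;
  by apply: (@le_integral_off_null D N) => // x Dx Nx; rewrite fg.
Qed.

End NullModification.

(** * Strong measurability *)

Section StronglyMeasurable.
Variables (R : realType) (K : hilbertSpace R).
Implicit Types (f g : R -> K) (A D N : set R).

(** Convergence is required at every point, unlike in [bochner_measurable], so measurability of
    scalar products passes to the limit without an exceptional set. [bochner_cut] reaches this
    situation by zeroing the function on the null set. *)
Definition strongly_measurable f := exists s : nat -> R -> K,
  (forall n, simple_fun (s n)) /\ forall x, seq_lim (fun n => s n x) (f x).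

Definition cut A f : R -> K := fun x => if `[< A x >] then f x else 0.

Lemma cutT A f x : A x -> cut A f x = f x.
Proof. by move=> Ax; rewrite /cut asboolT. Qed.

Lemma cutF A f x : ~ A x -> cut A f x = 0.
Proof. by move=> Ax; rewrite /cut asboolF. Qed.

Lemma simple_fun_cut A f : measurable A -> simple_fun f -> simple_fun (cut A f).
Proof.
move=> mA [n [v [B [mB fE]]]]; exists n, v, (fun i => B i `&` A); split.
  by move=> i; exact: measurableI.
move=> x; rewrite /cut; case: asboolP => Ax.
  rewrite fE; apply: eq_bigl => i; apply/asboolP/asboolP => [Bx|[]//]; exact: conj Bx Ax.
by rewrite big_pred0// => i; apply/asboolP => -[].
Qed.

Lemma bochner_cut D f : measurable D -> bochner_measurable D f ->
  exists N, [/\ measurable N, @lebesgue_measure R N = 0%E & strongly_measurable (cut (D `\` N) f)].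
Proof.
move=> mD [s [ss [N [mN [N0 h]]]]]; exists N; split=> //.
exists (fun n => cut (D `\` N) (s n)); split.
  by move=> n; apply: simple_fun_cut => //; exact: measurableD.
move=> x; have [DNx|DNx] := pselect ((D `\` N) x).
  rewrite cutT//; apply: seq_lim_eq (h x _ _); [|by case: DNx|by case: DNx].
  by move=> n; rewrite cutT.
rewrite cutF//; apply: seq_lim_eq (seq_lim_cst 0) => n; by rewrite cutF.
Qed.

Lemma simple_fun_rip_measurable f g : simple_fun f -> simple_fun g ->
  measurable_fun setT (fun x => rip (f x) (g x) : R).
Proof.
move=> [n [v [A [mA fE]]]] [m [w [B [mB gE]]]].
have -> : (fun x => rip (f x) (g x)) = (fun x => \sum_(i < n) \sum_(j < m)
    (\1_(A i) x * \1_(B j) x * rip (v i) (w j))).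
  apply/funext => x; rewrite fE gE big_mkcond rip_sum; apply: eq_bigr => i _.
  rewrite indicE; case: asboolP => Ax; last first.
    rewrite memNset// rip0l big1// => j _; by rewrite !mul0r.
  rewrite mem_set// ripC big_mkcond rip_sum; apply: eq_bigr => j _.
  rewrite indicE; case: asboolP => Bx; last by rewrite memNset// mulr0 mul0r rip0l.
  by rewrite mem_set// !mul1r ripC.
apply: measurable_sum => i; apply: measurable_sum => j.
by apply: measurable_funM => //; apply: measurable_funM; exact: measurable_indic.
Qed.

Lemma seq_lim_rip_cvg (V : preHilbert R) (s r : nat -> V) (a b : V) :
  seq_lim s a -> seq_lim r b -> rip (s n) (r n) @[n --> \oo] --> rip a b.
Proof.
move=> sa rb; apply/cvgrPdist_lt => e e0.
have ca : 0 < 2 * (hnorm b + 1) by have := hnorm_ge0 b; lra.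
have cb : 0 < 2 * (hnorm a + 1) by have := hnorm_ge0 a; lra.
have [N1 h1] := sa _ (divr_gt0 e0 ca); have [N2 h2] := rb _ (divr_gt0 e0 cb).
have [N3 h3] := sa 1 ltr01.
exists (maxn N1 (maxn N2 N3)) => // n /=; rewrite !geq_max => /and3P[n1 n2 n3].
have := h1 n n1; have := h2 n n2; have := h3 n n3; rewrite !ltr_pdivlMr// => e3 e2 e1.
have -> : rip a b - rip (s n) (r n) = - rip (s n - a) b - rip (s n) (r n - b).
  by rewrite !ripE; ring.
apply: le_lt_trans (ler_normB _ _) _; rewrite normrN.
have := CauchySchwarz (s n - a) b; have := CauchySchwarz (s n) (r n - b).
have := hnorm_le_add (s n) a.
have := hnorm_ge0 (s n - a); have := hnorm_ge0 (r n - b); have := hnorm_ge0 a; have := hnorm_ge0 b.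
move: e1 e2 e3; set p := hnorm (s n - a); set q := hnorm (r n - b); set u := hnorm a; set v := hnorm b.
set w := hnorm (s n) => e1 e2 e3 v0 u0 q0 p0 wu h4 h5.
have : w * q <= (u + 1) * q by apply: ler_wpM2r => //; lra.
lra.
Qed.

Lemma rip_measurable f g : strongly_measurable f -> strongly_measurable g ->
  measurable_fun setT (fun x => rip (f x) (g x) : R).
Proof.
move=> [s [ss sf]] [r [sr rg]].
apply: (@measurable_fun_cvg _ _ _ _ (fun n x => rip (s n x) (r n x))).
  by move=> n; exact: simple_fun_rip_measurable.
by move=> x _; exact: seq_lim_rip_cvg.
Qed.

(** On the cell containing [t] the step function takes the value at the right endpoint, which lies
    strictly beyond [t], as one-sided continuity demands. *)
Lemma bochner_of_right_continuous D f :
  (forall t (e : R), D t -> 0 < e -> exists d, 0 < d /\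
    forall s, t < s -> s < t + d -> hnorm (f s - f t) < e) ->
  bochner_measurable D f.
Proof.
move=> rc; pose h := mesh R.
have h0 n : 0 < h n by rewrite /h mesh_gt0.
(* The grid starts at [- 2 ^ n], since [(h n)^-1 = 2 ^ n]; [2 * 4 ^ n] cells of width [2^-n] then
   reach [2 ^ n], and these intervals exhaust the line. *)
pose a n i : R := i%:R * h n - (h n)^-1.
exists (fun n t => \sum_(i < 2 * 4 ^ n | `[< a n i <= t < a n i.+1 >]) f (a n i.+1)); split.
  move=> n; exists (2 * 4 ^ n)%N, (fun i : 'I_ _ => f (a n i.+1)),
    (fun i : 'I_ _ => `[a n i, a n i.+1[%classic); split.
    by move=> i; exact: measurable_itv.
  by move=> x; apply: eq_bigl => i; rewrite /= in_itv.
exists set0; split=> //; split; first exact: measure0.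
move=> t Dt _ e e0; have [d [d0 hd]] := rc t e Dt e0.
have [N1 h1] := mesh_small 1 d0.
have t1 : 0 < (`|t| + 1)^-1 by rewrite invr_gt0 ltr_pwDr.
have [N2 h2] := mesh_small 1 t1.
exists (maxn N1 N2) => n; rewrite geq_max => /andP[n1 n2].
have hd1 := h1 n n1; have ht1 := h2 n n2; rewrite mul1r -/(h n) in hd1; rewrite mul1r -/(h n) in ht1.
have tn : `|t| + 1 < (h n)^-1 by rewrite -[ltLHS]invrK ltf_pV2 ?posrE//.
have tb := tn; have /andP[tb1 tb2] : - (h n)^-1 < t < (h n)^-1.
  by rewrite -ltr_norml; have := tn; lra.
have th0 : 0 <= t + (h n)^-1 by lra.
pose j := floor_idx (t + (h n)^-1) n.
have jle : j%:R * h n <= t + (h n)^-1 by exact: floor_idx_le.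
have jgt : t + (h n)^-1 < j%:R * h n + h n by exact: floor_idx_gt.
have jS : a n j.+1 = a n j + h n by rewrite /a -natr1; ring.
have jlt : (j < 2 * 4 ^ n)%N.
  rewrite -(ltr_nat R) -(ltr_pM2r (h0 n)); apply: le_lt_trans jle _.
  have -> : (2 * 4 ^ n)%:R * h n = (h n)^-1 + (h n)^-1.
    have -> : (2 * 4 ^ n)%:R = 2 * ((h n)^-1 * (h n)^-1).
      rewrite natrM natrX /h /mesh -exprVn invrK -exprMn; congr (_ * _ ^+ _).
      by rewrite -natrM.
    by field; rewrite lt0r_neq0.
  by lra.
rewrite (big_pred1 (Ordinal jlt)) /=; last first.
  move=> i /=; apply/asboolP/eqP => [/andP[i1 i2]|->]; last first.
    by rewrite jS /a; apply/andP; split; lra.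
  move: i1 i2; rewrite /a -!natr1 => i1 i2.
  have ij : (i < j.+1)%N by rewrite -(ltr_nat R) -(ltr_pM2r (h0 n)) -natr1; lra.
  have ji : (j < i.+1)%N by rewrite -(ltr_nat R) -(ltr_pM2r (h0 n)) -natr1; lra.
  by apply/val_inj/eqP; rewrite /= eqn_leq -ltnS ij -ltnS ji.
apply: hd; rewrite jS /a; lra.
Qed.

End StronglyMeasurable.

(** * Algebra of the resolvent *)

Section ResolventFacts.
Variables (R : realType) (H : hilbertSpace R) (E : linop H H).
Hypothesis linE : is_linop E.

Lemma resolvent_spec l y : resolvent_set E l ->
  ldom E (resolvent E l y) /\ l *: resolvent E l y - lapp E (resolvent E l y) = y.
Proof.
move=> [Rl [_ [h _]]]; rewrite /resolvent.
by apply: (@xgetPex _ 0 [set x | ldom E x /\ l *: x - lapp E x = y]); exists (Rl y); exact: h.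
Qed.

Lemma resolvent_unique l x y : resolvent_set E l -> ldom E x -> l *: x - lapp E x = y ->
  resolvent E l y = x.
Proof.
move=> rl Dx e; have [D1 e1] := resolvent_spec y rl; have [Rl [_ [_ h]]] := rl.
by rewrite -(h x Dx) e -{2}e1 h.
Qed.

Lemma resolvent_lin l a x y : resolvent_set E l ->
  resolvent E l (a *: x + y) = a *: resolvent E l x + resolvent E l y.
Proof.
move=> rl; have [D1 e1] := resolvent_spec x rl; have [D2 e2] := resolvent_spec y rl.
apply: resolvent_unique => //; first exact: dom_lin.
rewrite app_lin// -[in RHS]e1 -[in RHS]e2.
by apply: inner_ext => w; rewrite !innerE; ring.
Qed.

Lemma resolvent_app l x : resolvent_set E l -> ldom E x ->
  resolvent E l (lapp E x) = l *: resolvent E l x - x.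
Proof.
move=> rl Dx; have [D1 e1] := resolvent_spec x rl.
apply: resolvent_unique => //; first by apply: domB => //; exact: domZ.
rewrite appB//; last exact: domZ.
rewrite appZ//.
have -> : lapp E (resolvent E l x) = l *: resolvent E l x - x.
  by rewrite -[X in _ = _ - X]e1 opprB addrC subrK.
by apply: inner_ext => w; rewrite !innerE; ring.
Qed.

Lemma rhp_resolvent_set (a b : R) : spectrum E `<=` [set z | complex.Re z <= 0] ->
  0 < a -> resolvent_set E (Complex a b).
Proof.
move=> sE a0; apply: contrapT => h; have /= := sE _ h; by rewrite leNgt a0.
Qed.

End ResolventFacts.

(** * The energy form at a fixed abscissa *)

Section Weight.
Variable R : realType.
Local Notation mu := (@lebesgue_measure R).

(** A multiple of the Cauchy density. The factor 2 gives [1 <= weight xi] for [|xi| <= 1] and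
    [1 <= xi^2 * weight xi] beyond, so one integrable majorant serves both regimes. *)
Definition weight (x : R) : R := 2 * (oneDsqr x)^-1.

Lemma weight_ge0 x : 0 <= weight x.
Proof.
by rewrite /weight mulr_ge0// invr_ge0; have := oneDsqr_ge1 x; lra.
Qed.

Lemma integrable_weight : mu.-integrable setT (EFin \o weight).
Proof.
have mw : measurable_fun setT (EFin \o (fun x : R => (oneDsqr x)^-1)).
  by apply/measurable_EFinP; apply: continuous_measurable_fun; exact: continuous_oneDsqrV.
have iw : mu.-integrable setT (EFin \o (fun x : R => (oneDsqr x)^-1)).
  apply/integrableP; split=> //.
  rewrite (eq_integral (fun x : measurableTypeR R => ((oneDsqr (x : R))^-1)%:E)); last first.
    by move=> x _ /=; rewrite ger0_norm// invr_ge0; have := oneDsqr_ge1 x; lra.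
  rewrite ge0_symfun_integralT.
  - have -> : [set x : R | 0 <= x] = `[0, +oo[%classic.
      by apply/seteqP; split=> x /=; rewrite in_itv /= andbT.
    by rewrite integral0y_oneDsqr -EFinM ltry.
  - by move=> x; rewrite invr_ge0; have := oneDsqr_ge1 x; lra.
  - exact: continuous_oneDsqrV.
  - by move=> x; rewrite /= /oneDsqr sqrrN.
have := integrableZl measurableT 2 iw.
by apply: eq_integrable.
Qed.

End Weight.

Section EnergyForm.
Variables (R : realType) (H K : hilbertSpace R).
Variables (F : H -> R -> K) (e : R).
Local Notation "r %:C" := (real_complex R r) : ring_scope.
Local Notation mu := (@lebesgue_measure R).
Hypothesis e0 : 0 < e.
Hypothesis Flin : forall a x y xi, F (a *: x + y) xi = a *: F x xi + F y xi.
Hypothesis Fb : forall x, bochner_measurable setT (F x).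

Definition energy x : \bar R := (e%:E * \int[mu]_(xi in [set: R]) ((hnorm (F x xi)) ^+ 2)%:E)%E.

(** To be read with [f = C R(l) x], [c = C x] and [y = C R(l) E x]. The term [rip c f] pairs a
    constant with [f]; for large [xi] the substitution [f = (y + c) / (e + i xi)] supplies a factor
    [1 / xi], which makes the terms in [c] integrable. The parameter [s] balances the
    arithmetic-geometric mean inequality and is fixed later. *)
Lemma weighted_bound (c f y : K) (s xi : R) : 0 < s -> e <= 1 ->
  y = Complex e xi *: f - c ->
  `|rip y f| <= (e + s) * rip f f + s * rip y y + (s^-1 + e) * rip c c * weight xi.
Proof.
move=> s0 e1 yE; have e_gt0 := e0.
have r1 : rip y f = e * rip f f - rip c f.
  rewrite yE scale_cplx !ripE ripi0; ring.
have [p [sV sV0 ->]] : exists p, [/\ s * p = 1, 0 < p & s^-1 = p].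
  by exists s^-1; split; rewrite ?mulfV ?invr_gt0// lt0r_neq0.
have f0 := rip_ge0 f; have y0 := rip_ge0 y; have c0 := rip_ge0 c.
suff main : `|rip c f| <= s * rip f f + s * rip y y + (p + e) * rip c c * weight xi.
  rewrite r1; apply: le_trans (ler_normB _ _) _; rewrite ger0_norm ?mulr_ge0 ?(ltW e0)//; lra.
have w0 := weight_ge0 xi.
have wE : weight xi * (1 + xi ^+ 2) = 2.
  by rewrite /weight -mulrA mulVf ?mulr1//; have := oneDsqr_ge1 xi; rewrite /oneDsqr => h; lra.
have am (a b : R) : 2 * (a * b) <= s * a ^+ 2 + p * b ^+ 2.
  rewrite -(ler_pM2l s0); have := sqr_ge0 (s * a - b).
  have -> : s * (s * a ^+ 2 + p * b ^+ 2) = s ^+ 2 * a ^+ 2 + (s * p) * b ^+ 2 by ring.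
  rewrite sV; lra.
have [x1|x1] := lerP (xi ^+ 2) 1.
  have w1 : 1 <= weight xi by have := sqr_ge0 xi; nra.
  have h1 : `|rip c f| <= s * rip f f + p * rip c c.
    apply: le_trans (CauchySchwarz _ _) _; have := am (hnorm f) (hnorm c).
    rewrite !hnorm2 (mulrC (hnorm f)); have := mulr_ge0 (hnorm_ge0 c) (hnorm_ge0 f); lra.
  have h2 : p * rip c c <= (p + e) * rip c c * weight xi.
    have : p * rip c c <= (p + e) * rip c c by rewrite ler_wpM2r//; lra.
    have : 0 <= (p + e) * rip c c by rewrite mulr_ge0//; lra.
    nra.
  have := mulr_ge0 (ltW s0) y0; lra.
pose X := `|xi|.
have X2 : X ^+ 2 = xi ^+ 2 by rewrite /X real_normK ?num_real.
have X1 : 1 < X by rewrite -(ltr_sqr) ?nnegrE ?normr_ge0// expr1n X2.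
have w1 : 1 <= xi ^+ 2 * weight xi by nra.
(* The substitution multiplied out by the conjugate of [l = e + i xi]: [|l|^2 f = conj l (y + c)],
   paired with [c]. *)
have D : (e ^+ 2 + xi ^+ 2) * rip c f = e * rip c y + e * rip c c - xi * rip c ('i%C *: y).
  have -> : e * rip c y + e * rip c c - xi * rip c ('i%C *: y)
     = rip c (Complex e (- xi) *: (y + c)).
    by rewrite scale_cplx (scalerDr 'i%C) !ripE (ripC c ('i%C *: c)) ripi0; ring.
  rewrite yE subrK -ripZr scalerA; congr (rip c (_ *: _)).
  by apply/eqP; rewrite eq_complex /=; apply/andP; split; apply/eqP; ring.
have k0 := hnorm_ge0 c; have n0 := hnorm_ge0 y.
have b1 : xi ^+ 2 * `|rip c f| <= e * rip c c + 2 * (X * hnorm y * hnorm c).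
  have c1 : xi ^+ 2 * `|rip c f| <= `|(e ^+ 2 + xi ^+ 2) * rip c f|.
    rewrite normrM [in leRHS]ger0_norm ?addr_ge0 ?sqr_ge0//; apply: ler_wpM2r => //.
    by have := sqr_ge0 e; lra.
  apply: le_trans c1 _; rewrite D.
  have c2 := CauchySchwarz c y; have c3 := CauchySchwarz c ('i%C *: y); rewrite hnormi in c3.
  apply: le_trans (ler_normB _ _) _; apply: le_trans (lerD (ler_normD _ _) (lexx _)) _.
  rewrite !normrM (gtr0_norm e0) (ger0_norm c0) -/X.
  have kn : 0 <= hnorm c * hnorm y by exact: mulr_ge0.
  have : e * `|rip c y| <= X * (hnorm c * hnorm y).
    by apply: ler_pM => //; [exact: ltW|lra].
  have : X * `|rip c ('i%C *: y)| <= X * (hnorm c * hnorm y) by apply: ler_wpM2l => //; lra.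
  lra.
have b2 := am (X * hnorm y) (hnorm c); rewrite exprMn X2 !hnorm2 in b2.
have b3 : xi ^+ 2 * (`|rip c f| - s * rip y y) <= (p + e) * rip c c by lra.
have b4 : xi ^+ 2 * (`|rip c f| - s * rip y y) <= xi ^+ 2 * ((p + e) * rip c c * weight xi).
  apply: le_trans b3 _.
  have : 0 <= (p + e) * rip c c by rewrite mulr_ge0//; lra.
  nra.
have x0 : 0 < xi ^+ 2 by lra.
rewrite ler_pM2l// in b4; have := mulr_ge0 (ltW s0) f0; lra.
Qed.

Lemma energy_ge0 x : (0 <= energy x)%E.
Proof.
apply: mule_ge0; first by rewrite lee_fin ltW.
by apply: integral_ge0 => xi _; rewrite lee_fin sqr_ge0.
Qed.

(** [b] is [e] times the integral of [rip (F x xi) (F y xi)], each [F x] being first set to zero on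
    a null set of its own. Linearity of [F] thus survives only off the union of the null sets
    involved, and additivity of the integral draws on finite energies. *)
Lemma energy_form : exists b : H -> H -> R, [/\
  forall x y, b x y = b y x,
  forall x, (energy x < +oo)%E -> energy x = (b x x)%:E,
  forall r x y z, (energy x < +oo)%E -> (energy y < +oo)%E -> (energy z < +oo)%E ->
    b (r%:C *: x + y) z = r * b x z + b y z,
  forall x y, b ('i%C *: x) ('i%C *: y) = b x y &
  forall x y c s, (energy x < +oo)%E -> (energy y < +oo)%E -> 0 < s -> e <= 1 ->
    (forall xi, F y xi = Complex e xi *: F x xi - c) ->
    `|b y x| <= (e + s) * b x x + s * b y y
        + e * ((s^-1 + e) * rip c c * \int[mu]_(xi in setT) weight xi)].
Proof.
have /boolp.choice[N NE] : forall x, exists N, [/\ measurable N, mu N = 0%E &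
    strongly_measurable (cut (setT `\` N) (F x))].
  by move=> x; apply: bochner_cut => //; exact: Fb.
pose f x := cut (setT `\` N x) (F x).
have mN x : measurable (N x) by case: (NE x).
have N0 x : mu (N x) = 0%E by case: (NE x).
have sf x : strongly_measurable (f x) by case: (NE x).
have fE x xi : ~ N x xi -> f x xi = F x xi by move=> Nx; rewrite /f cutT.
have f0 x xi : N x xi -> f x xi = 0 by move=> Nx; rewrite /f cutF// => -[].
have mrip x y : measurable_fun setT (fun xi => rip (f x xi) (f y xi)) by exact: rip_measurable.
have nullU (A B : set R) : measurable A -> mu A = 0%E -> measurable B -> mu B = 0%E ->
    mu (A `|` B) = 0%E by move=> mA A0 mB B0; rewrite measureU0.
have NU x y : measurable (N x `|` N y) /\ mu (N x `|` N y) = 0%E.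
  split; first exact: measurableU.
  exact: (nullU _ _ (mN x) (N0 x) (mN y) (N0 y)).
have enE x : energy x = (e%:E * \int[mu]_(xi in [set: R]) (rip (f x xi) (f x xi))%:E)%E.
  congr (_ * _)%E; apply: (@eq_integral_off_null _ _ _ mu _ (N x)) => //.
  - exact: N0.
  - by move=> xi _; rewrite lee_fin sqr_ge0.
  - by move=> xi _; rewrite lee_fin rip_ge0.
  - by move=> xi _ Nxi; rewrite fE// hnorm2.
have int2 x : (energy x < +oo)%E -> mu.-integrable setT (EFin \o (fun xi => rip (f x xi) (f x xi))).
  rewrite enE => h; apply/integrableP; split; first by apply/measurable_EFinP; exact: mrip.
  rewrite (eq_integral (fun xi : measurableTypeR R => (rip (f x xi) (f x xi))%:E)); last first.
    by move=> xi _ /=; rewrite ger0_norm ?rip_ge0.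
  rewrite ltNge leye_eq; apply/negP => /eqP h1.
  by move: h; rewrite h1 gt0_muley ?lte_fin// ltxx.
have int x y : (energy x < +oo)%E -> (energy y < +oo)%E ->
    mu.-integrable setT (EFin \o (fun xi => rip (f x xi) (f y xi))).
  move=> ex ey; apply: (le_integrable _ _ _ (integrableD _ (int2 x ex) (int2 y ey))) => //.
    apply/measurable_EFinP; exact: mrip.
  move=> xi _ /=; rewrite lee_fin.
  set u := f x xi; set v := f y xi.
  rewrite [leRHS]ger0_norm ?addr_ge0 ?rip_ge0// ler_norml.
  have := rip_ge0 (u + v); have := rip_ge0 (u - v); have := rip_ge0 u; have := rip_ge0 v.
  rewrite !ripE (ripC v u) => ? ? ? ?; apply/andP; split; lra.
have aeR (g h : R -> R) (M : set R) : measurable_fun setT g -> measurable_fun setT h ->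
    measurable M -> mu M = 0%E -> (forall xi, ~ M xi -> g xi = h xi) ->
    \int[mu]_(xi in setT) g xi = \int[mu]_(xi in setT) h xi.
  move=> mg mh mM M0 gh; rewrite /Rintegral; congr fine.
  apply: ae_eq_integral => //; [exact/measurable_EFinP|exact/measurable_EFinP|].
  exists M; split=> // xi /= hx; apply: contrapT => Mx; apply: hx => _.
  by rewrite gh.
have iZ (g : R -> R) r : mu.-integrable setT (EFin \o g) ->
    mu.-integrable setT (EFin \o (fun xi => r * g xi)).
  by move=> ig; have := integrableZl measurableT r ig; apply: eq_integrable.
pose b x y := e * \int[mu]_(xi in setT) rip (f x xi) (f y xi).
have bE x : (energy x < +oo)%E -> energy x = (b x x)%:E.
  move=> ex; rewrite enE /b EFinM /Rintegral fineK//.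
  exact: (integrable_fin_num measurableT (int2 x ex)).
exists b; split.
- by move=> x y; rewrite /b; congr (_ * _); apply: eq_Rintegral => xi _; rewrite ripC.
- exact: bE.
- move=> r x y z ex ey ez; rewrite /b mulrCA -mulrDr; congr (_ * _).
  have i1 := iZ _ r (int x z ex ez); have i2 := int y z ey ez.
  rewrite -(RintegralZl r measurableT (int x z ex ez)) -(RintegralD measurableT i1 i2).
  have [m1 z1] := NU x y.
  apply: (aeR _ _ (N (r%:C *: x + y) `|` (N x `|` N y))) => //.
  + by apply: measurable_funD => //; exact: measurable_funM.
  + exact: (measurableU _ _ (mN _) m1).
  + exact: (nullU _ _ (mN _) (N0 _) m1 z1).
  move=> xi nN; rewrite (fE (r%:C *: x + y)); last by move=> h; apply: nN; left.
  rewrite (fE x); last by move=> h; apply: nN; right; left.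
  rewrite (fE y); last by move=> h; apply: nN; right; right.
  by rewrite Flin !ripE.
- have Fi x xi : F ('i%C *: x) xi = 'i%C *: F x xi.
    have F0 : F 0 xi = 0 by apply: (addrI (F 0 xi)); have := Flin 1 0 0 xi; rewrite !scale1r !addr0.
    by have := Flin 'i%C x 0 xi; rewrite F0 !addr0.
  move=> x y; rewrite /b; congr (_ * _).
  have [m1 z1] := NU x y; have [m2 z2] := NU ('i%C *: x) ('i%C *: y).
  apply: (aeR _ _ ((N ('i%C *: x) `|` N ('i%C *: y)) `|` (N x `|` N y))) => //.
  + exact: (measurableU _ _ m2 m1).
  + exact: (nullU _ _ m2 z2 m1 z1).
  move=> xi nN; rewrite (fE ('i%C *: x)); last by move=> h; apply: nN; left; left.
  rewrite (fE ('i%C *: y)); last by move=> h; apply: nN; left; right.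
  rewrite (fE x); last by move=> h; apply: nN; right; left.
  rewrite (fE y); last by move=> h; apply: nN; right; right.
  by rewrite !Fi ripii.
- move=> x y c s ex ey s0 e1 yE.
  rewrite {1}/b normrM (gtr0_norm e0).
  have -> : (e + s) * b x x + s * b y y
        + e * ((s^-1 + e) * rip c c * \int[mu]_(xi in setT) weight xi) =
     e * ((e + s) * \int[mu]_(xi in setT) rip (f x xi) (f x xi) +
       s * \int[mu]_(xi in setT) rip (f y xi) (f y xi) +
       (s^-1 + e) * rip c c * \int[mu]_(xi in setT) weight xi) by rewrite /b; ring.
  apply: ler_wpM2l; first exact: ltW.
  apply: le_trans (le_normr_Rintegral _ (int y x ey ex)) _ => //.
  have iD (g h : R -> R) : mu.-integrable setT (EFin \o g) -> mu.-integrable setT (EFin \o h) ->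
      mu.-integrable setT (EFin \o (fun xi => g xi + h xi)).
    by move=> ig ih; have := integrableD measurableT ig ih; apply: eq_integrable.
  have iw := @integrable_weight R.
  have ix := int2 x ex; have iy := int2 y ey.
  have jx := iZ _ (e + s) ix; have jy := iZ _ s iy; have jw := iZ _ ((s^-1 + e) * rip c c) iw.
  rewrite -(RintegralZl (e + s) measurableT ix) -(RintegralZl s measurableT iy).
  rewrite -(RintegralZl ((s^-1 + e) * rip c c) measurableT iw).
  rewrite -(RintegralD measurableT jx jy) -(RintegralD measurableT (iD _ _ jx jy) jw).
  apply: le_Rintegral => //.
  + by have := integrable_abse (int y x ey ex); apply: eq_integrable.
  + exact: (iD _ _ (iD _ _ jx jy) jw).
  move=> xi _.
  have rhs0 : 0 <= (e + s) * rip (f x xi) (f x xi) + s * rip (f y xi) (f y xi) +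
      (s^-1 + e) * rip c c * weight xi.
    by rewrite !addr_ge0// !mulr_ge0// ?rip_ge0 ?weight_ge0 ?addr_ge0 ?invr_ge0 ?ltW.
  have [Nx|Nx] := pselect (N x xi); first by apply: le_trans rhs0; rewrite (f0 x)// rip0r normr0.
  have [Ny|Ny] := pselect (N y xi); first by apply: le_trans rhs0; rewrite (f0 y)// rip0l normr0.
  by apply: weighted_bound => //; rewrite !fE.
Qed.

End EnergyForm.

Section LimitBounds.
Variable R : realType.

Lemma limsup_0plus_le (g : R -> \bar R) (c e : R) : (limsup_0plus g <= c%:E)%E -> 0 < e ->
  exists d, 0 < d /\ forall t, 0 < t -> t < d -> (g t <= (c + e)%:E)%E.
Proof.
move=> h e0; have : (limsup_0plus g < (c + e)%:E)%E.
  by apply: le_lt_trans h _; rewrite lte_fin ltrDl.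
rewrite /limsup_0plus => /ereal_inf_lt[_ [d d0 <-] hd]; exists d; split=> // t t0 td.
apply: le_trans (ltW hd); apply: ereal_sup_ubound; exists t => //=.
by rewrite t0 td.
Qed.

Lemma liminf_0plus_ge (g : R -> \bar R) (c e : R) : (c%:E <= liminf_0plus g)%E -> 0 < e ->
  exists d, 0 < d /\ forall t, 0 < t -> t < d -> ((c - e)%:E <= g t)%E.
Proof.
move=> h e0; have : ((c - e)%:E < liminf_0plus g)%E.
  by apply: lt_le_trans h; rewrite lte_fin gtrBl.
rewrite /liminf_0plus => /ereal_sup_gt[_ [d d0 <-] hd]; exists d; split=> // t t0 td.
apply: le_trans (ltW hd) _; apply: ereal_inf_lbound; exists t => //=.
by rewrite t0 td.
Qed.

Lemma limsup_0plus_le_cst (g : R -> \bar R) (c : \bar R) :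
  (forall t, 0 < t -> (g t <= c)%E) -> (limsup_0plus g <= c)%E.
Proof.
move=> h; apply: (@le_trans _ _ (ereal_sup [set g t | t in [set t | 0 < t < 1]])).
  by apply: ereal_inf_lbound; exists 1 => //=; exact: ltr01.
by apply: ge_ereal_sup => _ [t /= /andP[t0 _] <-]; exact: h.
Qed.

Lemma liminf_0plus_ge_cst (g : R -> \bar R) (c : \bar R) :
  (forall t, 0 < t -> (c <= g t)%E) -> (c <= liminf_0plus g)%E.
Proof.
move=> h; apply: (@le_trans _ _ (ereal_inf [set g t | t in [set t | 0 < t < 1]])); last first.
  by apply: ereal_sup_ubound; exists 1 => //=; exact: ltr01.
by apply: le_ereal_inf_tmp => _ [t /= /andP[t0 _] <-]; exact: h.
Qed.

Lemma at_right0P (P : set R) :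
  (exists d, 0 < d /\ forall t, 0 < t -> t < d -> P t) -> (0^'+ : set_system R) P.
Proof.
move=> [d [d0 hd]]; have h : \forall t \near (0 : R)^'+, t < d by exact: nbhs_right_lt.
have h' : \forall t \near (0 : R)^'+, 0 < t by exact: nbhs_right_gt.
by apply: filterS2 h h' => t td t0; exact: hd.
Qed.

End LimitBounds.

(** * From the resolvent condition to an isometric semigroup *)

Section ResolventToIsometries.
Variables (R : realType) (H K : hilbertSpace R) (E : linop H H) (C : linop H K).
Local Notation "r %:C" := (real_complex R r) : ring_scope.
Hypotheses (linE : is_linop E) (linC : is_linop C).
Hypothesis specE : spectrum E `<=` [set z | complex.Re z <= 0].
Hypothesis domEC : ldom E `<=` ldom C.
Hypothesis meas : forall (e : R) (h : H), 0 < e ->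
  bochner_measurable [set: R] (fun xi => lapp C (resolvent E (Complex e xi) h)).
Variables (alpha beta : R).
Hypotheses (a0 : 0 < alpha) (b0 : 0 < beta).
Hypothesis sup_le : forall h, (limsup_0plus (resolvent_energy E C h) <= (beta * hnorm h ^+ 2)%:E)%E.
Hypothesis inf_ge : forall h, ((alpha * hnorm h ^+ 2)%:E <= liminf_0plus (resolvent_energy E C h))%E.

Let F (e : R) (x : H) (xi : R) : K := lapp C (resolvent E (Complex e xi) x).

Local Notation near0 P := ((0^'+ : set_system R) P).

(** The limsup bound makes the energy of each vector finite for small [e], so for given vectors the
    identities of [energy_form] hold near zero, and the limit functional sees nothing else. *)
Lemma resolvent_limit_form : exists b : H -> H -> R, [/\
  forall r x y z, b (r%:C *: x + y) z = r * b x z + b y z,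
  forall x y, b x y = b y x,
  forall x y, b ('i%C *: x) ('i%C *: y) = b x y,
  forall x, alpha * rip x x <= b x x <= beta * rip x x &
  forall x, ldom E x -> b (lapp E x) x = 0].
Proof.
have rs e xi : 0 < e -> resolvent_set E (Complex e xi) by exact: rhp_resolvent_set.
have Flin e : 0 < e -> forall a x y xi, F e (a *: x + y) xi = a *: F e x xi + F e y xi.
  move=> e0 a x y xi; rewrite /F (resolvent_lin linE _ _ _ (rs e xi e0)).
  apply: (app_lin linC); apply: domEC; exact: (proj1 (resolvent_spec _ (rs e xi e0))).
have /boolp.choice[b bE] : forall e, exists b : H -> H -> R, 0 < e -> [/\
  forall x y, b x y = b y x,
  forall x, (energy (F e) e x < +oo)%E -> energy (F e) e x = (b x x)%:E,
  forall r x y z, (energy (F e) e x < +oo)%E -> (energy (F e) e y < +oo)%E ->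
     (energy (F e) e z < +oo)%E -> b (r%:C *: x + y) z = r * b x z + b y z,
  forall x y, b ('i%C *: x) ('i%C *: y) = b x y &
  forall x y c s, (energy (F e) e x < +oo)%E -> (energy (F e) e y < +oo)%E -> 0 < s -> e <= 1 ->
    (forall xi, F e y xi = Complex e xi *: F e x xi - c) ->
    `|b y x| <= (e + s) * b x x + s * b y y
        + e * ((s^-1 + e) * rip c c * \int[@lebesgue_measure R]_(xi in setT) weight xi)].
  move=> e; have [e0|] := boolP (0 < e); last by exists (fun _ _ => 0).
  by have [b hb] := energy_form e0 (Flin e e0) (fun x => meas x e0); exists b.
have e_pos : near0 [set e | 0 < e] by exact: nbhs_right_gt.
have nI (P Q : set R) : near0 P -> near0 Q -> near0 (P `&` Q).
  by move=> hP hQ; exact: filterI.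
have fin x : near0 [set e | (energy (F e) e x < +oo)%E].
  apply: at_right0P; have [d [d0 hd]] := limsup_0plus_le (sup_le x) ltr01.
  exists d; split=> // t t0 td /=; apply: le_lt_trans (hd t t0 td) _; exact: ltry.
have up x e : 0 < e -> near0 [set t | b t x x <= beta * rip x x + e].
  move=> e0; have [d [d0 hd]] := limsup_0plus_le (sup_le x) e0.
  have h : near0 [set t | 0 < t /\ t < d] by apply: at_right0P; exists d.
  apply: filterS2 (fin x) h => t /= ft [t0 td]; have [_ h2 _ _ _] := bE t t0.
  by have := hd t t0 td; rewrite -[resolvent_energy _ _ _ _]/(energy (F t) t x) h2// lee_fin hnorm2.
have lo x e : 0 < e -> near0 [set t | alpha * rip x x - e <= b t x x].
  move=> e0; have [d [d0 hd]] := liminf_0plus_ge (inf_ge x) e0.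
  have h : near0 [set t | 0 < t /\ t < d] by apply: at_right0P; exists d.
  apply: filterS2 (fin x) h => t /= ft [t0 td]; have [_ h2 _ _ _] := bE t t0.
  by have := hd t t0 td; rewrite -[resolvent_energy _ _ _ _]/(energy (F t) t x) h2// lee_fin hnorm2.
have pos x : near0 [set t | 0 <= b t x x].
  apply: filterS2 (fin x) e_pos => t /= ft t0; have [_ h2 _ _ _] := bE t t0.
  by have := energy_ge0 (F t) t0 x; rewrite h2// lee_fin.
have near_lin r x y z : near0 [set t | b t (r%:C *: x + y) z = r * b t x z + b t y z].
  apply: filterS2 (nI _ _ (fin x) (fin y)) (nI _ _ (fin z) e_pos) => t /= [f1 f2] [f3 t0].
  by have [_ _ h3 _ _] := bE t t0; exact: h3.
have near_sym x y : near0 [set t | b t x y = b t y x].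
  by apply: filterS e_pos => t /= t0; have [h _ _ _ _] := bE t t0; exact: h.
(* Polarisation: nonnegativity at [x + y] and [x - y] bounds the mixed value by the diagonal ones,
   which the limsup controls. *)
have bdd x y : bounded_near (0^'+ : set_system R) (fun t => b t x y).
  have h1 := nI _ _ (near_lin 1 x y (x + y)) (near_lin (-1) y x (x - y)).
  have h2 := nI _ _ (near_lin 1 x y x) (near_lin 1 x y y).
  have h3 := nI _ _ (near_lin (-1) y x x) (near_lin (-1) y x y).
  have h4 := nI _ _ (near_sym x (x + y)) (near_sym y (x + y)).
  have h5 := nI _ _ (near_sym x (x - y)) (near_sym y (x - y)).
  have h6 := nI _ _ (pos (x + y)) (pos (x - y)).
  have h7 := nI _ _ (up x 1 ltr01) (nI _ _ (up y 1 ltr01) (near_sym x y)).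
  exists (beta * rip x x + beta * rip y y + 2).
  have hA := nI _ _ (nI _ _ h1 h2) (nI _ _ h3 h4); have hB := nI _ _ h5 (nI _ _ h6 h7).
  have mC (v : H) : (-1)%:C *: v = - v by apply: rip_ext => w; rewrite !ripE; ring.
  apply: filterS (nI _ _ hA hB) => t /=; rewrite !mC !scale1r !(addrC (- y)).
  move=> [[[[e1 e2] [e3 e4]] [[e5 e6] [e7 e8]]] [[e9 e10] [[p1 p2] [u1 [u2 s1]]]]].
  rewrite ler_norml; apply/andP; split; lra.
have [L [LD LZ Lle Lge]] := @filter_limit_functional R R (0^'+) _.
have Leq g h : bounded_near (0^'+ : set_system R) g -> bounded_near (0^'+ : set_system R) h ->
    near0 [set t | g t = h t] -> L g = L h.
  move=> bg bh gh; have bmh : bounded_near (0^'+ : set_system R) (fun t => (-1) * h t) by exact: bounded_nearZ.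
  have z : near0 [set t | g t + (-1) * h t = 0] by apply: filterS gh => t /= ->; ring.
  have e1 := LD _ _ bg bmh; have e2 := LZ (-1) _ bh.
  have bgh : bounded_near (0^'+ : set_system R) (fun t => g t + (-1) * h t) by exact: bounded_nearD.
  have zle : L (fun t => g t + (-1) * h t) <= 0 by apply: Lle => //; apply: filterS z => t /= ->.
  have zge : 0 <= L (fun t => g t + (-1) * h t) by apply: Lge => //; apply: filterS z => t /= ->.
  by rewrite e1 e2 in zle zge; apply/le_anti/andP; split; lra.
exists (fun x y => L (fun t => b t x y)); split.
- move=> r x y z; rewrite -LZ// -LD//; last exact: bounded_nearZ.
  apply: Leq => //; apply: bounded_nearD => //; exact: bounded_nearZ.
- by move=> x y; apply: Leq.
- move=> x y; apply: Leq => //; apply: filterS e_pos => t /= t0.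
  by have [_ _ _ h _] := bE t t0; exact: h.
- move=> x; apply/andP; split.
    apply/ler_addgt0Pr => e e0; rewrite -lerBlDr; apply: Lge => //; exact: lo.
  by apply/ler_addgt0Pr => e e0; apply: Lle => //; exact: up.
- move=> x Dx; set y := lapp E x; set c := lapp C x.
  pose W := \int[@lebesgue_measure R]_(xi in setT) weight xi : R.
  have W0 : 0 <= W by apply: Rintegral_ge0 => xi _; exact: weight_ge0.
  pose M := (beta * rip x x + 1) + (beta * rip y y + 1) + rip c c * W + 1.
  have rx := rip_ge0 x; have ry := rip_ge0 y; have rc := rip_ge0 c; have bb := b0.
  have bx : 0 <= beta * rip x x by rewrite mulr_ge0// ltW.
  have by_ : 0 <= beta * rip y y by rewrite mulr_ge0// ltW.
  have cW : 0 <= rip c c * W by exact: mulr_ge0.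
  have M0 : 0 < M by rewrite /M; lra.
  have small (d : R) : 0 < d -> near0 [set t | `|b t y x| <= d].
    (* With [s = sqrt t] the three terms of the estimate are at most [2 s], [s] and [2 s] times
       quantities below [M], whence the 5; in the last one, [t / s = s]. *)
    move=> d0; pose s0 := Num.min 1 (d / (5 * M)).
    have s00 : 0 < s0 by rewrite lt_min ltr01 divr_gt0// mulr_gt0.
    have h : near0 [set t | 0 < t /\ t < s0 ^+ 2].
      by apply: at_right0P; exists (s0 ^+ 2); split=> //; rewrite exprn_gt0.
    have h1 := nI _ _ (nI _ _ (up x 1 ltr01) (up y 1 ltr01)) (nI _ _ (pos x) (pos y)).
    apply: filterS2 (nI _ _ (fin x) (fin y)) (nI _ _ h h1).
    move=> t /= [fx fy] [[t0 ts] [[ux uy] [px py]]].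
    have [_ _ _ _ h5] := bE t t0.
    pose s := Num.sqrt t; have s_gt0 : 0 < s by rewrite sqrtr_gt0.
    have s2 : s ^+ 2 = t by rewrite sqr_sqrtr// ltW.
    have ss0 : s < s0 by rewrite -ltr_sqr ?nnegrE ?(ltW s_gt0) ?(ltW s00)// s2.
    have s1 : s < 1 by apply: lt_le_trans ss0 _; rewrite ge_min lexx.
    have sM : s * (5 * M) <= d.
      rewrite -ler_pdivlMr ?mulr_gt0//; apply: le_trans (ltW ss0) _.
      by rewrite ge_min lexx orbT.
    have t1 : t <= 1 by rewrite -s2; nra.
    have yF xi : F t y xi = Complex t xi *: F t x xi - c.
      have [D1 _] := resolvent_spec x (rs t xi t0).
      rewrite /F /y (resolvent_app linE (rs t xi t0) Dx) (appB linC) ?(appZ linC)//.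
      + exact: domEC.
      + by apply: (domZ linC); exact: domEC.
      + exact: domEC.
    apply: le_trans (h5 x y c s fx fy s_gt0 t1 yF) _.
    apply: le_trans sM.
    have -> : t * ((s^-1 + t) * rip c c * \int[@lebesgue_measure R]_(xi in setT) weight xi)
        = (s + t ^+ 2) * (rip c c * W).
      rewrite -/W -s2; field; exact: lt0r_neq0.
    have ts1 : t <= s by rewrite -s2; nra.
    have tt : t ^+ 2 <= s by nra.
    have q1 : (t + s) * b t x x <= (2 * s) * (beta * rip x x + 1) by apply: ler_pM => //; lra.
    have q2 : s * b t y y <= s * (beta * rip y y + 1) by apply: ler_wpM2l => //; exact: ltW.
    have q3 : (s + t ^+ 2) * (rip c c * W) <= (2 * s) * (rip c c * W) by apply: ler_wpM2r => //; lra.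
    rewrite /M; have := mulr_ge0 (ltW s_gt0) bx; have := mulr_ge0 (ltW s_gt0) by_.
    have := mulr_ge0 (ltW s_gt0) cW; lra.
  apply/eqP; rewrite eq_le; apply/andP; split.
    apply/ler_addgt0Pr => d d0; rewrite add0r; apply: Lle => //.
    by apply: filterS (small d d0) => t /=; rewrite ler_norml => /andP[].
  rewrite -oppr_le0; apply/ler_addgt0Pr => d d0; rewrite add0r lerNl; apply: Lge => //.
  by apply: filterS (small d d0) => t /=; rewrite ler_norml => /andP[].
Qed.

(** Seen through [P], the limit form becomes the original scalar product and [E] becomes a skew [G].
    Surjectivity of [1 - r G] comes from the resolvent at [r^-1], as [1 - r G = r (r^-1 - G)]; the
    semigroup is then carried back. *)
Lemma resolvent_to_isometries : exists T : R -> H -> H,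
  [/\ c0_semigroup T, generates T E & similar_to_isometries T].
Proof.
have [b [bl bC bi bab bskew]] := resolvent_limit_form.
have ba x : alpha * rip x x <= b x x by case/andP: (bab x).
have bb x : b x x <= beta * rip x x by case/andP: (bab x).
have [P [Q [bP bQ PQ QP RR]]] := equivalent_form a0 b0 bl bC bi ba bb.
have bD x y z : b (x + y) z = b x z + b y z by have := bl 1 x y z; rewrite scale1r mul1r.
have RRp u v : rip (P u) (P v) = b u v.
  have := RR (u + v); rewrite (bopD bP) !ripE !bD !(bC _ (u + v)) !bD !RR (bC v u) (ripC (P v)).
  lra.
have linG := conj_linop_linear bP bQ linE.
have skewG x : ldom (conj_linop P Q E) x -> rip (lapp (conj_linop P Q E) x) x = 0.
  by move=> /= Dx; rewrite -{2}(PQ x) RRp bskew.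
have rangeG (r : R) y : 0 < r ->
    exists x, ldom (conj_linop P Q E) x /\ x - r%:C *: lapp (conj_linop P Q E) x = y.
  move=> r0; have ri : 0 < r^-1 by rewrite invr_gt0.
  have rl := rhp_resolvent_set (0 : R) specE ri.
  have [D1 e1] := resolvent_spec (r^-1%:C *: Q y) rl.
  exists (P (resolvent E (Complex r^-1 0) (r^-1%:C *: Q y))); rewrite /= QP; split=> //.
  have e2 : y = P (r%:C *: (r^-1%:C *: Q y)).
    rewrite scalerA -rmorphM mulfV ?lt0r_neq0// scale1r PQ//.
  rewrite [RHS]e2 -[in RHS]e1 -(bopZ bP) -(bopB bP); congr P.
  apply: rip_ext => w; rewrite [Complex _ _ *: _]scale_cplx !ripE.
  by field; rewrite lt0r_neq0.
have [S [cS gS isoS]] := generation linG skewG rangeG.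
have cT := conj_semigroup_c0 bQ bP QP PQ cS.
exists (conj_semigroup Q P S); split=> //.
  have := conj_semigroup_generates bQ bP QP PQ cS gS.
  move=> g x; have := g x; rewrite /= QP.
  by rewrite QP.
exists P, Q; split=> //; split=> //; split=> //; split=> // t x t0.
by rewrite /conj_semigroup PQ PQ isoS.
Qed.

End ResolventToIsometries.

(** * Calculus on segments and the Poisson kernel *)

Section RealCalculus.
Variable R : realType.
Local Notation mu := (@lebesgue_measure R).
Implicit Types (f g : R -> R) (N k : R).

Lemma lipschitz_continuous f k :
  (forall x y, `|f x - f y| <= k * `|x - y|) -> continuous f.
Proof.
move=> hf x; apply/cvgrPdist_lt => e e0.
have k0 : 0 <= k.
  by have := hf 1 0; rewrite subr0 normr1 mulr1; apply: le_trans.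
have k1 : 0 < k + 1 by lra.
have h : \forall t \near x, `|x - t| < e / (k + 1).
  by apply: (@cvgr_dist_lt _ _ _ (nbhs x) _ id x) => //; exact: divr_gt0.
apply: filterS h => t ht; rewrite ltr_pdivlMr// in ht; apply: le_lt_trans (hf x t) _.
have := normr_ge0 (x - t); lra.
Qed.

(** Adapted to the resolvent identity, which delivers an explicit quadratic remainder rather than a
    limit. *)
Lemma quadratic_is_derive f g k x :
  (forall h, `|f (x + h) - f x - h * g x| <= k * h ^+ 2) -> is_derive x 1 f (g x).
Proof.
move=> hf.
have lim : h^-1 *: (f (h *: 1 + x) - f x) @[h --> 0^'] --> g x.
  apply/cvgrPdist_lt => e e0.
  have k1 : 0 < `|k| + 1 by have := normr_ge0 k; lra.
  have h1 : \forall h \near (0 : R)^', `|0 - h| < e / (`|k| + 1).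
    apply: nbhs_dnbhs; apply: (@cvgr_dist_lt _ _ _ (nbhs (0 : R)) _ id 0) => //; exact: divr_gt0.
  have h2 : \forall h \near (0 : R)^', h != 0 by exact: nbhs_dnbhs_neq.
  apply: filterS2 h1 h2 => h h1 h2; rewrite sub0r normrN ltr_pdivlMr// in h1.
  have := hf h; rewrite /= /GRing.scale /= mulr1 (addrC h).
  set d := f (x + h) - f x => hd.
  have hp : 0 < `|h| by rewrite normr_gt0.
  have -> : g x - h^-1 * d = - h^-1 * (d - h * g x) by field.
  rewrite normrM normrN normfV -(ltr_pM2l hp) mulrA mulfV ?lt0r_neq0// mul1r.
  apply: le_lt_trans hd _; rewrite -real_normK ?num_real// expr2 mulrCA ltr_pM2l//.
  by apply: le_lt_trans h1; rewrite mulrC; apply: ler_wpM2l => //; have := ler_norm k; lra.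
apply: DeriveDef; first by apply/cvg_ex; exists (g x).
by apply: cvg_lim.
Qed.

(** Bisecting [n] times leaves the linear term unchanged and divides the quadratic one by [2 ^ n].
    It stands in for a mean value inequality, so no differentiation under the integral occurs. *)
Lemma bisection_bound f (a A B : R) : 0 <= B ->
  (forall x y, a <= x -> x <= y -> `|f y - f x| <= A * (y - x) + B * (y - x) ^+ 2) ->
  forall x y, a <= x -> x <= y -> `|f y - f x| <= A * (y - x).
Proof.
move=> B0 hf.
have st n : forall x y, a <= x -> x <= y -> `|f y - f x| <= A * (y - x) + B * (y - x) ^+ 2 * mesh R n.
  elim: n => [|n ih] x y ax xy; first by rewrite /mesh expr0 mulr1; exact: hf.
  pose z := (x + y) / 2.
  have h1 := ih x z ax (ltac:(rewrite /z; lra)).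
  have h2 := ih z y (ltac:(rewrite /z; lra)) (ltac:(rewrite /z; lra)).
  have -> : f y - f x = (f y - f z) + (f z - f x) by ring.
  apply: le_trans (ler_normD _ _) _.
  have e1 : y - z = (y - x) / 2 by rewrite /z; field.
  have e2 : z - x = (y - x) / 2 by rewrite /z; field.
  rewrite e1 in h2; rewrite e2 in h1; have := mesh_gt0 R n.+1; rewrite (meshS R n) in h1 h2.
  have : 0 <= B * (y - x) ^+ 2 by rewrite mulr_ge0 ?sqr_ge0.
  nra.
move=> x y ax xy; apply/ler_addgt0Pr => e e0.
have [n hn] := mesh_small (B * (y - x) ^+ 2) e0.
by have := st n x y ax xy; have := hn n (leqnn _); lra.
Qed.

Lemma integrable_segment f N : continuous f -> mu.-integrable `[- N, N] (EFin \o f).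
Proof.
move=> cf; apply: continuous_compact_integrable; first exact: segment_compact.
exact: continuous_subspaceT.
Qed.

Lemma Rintegral_segment_cst N k : 0 <= N -> \int[mu]_(x in `[- N, N]) k = 2 * N * k.
Proof.
move=> N0; rewrite Rintegral_cst//= lebesgue_measure_itv /= lte_fin.
case: ltP => [_|h]; first by rewrite /= opprK; ring.
have -> : N = 0 by apply/le_anti; rewrite N0 andbT; lra.
by rewrite !mulr0 mul0r.
Qed.

Lemma le_Rintegral_segment f g N : continuous f -> continuous g ->
  (forall x, f x <= g x) -> \int[mu]_(x in `[- N, N]) f x <= \int[mu]_(x in `[- N, N]) g x.
Proof.
move=> cf cg fg; apply: le_Rintegral => //; exact: integrable_segment.
Qed.

Lemma Rintegral_segment_bound f N k : 0 <= N -> continuous f -> (forall x, `|f x| <= k) ->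
  `|\int[mu]_(x in `[- N, N]) f x| <= 2 * N * k.
Proof.
move=> N0 cf hf; have cc (c : R) : continuous (fun _ : R => c).
  by apply: (@lipschitz_continuous _ 0) => x y; rewrite subrr normr0 mul0r.
rewrite ler_norml -Rintegral_segment_cst//; apply/andP; split; last first.
  apply: le_Rintegral_segment => // x; exact: le_trans (ler_norm _) (hf x).
rewrite Rintegral_segment_cst// -mulrN -Rintegral_segment_cst//; apply: le_Rintegral_segment => // x.
by have := hf x; rewrite ler_norml => /andP[].
Qed.

Lemma Rintegral_segment_FTC (f F : R -> R) N : 0 < N -> continuous f ->
  (forall x : R, is_derive x (1 : R) F (f x)) -> \int[mu]_(x in `[- N, N]) f x = F N - F (- N).
Proof.
move=> N0 cf dF; have NN : - N < N by lra.
have cF : continuous F.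
  by move=> x; apply: differentiable_continuous; apply/derivable1_diffP; exact: ex_derive.
rewrite /Rintegral (@continuous_FTC2 R f F (- N) N)//.
- exact: continuous_subspaceT.
- split; first by move=> x _; exact: ex_derive.
  + by apply: cvg_at_right_filter; exact: cF.
  + by apply: cvg_at_left_filter; exact: cF.
- by move=> x _; rewrite derive1E; exact: derive_val.
Qed.

Lemma Rintegral_segmentD f g N : continuous f -> continuous g ->
  \int[mu]_(x in `[- N, N]) (f x + g x) =
  \int[mu]_(x in `[- N, N]) f x + \int[mu]_(x in `[- N, N]) g x.
Proof. by move=> cf cg; apply: RintegralD => //; exact: integrable_segment. Qed.

Lemma Rintegral_segmentZ f k N : continuous f ->
  \int[mu]_(x in `[- N, N]) (k * f x) = k * \int[mu]_(x in `[- N, N]) f x.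
Proof. by move=> cf; apply: RintegralZl => //; exact: integrable_segment. Qed.

Lemma continuousZ_fun f k : continuous f -> continuous (fun x => k * f x).
Proof. by move=> cf x; apply: cvgMr; exact: cf. Qed.

Lemma continuousD_fun f g : continuous f -> continuous g -> continuous (fun x => f x + g x).
Proof. by move=> cf cg x; apply: cvgD; [exact: cf|exact: cg]. Qed.

Lemma EFin_Rintegral_segment f N : continuous f ->
  ((\int[mu]_(x in `[- N, N]) f x)%:E = \int[mu]_(x in `[(- N)%R, N]) (f x)%:E)%E.
Proof.
move=> cf; rewrite /Rintegral fineK//.
by apply: integrable_fin_num => //; exact: integrable_segment.
Qed.

Lemma segment_le_integralT f (n : nat) : continuous f -> (forall x, 0 <= f x) ->
  ((\int[mu]_(x in `[- n%:R, n%:R]) f x)%:E <= \int[mu]_(x in [set: R]) (f x)%:E)%E.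
Proof.
move=> cf f0; rewrite EFin_Rintegral_segment//; apply: ge0_subset_integral => //.
- by apply/measurable_EFinP; exact: continuous_measurable_fun.
- by move=> x _; rewrite lee_fin.
Qed.

Lemma integralT_le f (c : R) : continuous f -> (forall x, 0 <= f x) ->
  (forall d, 0 < d -> exists n0, forall n, (n0 <= n)%N ->
     \int[mu]_(x in `[- n%:R, n%:R]) f x <= c + d) ->
  (\int[mu]_(x in [set: R]) (f x)%:E <= c%:E)%E.
Proof.
move=> cf f0 hc.
have mf : measurable_fun [set: R] (EFin \o f).
  by apply/measurable_EFinP; exact: continuous_measurable_fun.
have := @ge0_nondecreasing_set_cvg_integral _ (measurableTypeR R) R
  (fun n => `[- n%:R, n%:R]%classic) (fun x => (f x)%:E) mu.
have -> : \bigcup_n `[- n%:R, n%:R]%classic = [set: R].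
  apply/seteqP; split=> // x _; exists (Num.truncn `|x|).+1 => //=.
  by rewrite in_itv /= -ler_norml ltW// truncnS_gt.
move=> /(_ _ _ _ _) h.
have {}h : (\int[mu]_(x in `[(- n%:R)%R, n%:R]) (f x)%:E)%E @[n --> \oo]
    --> (\int[mu]_(x in [set: R]) (f x)%:E)%E.
  apply: h => //.
  - move=> m n mn; apply/subsetPset => x /=; rewrite !in_itv /= => /andP[h1 h2].
    have mn' : m%:R <= n%:R :> R by rewrite ler_nat.
    by apply/andP; split; lra.
  - by move=> i; exact: measurable_funS mf.
  - by move=> i x _; rewrite lee_fin.
apply/lee_addgt0Pr => d d0; have [n0 hn] := hc d d0.
rewrite -(cvg_lim _ h)//; apply: lime_le; first by apply/cvg_ex; eexists; exact: h.
exists n0 => // n /= n0n; rewrite -EFin_Rintegral_segment// -EFinD lee_fin.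
exact: hn.
Qed.

(** The Poisson kernel of the half-plane up to normalisation, with primitive [atan (x / c)]; as [N]
    grows its mass tends to [pi] whatever [c] is. *)
Lemma poisson_segment (c N : R) : 0 < c -> 0 < N ->
  \int[mu]_(x in `[- N, N]) (c / (c ^+ 2 + x ^+ 2)) = 2 * atan (N / c).
Proof.
move=> c0 N0.
have den x : c ^+ 2 + x ^+ 2 != 0 by rewrite lt0r_neq0// ltr_wpDr ?sqr_ge0 ?exprn_gt0.
have den1 x : 1 + (x / c) ^+ 2 != 0 by rewrite lt0r_neq0// ltr_wpDr ?sqr_ge0.
have cw : continuous (fun x : R => c / (c ^+ 2 + x ^+ 2)).
  move=> x; apply: cvgMr; apply: cvgV => //.
  by apply: cvgD; [exact: cvg_cst|exact: exprn_continuous].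
have dF (x : R) : is_derive x (1 : R) (fun x : R => atan (x / c)) (c / (c ^+ 2 + x ^+ 2)).
  have d1 : is_derive x (1 : R) (fun x : R => x / c) (c^-1).
    apply: (@quadratic_is_derive _ (fun=> c^-1) 0) => h.
    by rewrite [X in `|X|](_ : _ = 0) ?normr0 ?mul0r//; ring.
  have := @is_derive1_comp R atan (fun x => x / c) x _ _ (is_derive1_atan (x / c)) d1.
  have -> : c / (c ^+ 2 + x ^+ 2) = (1 + (x / c) ^+ 2)^-1 / c.
    have -> : 1 + (x / c) ^+ 2 = (c ^+ 2 + x ^+ 2) / c ^+ 2 by field; exact: lt0r_neq0.
    by rewrite invf_div; field; rewrite ?den ?(lt0r_neq0 c0).
  by [].
rewrite (Rintegral_segment_FTC N0 cw dF).
by rewrite mulNr atanN opprK; ring.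
Qed.

End RealCalculus.

(** * Energy of a skew operator along vertical lines *)

Section SkewEnergy.
Variables (R : realType) (H : hilbertSpace R) (G : linop H H).
Local Notation "r %:C" := (real_complex R r) : ring_scope.
Local Notation mu := (@lebesgue_measure R).
Local Notation D := (ldom G).
Local Notation g := (lapp G).
Hypothesis linG : is_linop G.
Hypothesis skewG : forall x, D x -> rip (g x) x = 0.
Variable U : R -> R -> H -> H.
Hypothesis UE : forall e xi y, 0 < e -> D (U e xi y) /\ Complex e xi *: U e xi y - g (U e xi y) = y.

Lemma skew_numerical (e xi : R) w : D w -> rip (Complex e xi *: w - g w) w = e * rip w w.
Proof. by move=> Dw; rewrite scale_cplx !ripE ripi0 skewG//; ring. Qed.

Lemma skew_solution_unique (e xi : R) x y : 0 < e -> D x -> Complex e xi *: x - g x = y -> x = U e xi y.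
Proof.
move=> e0 Dx xE; have [Du uE] := UE xi y e0; apply/eqP; rewrite -subr_eq0; apply/eqP/rip_eq0.
have := skew_numerical e xi (domB linG Dx Du).
rewrite (appB linG)//.
have -> : Complex e xi *: (x - U e xi y) - (g x - g (U e xi y)) =
    (Complex e xi *: x - g x) - (Complex e xi *: U e xi y - g (U e xi y)).
  by apply: inner_ext => w; rewrite !innerE; ring.
rewrite xE uE subrr.
by rewrite rip0l => /esym/eqP; rewrite mulf_eq0 gt_eqF//= => /eqP ->.
Qed.

Lemma solution_lin (e xi : R) a x y : 0 < e -> U e xi (a *: x + y) = a *: U e xi x + U e xi y.
Proof.
move=> e0; have [D1 e1] := UE xi x e0; have [D2 e2] := UE xi y e0.
apply/esym/skew_solution_unique => //; first exact: dom_lin.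
rewrite (app_lin linG)// -[in RHS]e1 -[in RHS]e2.
by apply: inner_ext => w; rewrite !innerE; ring.
Qed.

Lemma solutionB (e xi : R) x y : 0 < e -> U e xi (x - y) = U e xi x - U e xi y.
Proof. by move=> e0; have := solution_lin xi (-1) y x e0; rewrite !scaleN1r !(addrC (- _)). Qed.

Lemma solution0 (e xi : R) : 0 < e -> U e xi 0 = 0.
Proof. by move=> e0; have := solutionB xi 0 0 e0; rewrite !subrr. Qed.

Lemma solutionZ (e xi : R) a x : 0 < e -> U e xi (a *: x) = a *: U e xi x.
Proof. by move=> e0; have := solution_lin xi a x 0 e0; rewrite solution0// !addr0. Qed.

(** Trades the square for [rip y (U e xi y)], which is harmonic in [(e, xi)]; this is what opens the
    way to a contour shift. *)
Lemma solution_energy (e xi : R) y : 0 < e -> rip y (U e xi y) = e * rip (U e xi y) (U e xi y).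
Proof. by move=> e0; have [Du uE] := UE xi y e0; rewrite -(skew_numerical e xi Du) uE. Qed.

Lemma solution_bound (e xi : R) y : 0 < e -> hnorm (U e xi y) <= e^-1 * hnorm y.
Proof.
move=> e0; rewrite ler_pdivlMl//; set u := U e xi y.
have [->|u0] := eqVneq u 0; first by rewrite hnorm0 mulr0 hnorm_ge0.
have un : 0 < hnorm u by rewrite sqrtr_gt0 rip_gt0.
rewrite -(ler_pM2r un) -mulrA -expr2 hnorm2 -solution_energy//; exact: rip_le.
Qed.

(** The resolvent identity; the Lipschitz and derivative bounds on [U] below are read off from
    it. *)
Lemma solution_diff (e1 e2 x1 x2 : R) y : 0 < e1 -> 0 < e2 ->
  U e2 x2 y - U e1 x1 y = Complex (e1 - e2) (x1 - x2) *: U e2 x2 (U e1 x1 y).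
Proof.
move=> e10 e20; have [D1 E1] := UE x1 y e10; have [D2 E2] := UE x2 y e20.
rewrite -solutionZ//; apply: skew_solution_unique => //; first exact: domB.
rewrite (appB linG)//.
have -> : g (U e1 x1 y) = Complex e1 x1 *: U e1 x1 y - y by rewrite -[X in _ = _ - X]E1 opprB addrC subrK.
have -> : g (U e2 x2 y) = Complex e2 x2 *: U e2 x2 y - y by rewrite -[X in _ = _ - X]E2 opprB addrC subrK.
have -> : Complex (e1 - e2) (x1 - x2) = Complex e1 x1 - Complex e2 x2 by [].
by apply: inner_ext => w; rewrite !innerE; ring.
Qed.

Lemma solution_commute (e xi : R) y : 0 < e -> D y -> g (U e xi y) = U e xi (g y).
Proof.
move=> e0 Dy; have [Du uE] := UE xi y e0.
have gE : g (U e xi y) = Complex e xi *: U e xi y - y by rewrite -[X in _ = _ - X]uE opprB addrC subrK.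
apply: skew_solution_unique => //; first by rewrite gE; apply: (domB linG) => //; exact: domZ.
rewrite [in g (g _)]gE (appB linG)//; last exact: domZ.
rewrite (appZ linG)//.
by apply: inner_ext => w; rewrite !innerE; ring.
Qed.

Let p (e : R) (y : H) (xi : R) : R := rip y (U e xi y).

Lemma solution_diff_bound (e x1 x2 : R) y : 0 < e ->
  hnorm (U e x2 y - U e x1 y) <= `|x1 - x2| * (e^-1 * (e^-1 * hnorm y)).
Proof.
move=> e0; rewrite solution_diff// hnormZc subrr expr0n add0r sqrtr_sqr.
apply: ler_wpM2l => //; apply: le_trans (solution_bound _ _ e0) _.
apply: ler_wpM2l; first by rewrite invr_ge0 ltW.
exact: solution_bound.
Qed.

Lemma density_continuous (e : R) y : 0 < e -> continuous (p e y).
Proof.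
move=> e0; apply: (@lipschitz_continuous _ _ (hnorm y * (e^-1 * (e^-1 * hnorm y)))) => x1 x2.
rewrite /p -ripNr -ripDr; apply: le_trans (CauchySchwarz _ _) _.
rewrite -mulrA; apply: ler_wpM2l; first exact: hnorm_ge0.
by rewrite mulrC distrC; apply: solution_diff_bound.
Qed.

Lemma density_ge0 (e xi : R) y : 0 < e -> 0 <= p e y xi.
Proof. by move=> e0; rewrite /p solution_energy// mulr_ge0 ?rip_ge0// ltW. Qed.

Lemma density_le (e xi : R) y : 0 < e -> p e y xi <= e^-1 * rip y y.
Proof.
move=> e0; apply: le_trans (rip_le _ _) _; rewrite -hnorm2 expr2 mulrCA.
apply: ler_wpM2l; [exact: hnorm_ge0|exact: solution_bound].
Qed.

(* [U] is holomorphic in [e + i xi], so Cauchy-Riemann turns the [e]-derivative of [p e y] into the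
   [xi]-derivative of [k]; the boundary terms [k (N)] and [k (-N)] vanish as [N] grows. *)
Lemma contour_shift (e e1 e2 N : R) y : 0 < e -> e <= e1 -> e1 <= e2 -> 0 < N -> D y ->
  `|\int[mu]_(x in `[- N, N]) p e2 y x - \int[mu]_(x in `[- N, N]) p e1 y x| <=
  2 * ((hnorm y + e^-1 * hnorm (g y)) * hnorm y / N) * (e2 - e1).
Proof.
move=> e0 ee1 e12 N0 Dy; pose Psi (e : R) : R := \int[mu]_(x in `[- N, N]) p e y x.
set A := 2 * _; pose q : R := e^-1 * (e^-1 * (e^-1 * hnorm y)).
have ei : 0 <= e^-1 by rewrite invr_ge0 ltW.
have y0 := hnorm_ge0 y.
have q0 : 0 <= q by rewrite !mulr_ge0.
apply: (@bisection_bound _ Psi e A (2 * N * (hnorm y * q))) => //.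
  by rewrite !mulr_ge0// ltW.
move=> {e1 e2 ee1 e12} e1 e2 ee1 e12.
have e10 : 0 < e1 by exact: lt_le_trans ee1.
have e20 : 0 < e2 by exact: lt_le_trans e12.
have bnd (e' x : R) z : e <= e' -> hnorm (U e' x z) <= e^-1 * hnorm z.
  move=> ee'; have e'0 : 0 < e' by exact: lt_le_trans ee'.
  apply: le_trans (solution_bound _ _ e'0) _; apply: ler_wpM2r; first exact: hnorm_ge0.
  by rewrite lef_pV2.
have ee2 : e <= e2 by exact: le_trans e12.
(* [m] is the derivative of [p] in [e] and also, by [dk], that of [k] in [xi]: the two sides of
   Cauchy-Riemann. *)
pose m x : R := - rip y (U e1 x (U e1 x y)).
pose k x : R := - rip y ('i%C *: U e1 x y).
have Udx (x h : R) z : U e1 (x + h) z - U e1 x z = (- h)%:C *: ('i%C *: U e1 (x + h) (U e1 x z)).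
  rewrite solution_diff// scale_cplx; apply: rip_ext => w; rewrite !ripE; ring.
have cm : continuous m.
  apply: (@lipschitz_continuous _ _ (hnorm y * (2 * (e^-1 * (e^-1 * (e^-1 * hnorm y)))))) => x1 x2.
  have -> : m x1 - m x2 = rip y (U e1 x2 (U e1 x2 y - U e1 x1 y) + (U e1 x2 (U e1 x1 y) - U e1 x1 (U e1 x1 y))).
    by rewrite /m solutionB// !ripE; ring.
  apply: le_trans (CauchySchwarz _ _) _; rewrite -mulrA; apply: ler_wpM2l => //.
  apply: le_trans (hnormD _ _) _.
  have d1 z : hnorm (U e1 x2 z - U e1 x1 z) <= `|x1 - x2| * (e^-1 * (e^-1 * hnorm z)).
    rewrite solution_diff// hnormZc subrr expr0n add0r sqrtr_sqr; apply: ler_wpM2l => //.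
    apply: le_trans (bnd _ _ _ ee1) _; apply: ler_wpM2l => //; exact: bnd.
  have b1 := bnd e1 x2 (U e1 x2 y - U e1 x1 y) ee1.
  have b2 := ler_wpM2l ei (d1 y).
  have b3 := d1 (U e1 x1 y).
  have b4 : `|x1 - x2| * (e^-1 * (e^-1 * hnorm (U e1 x1 y))) <=
     `|x1 - x2| * (e^-1 * (e^-1 * (e^-1 * hnorm y))).
    by apply: ler_wpM2l => //; apply: ler_wpM2l => //; apply: ler_wpM2l => //; exact: bnd.
  have -> : 2 * (e^-1 * (e^-1 * (e^-1 * hnorm y))) * `|x1 - x2| =
    e^-1 * (`|x1 - x2| * (e^-1 * (e^-1 * hnorm y))) + `|x1 - x2| * (e^-1 * (e^-1 * (e^-1 * hnorm y))).
    by ring.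
  apply: lerD; [exact: le_trans b1 b2|exact: le_trans b3 b4].
have dk (x : R) : is_derive x (1 : R) k (m x).
  apply: (@quadratic_is_derive _ _ _ (hnorm y * q)) => h.
  have -> : k (x + h) - k x - h * m x = - rip y ('i%C *: (U e1 (x + h) y - U e1 x y)) + h * rip y (U e1 x (U e1 x y)).
    rewrite /k /m scalerBr !ripE; ring.
  have -> : 'i%C *: (U e1 (x + h) y - U e1 x y) = h%:C *: U e1 (x + h) (U e1 x y).
    by rewrite Udx !scalerA mulrAC -expr2 sqr_i mulN1r -rmorphN opprK.
  have -> : - rip y (h%:C *: U e1 (x + h) (U e1 x y)) + h * rip y (U e1 x (U e1 x y)) =
     rip y ((- h)%:C *: (U e1 (x + h) (U e1 x y) - U e1 x (U e1 x y))) by rewrite !ripE; ring.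
  apply: le_trans (CauchySchwarz _ _) _; rewrite -mulrA; apply: ler_wpM2l => //.
  rewrite hnormZ normrN Udx hnormZ normrN hnormi mulrA -expr2 real_normK ?num_real// mulrC.
  apply: ler_wpM2r; first exact: sqr_ge0.
  apply: le_trans (bnd _ _ _ ee1) _; apply: ler_wpM2l => //.
  apply: le_trans (bnd _ _ _ ee1) _; apply: ler_wpM2l => //; exact: bnd.
(* For [y] in the domain, [l U y = y + U (G y)] is bounded in [xi], so [U y], and with it [k], is of
   order [1 / N] for [|xi| >= N]. *)
have kb x : N ^+ 2 <= x ^+ 2 -> `|k x| <= (hnorm y + e^-1 * hnorm (g y)) * hnorm y / N.
  move=> Nx; have [Du uE] := UE x y e10.
  have h1 : hnorm (Complex e1 x *: U e1 x y) <= hnorm y + e^-1 * hnorm (g y).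
    have -> : Complex e1 x *: U e1 x y = y + U e1 x (g y).
      by rewrite -solution_commute// -{2}uE subrK.
    by apply: le_trans (hnormD _ _) _; rewrite lerD2l; exact: bnd.
  have h2 : N * hnorm (U e1 x y) <= hnorm (Complex e1 x *: U e1 x y).
    rewrite hnormZc; apply: ler_wpM2r; first exact: hnorm_ge0.
    rewrite -[leLHS]ger0_norm ?(ltW N0)// -sqrtr_sqr; apply: ler_wsqrtr.
    by apply: le_trans Nx _; rewrite lerDr sqr_ge0.
  rewrite /k normrN; apply: le_trans (CauchySchwarz _ _) _; rewrite hnormi.
  rewrite ler_pdivlMr// -mulrA mulrC; apply: ler_wpM2r => //.
  by rewrite mulrC; apply: le_trans h2 h1.
have cp1 := density_continuous (y := y) e10; have cp2 := density_continuous (y := y) e20.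
pose d := e2 - e1; have d0 : 0 <= d by rewrite /d; lra.
(* Second-order remainder of [p] in [e]. Its integral is bounded by a multiple of [N * d ^+ 2]; the
   growth in [N] is harmless, because [bisection_bound] discards the quadratic term altogether. *)
pose r x : R := p e2 y x + (- 1) * p e1 y x + (- d) * m x.
have cr : continuous r.
  apply: continuousD_fun; last exact: continuousZ_fun.
  by apply: continuousD_fun => //; exact: continuousZ_fun.
have rb x : `|r x| <= hnorm y * q * d ^+ 2.
  have Ude z : U e2 x z - U e1 x z = (- d)%:C *: U e2 x (U e1 x z).
    rewrite solution_diff// subrr.
    by have -> : Complex (e1 - e2) 0 = (- d)%:C by rewrite /d opprB.
  have -> : r x = rip y ((- d)%:C *: ((- d)%:C *: U e2 x (U e1 x (U e1 x y)))).
    rewrite -Ude.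
    have -> : r x = rip y (U e2 x y - U e1 x y) + d * rip y (U e1 x (U e1 x y)).
      by rewrite /r /p /m !ripE; ring.
    by rewrite Ude !ripE; ring.
  apply: le_trans (CauchySchwarz _ _) _; rewrite -mulrA; apply: ler_wpM2l => //.
  rewrite !hnormZ normrN ger0_norm// mulrA -expr2 mulrC; apply: ler_wpM2r; first exact: sqr_ge0.
  apply: le_trans (bnd _ _ _ ee2) _; apply: ler_wpM2l => //.
  apply: le_trans (bnd _ _ _ ee1) _; apply: ler_wpM2l => //; exact: bnd.
have Ir := Rintegral_segment_bound (ltW N0) cr rb.
have IE : \int[mu]_(x in `[- N, N]) r x = Psi e2 - Psi e1 - d * (k N - k (- N)).
  rewrite /r (Rintegral_segmentD _ (continuousD_fun cp2 (continuousZ_fun (k := -1) cp1)) (continuousZ_fun (k := - d) cm)).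
  rewrite (Rintegral_segmentD _ cp2 (continuousZ_fun (k := -1) cp1)) !Rintegral_segmentZ//.
  rewrite (Rintegral_segment_FTC N0 cm dk) /Psi; ring.
have kN := kb N (lexx _); have kN' : `|k (- N)| <= (hnorm y + e^-1 * hnorm (g y)) * hnorm y / N.
  by apply: kb; rewrite sqrrN.
have -> : Psi e2 - Psi e1 = \int[mu]_(x in `[- N, N]) r x + d * (k N - k (- N)) by rewrite IE; ring.
apply: le_trans (ler_normD _ _) _; rewrite addrC; apply: lerD.
  rewrite normrM (ger0_norm d0) mulrC -/d; apply: ler_wpM2r => //.
  apply: le_trans (ler_normB _ _) _; rewrite /A; lra.
by apply: le_trans Ir _; rewrite -/d !mulrA.
Qed.

(** For [e2] so large that [U (G y)] has norm at most half of [hnorm y], the norm of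
    [(e2 + i xi) U y] lies between [1/2] and [3/2] of [hnorm y]. So [p e2 y] is the Poisson kernel
    times a factor between [1/4] and [9/4] of [rip y y], and [contour_shift] brings the integral
    back to [e]. The constant [pi / 8] is [1/4 * (pi / 2)], from a segment with [N >= e2], where
    [atan (N / e2) >= pi / 4]. *)
Lemma domain_energy (e : R) y : 0 < e -> D y ->
  (((pi / 8) * rip y y)%:E <= \int[mu]_(x in [set: R]) (p e y x)%:E <= ((9 / 4 * pi) * rip y y)%:E)%E.
Proof.
move=> e0 Dy; have y0 := hnorm_ge0 y; have gy0 := hnorm_ge0 (g y); have ry0 := rip_ge0 y.
have [e2 [ee2 ge2]] : exists e2, e <= e2 /\ 2 * hnorm (g y) <= e2 * hnorm y.
  have [yz|yn] := eqVneq y 0.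
    by exists e; rewrite yz (app0 linG) hnorm0 !mulr0.
  have yp : 0 < hnorm y by rewrite sqrtr_gt0 rip_gt0.
  exists (e + 2 * hnorm (g y) / hnorm y).
  have -> : (e + 2 * hnorm (g y) / hnorm y) * hnorm y = e * hnorm y + 2 * hnorm (g y).
    by field; exact: lt0r_neq0.
  have : 0 <= 2 * hnorm (g y) / hnorm y by rewrite divr_ge0// mulr_ge0.
  by have := mulr_ge0 (ltW e0) y0; split; lra.
have e20 : 0 < e2 by exact: lt_le_trans ee2.
have cp := density_continuous (y := y) e0; have cp2 := density_continuous (y := y) e20.
pose w x : R := e2 / (e2 ^+ 2 + x ^+ 2).
have den x : 0 < e2 ^+ 2 + x ^+ 2 by rewrite ltr_wpDr ?sqr_ge0 ?exprn_gt0.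
have cw : continuous w.
  move=> x; apply: cvgMr; apply: cvgV; first exact: lt0r_neq0.
  by apply: cvgD; [exact: cvg_cst|exact: exprn_continuous].
have pw x : 1 / 4 * rip y y * w x <= p e2 y x <= 9 / 4 * rip y y * w x.
  have [Du uE] := UE x y e20.
  have h1 : (e2 ^+ 2 + x ^+ 2) * rip (U e2 x y) (U e2 x y) = rip (y + U e2 x (g y)) (y + U e2 x (g y)).
    have -> : y + U e2 x (g y) = Complex e2 x *: U e2 x y.
      by rewrite -solution_commute// -[X in X + _]uE subrK.
    by rewrite ripZc.
  have h2 : hnorm (U e2 x (g y)) <= hnorm y / 2.
    apply: le_trans (solution_bound _ _ e20) _; rewrite ler_pdivrMl//; lra.
  have h3 := hnormD y (U e2 x (g y)); have h4 := hnormB (y + U e2 x (g y)) (U e2 x (g y)).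
  rewrite addrK in h4; have z0 := hnorm_ge0 (y + U e2 x (g y)).
  have -> : p e2 y x = rip (y + U e2 x (g y)) (y + U e2 x (g y)) * w x.
    by rewrite -h1 /p solution_energy// /w; field; exact: lt0r_neq0.
  have w0 : 0 <= w x by rewrite divr_ge0// ltW.
  rewrite -!hnorm2; apply/andP; split; apply: ler_wpM2r => //; nra.
have Iw (N : R) : e2 <= N -> pi / 2 <= \int[mu]_(x in `[- N, N]) w x.
  move=> eN; rewrite /w poisson_segment//; last exact: lt_le_trans eN.
  have : atan 1 <= atan (N / e2) by apply: le_atan; rewrite ler_pdivlMr// mul1r.
  rewrite atan1; lra.
have Iw' (N : R) : 0 < N -> \int[mu]_(x in `[- N, N]) w x <= pi.
  by move=> N0; rewrite /w poisson_segment//; have := atan_ltpi2 (N / e2); lra.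
have Ip (N : R) : \int[mu]_(x in `[- N, N]) p e2 y x <= 9 / 4 * rip y y * \int[mu]_(x in `[- N, N]) w x.
  rewrite -Rintegral_segmentZ//; apply: le_Rintegral_segment => //; first exact: continuousZ_fun.
  by move=> x; case/andP: (pw x).
have Ip' (N : R) : 1 / 4 * rip y y * \int[mu]_(x in `[- N, N]) w x <= \int[mu]_(x in `[- N, N]) p e2 y x.
  rewrite -Rintegral_segmentZ//; apply: le_Rintegral_segment => //; first exact: continuousZ_fun.
  by move=> x; case/andP: (pw x).
pose B : R := 2 * ((hnorm y + e^-1 * hnorm (g y)) * hnorm y) * (e2 - e).
have B0 : 0 <= B.
  have d0 : 0 <= e2 - e by rewrite subr_ge0.
  rewrite /B; apply: mulr_ge0 => //; apply: mulr_ge0 => //; apply: mulr_ge0 => //.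
  by apply: addr_ge0 => //; apply: mulr_ge0 => //; rewrite invr_ge0 ltW.
have sh (N : R) : 0 < N ->
    `|\int[mu]_(x in `[- N, N]) p e2 y x - \int[mu]_(x in `[- N, N]) p e y x| <= B / N.
  move=> N0; apply: le_trans (contour_shift e0 (lexx _) ee2 N0 Dy) _.
  by rewrite /B le_eqVlt; apply/orP; left; apply/eqP; ring.
have small (d : R) : 0 < d -> exists n0, forall n, (n0 <= n)%N -> [/\ 0 < n%:R :> R, e2 <= n%:R & B / n%:R <= d].
  move=> d0; exists (maxn (Num.truncn e2).+1 (Num.truncn (B / d)).+1) => n.
  rewrite geq_max -!(ler_nat R) => /andP[n1 n2].
  have t1 := truncnS_gt e2; have t2 := truncnS_gt (B / d).
  have nn : 0 < n%:R :> R by lra.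
  have n3 : B / d <= n%:R by lra.
  split=> //; first lra.
  by rewrite ler_pdivrMr// mulrC -ler_pdivrMr.
have p0 x : 0 <= p e y x by exact: density_ge0.
apply/andP; split; last first.
  apply: integralT_le => // d d0; have [n0 hn] := small d d0; exists n0 => n /hn[n1 n2 n3].
  have := sh _ n1; rewrite distrC => /(le_trans (ler_norm _)) => h.
  have := Ip n%:R; have := Iw' _ n1 => h1 h2.
  have : 9 / 4 * rip y y * \int[mu]_(x in `[- n%:R, n%:R]) w x <= 9 / 4 * rip y y * pi.
    by apply: ler_wpM2l => //; rewrite mulr_ge0//; lra.
  lra.
apply/lee_addgt0Pr => d d0; have [n0 hn] := small d d0; have [n1 n2 n3] := hn n0 (leqnn _).
apply: (@le_trans _ _ ((\int[mu]_(x in `[- n0%:R, n0%:R]) p e y x)%:E + d%:E)%E); last first.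
  by apply: leeD => //; exact: segment_le_integralT.
rewrite -EFinD lee_fin.
have := sh _ n1 => /(le_trans (ler_norm _)) => h.
have := Ip' n0%:R; have := Iw _ n2 => h1 h2.
have : 1 / 4 * rip y y * (pi / 2) <= 1 / 4 * rip y y * \int[mu]_(x in `[- n0%:R, n0%:R]) w x.
  by apply: ler_wpM2l => //; rewrite mulr_ge0//; lra.
lra.
Qed.

Hypothesis denseD : forall h (e : R), 0 < e -> exists x, D x /\ hnorm (h - x) < e.

(** Density argument. Passing between [y] and a nearby [z] of the domain costs a factor 2 in the
    energy and another 2 in [rip], hence [9 pi = 4 * (9/4) pi] and [pi / 32 = (pi / 8) / 4]. *)
Lemma skew_energy (e : R) y : 0 < e ->
  (((pi / 32) * rip y y)%:E <= \int[mu]_(x in [set: R]) (p e y x)%:E <= ((9 * pi) * rip y y)%:E)%E.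
Proof.
move=> e0; have pi0 : 0 < pi :> R by exact: pi_gt0.
have c z := density_continuous (y := z) e0.
have p0 z x : 0 <= p e z x by exact: density_ge0.
have sub (u v : H) x : p e u x <= 2 * p e v x + 2 * p e (u - v) x.
  rewrite /p !solution_energy// solutionB//.
  have := hnorm_sqD (U e x v) (U e x u - U e x v).
  have -> : U e x v + (U e x u - U e x v) = U e x u by rewrite addrC subrK.
  move=> h; have := ler_wpM2l (ltW e0) h; lra.
have cs (a b : R) (u v : H) : continuous (fun x => a * p e u x + b * p e v x).
  by apply: continuousD_fun; exact: continuousZ_fun.
have subI (u v : H) (N : R) : \int[mu]_(x in `[- N, N]) p e u x <=
    2 * \int[mu]_(x in `[- N, N]) p e v x + 2 * \int[mu]_(x in `[- N, N]) p e (u - v) x.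
  rewrite -!Rintegral_segmentZ// -Rintegral_segmentD; try exact: continuousZ_fun.
  by apply: le_Rintegral_segment => //; exact: sub.
have close (d : R) : 0 < d -> exists z, D z /\ rip (y - z) (y - z) < d.
  move=> d0; have sd : 0 < Num.sqrt d by rewrite sqrtr_gt0.
  have [z [Dz hz]] := denseD y sd; exists z; split=> //.
  rewrite -hnorm2 -[ltRHS]sqr_sqrtr ?(ltW d0)// ltr_sqr ?nnegrE ?hnorm_ge0//; exact: ltW.
have small_seg z (n : nat) : \int[mu]_(x in `[- n%:R, n%:R]) p e z x <= 2 * n%:R * (e^-1 * rip z z).
  have := @Rintegral_segment_bound R (p e z) n%:R (e^-1 * rip z z) (ler0n _ _) (c z).
  move=> /(_ _) h; apply: le_trans (ler_norm _) (h _) => x.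
  by rewrite ger0_norm//; exact: density_le.
have up z : (\int[mu]_(x in [set: R]) (p e z x)%:E <= ((9 * pi) * rip z z)%:E)%E ->
    forall n : nat, \int[mu]_(x in `[- n%:R, n%:R]) p e z x <= 9 * pi * rip z z.
  by move=> h n; rewrite -lee_fin; apply: le_trans h; exact: segment_le_integralT.
have yz z : rip z z <= 2 * rip y y + 2 * rip (y - z) (y - z).
  have := hnorm_sqD y (z - y); have -> : y + (z - y) = z by rewrite addrC subrK.
  by rewrite -(opprB y z) ripNl ripNr opprK.
have zy z : rip y y <= 2 * rip z z + 2 * rip (y - z) (y - z).
  by have := hnorm_sqD z (y - z); have -> : z + (y - z) = y by rewrite addrC subrK.
(* Before the upper bound is known, the energy of [u - z] is controlled only on [[- n, n]], by
   [2 n / e] times its squared norm; so [z] is chosen depending on [n], through [Q]. *)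
have ub u : (\int[mu]_(x in [set: R]) (p e u x)%:E <= ((9 * pi) * rip u u)%:E)%E.
  have {yz zy} yz z : rip z z <= 2 * rip u u + 2 * rip (u - z) (u - z).
    have := hnorm_sqD u (z - u); have -> : u + (z - u) = z by rewrite addrC subrK.
    by rewrite -(opprB u z) ripNl ripNr opprK.
  apply: integralT_le => // d d0; exists 0%N => n _.
  pose Q : R := 9 * pi + 4 * n%:R * e^-1 + 1.
  have Q0 : 0 < Q.
    have : 0 <= 4 * n%:R * e^-1 :> R by rewrite !mulr_ge0// invr_ge0 ltW.
    by rewrite /Q; lra.
  have dQ : 0 < d / Q by exact: divr_gt0.
  have sd : 0 < Num.sqrt (d / Q) by rewrite sqrtr_gt0.
  have [z [Dz hz]] := denseD u sd.
  have hz2 : rip (u - z) (u - z) * Q < d.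
    rewrite -ltr_pdivlMr// -hnorm2 -[ltRHS]sqr_sqrtr ?(ltW dQ)// ltr_sqr ?nnegrE ?hnorm_ge0//; exact: ltW.
  have /andP[_ h1] := domain_energy e0 Dz.
  have h2 : \int[mu]_(x in `[- n%:R, n%:R]) p e z x <= 9 / 4 * pi * rip z z.
    by rewrite -lee_fin; apply: le_trans h1; exact: segment_le_integralT.
  have h3 := small_seg (u - z) n; have h4 := subI u z n%:R.
  have h5 : pi * rip z z <= pi * (2 * rip u u + 2 * rip (u - z) (u - z)) by apply: ler_wpM2l (yz z); exact: ltW.
  have ruz := rip_ge0 (u - z).
  move: hz2; rewrite /Q; lra.
rewrite ub andbT.
have fin : (\int[mu]_(x in [set: R]) (p e y x)%:E)%E \is a fin_num.
  rewrite ge0_fin_numE; first by apply: le_lt_trans (ub y) _; exact: ltry.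
  by apply: integral_ge0 => x _; rewrite lee_fin.
rewrite -(fineK fin) lee_fin; set P := fine _.
have PI (n : nat) : \int[mu]_(x in `[- n%:R, n%:R]) p e y x <= P.
  by have := segment_le_integralT n (c y) (p0 y); rewrite -(fineK fin) lee_fin.
clearbody P; apply/ler_addgt0Pr => d d0.
have dQ : 0 < d / (20 * pi) by rewrite divr_gt0// mulr_gt0.
have [z [Dz hz]] := close _ dQ; rewrite ltr_pdivlMr ?mulr_gt0// in hz.
have /andP[h1 _] := domain_energy e0 Dz.
(* The upper bound now applies to [z - y] on the whole line, so a single [z] serves for every
   [n]. *)
have : (\int[mu]_(x in [set: R]) (p e z x)%:E <= (2 * P + 18 * pi * rip (y - z) (y - z))%:E)%E.
  apply: integralT_le => // d' d'0; exists 0%N => n _.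
  have ryz : rip (z - y) (z - y) = rip (y - z) (y - z) by rewrite -(opprB y z) ripNl ripNr opprK.
  have := subI z y n%:R; have := PI n; have := up _ (ub (z - y)) n.
  rewrite ryz; move: (rip (y - z) _) (\int[mu]_(x in _) p e y x) (\int[mu]_(x in _) p e (z - y) x).
  by move: (\int[mu]_(x in _) p e z x) (pi : R) d'0; clear; move=> i1 q d'0 r i2 i3 b1 b2 b3; lra.
move=> /(le_trans h1); rewrite lee_fin => h2.
have h3 : pi * rip y y <= pi * (2 * rip z z + 2 * rip (y - z) (y - z)) by apply: ler_wpM2l (zy z); exact: ltW.
have := mulr_ge0 (ltW pi0) (rip_ge0 (y - z)); lra.
Qed.

End SkewEnergy.

(** * Translation invariance of integrals *)

Section Translation.
Variable R : realType.
Local Notation mu := (@lebesgue_measure R).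

Lemma measurable_shift (r : R) :
  measurable_fun setT ((fun x : R => x + r) : measurableTypeR R -> measurableTypeR R).
Proof. by apply: measurable_funD => //; exact: measurable_cst. Qed.

Lemma shift_preimage_itv (r a b : R) :
  (fun x : R => x + r) @^-1` `]a, b]%classic = `](a - r), (b - r)]%classic.
Proof.
by apply/seteqP; split=> x; rewrite /= !in_itv /= => /andP[h1 h2]; apply/andP; split; lra.
Qed.

Lemma lebesgue_measure_shift (r : R) (A : set R) : measurable A ->
  pushforward mu ((fun x : R => x + r) : measurableTypeR R -> measurableTypeR R) A = mu A.
Proof.
move=> mA; apply/esym/lebesgue_measure_unique => //=; first exact: measurable_shift.
move=> _ mX [[a b]] _ <-.
rewrite /pushforward shift_preimage_itv/= !lebesgue_measure_itv/= !lte_fin ltrD2r.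
by case: ifP => // _; rewrite -!EFinD; congr (_%:E); ring.
Qed.

Local Open Scope ereal_scope.

Lemma integral_shift (f : R -> \bar R) (r t : R) :
  measurable_fun setT f -> (forall x, 0 <= f x) ->
  \int[mu]_(x in `[0%R, t]) f (x + r)%R = \int[mu]_(x in `[r, (t + r)%R]) f x.
Proof.
move=> mf f0; have -> : `[0%R, t]%classic = (fun x => x + r)%R @^-1` `[r, (t + r)%R]%classic.
  by apply/seteqP; split=> x; rewrite /= !in_itv /= => /andP[h1 h2]; apply/andP; split; lra.
have := @ge0_integral_pushforward _ _ _ _ R _ (measurable_shift r) mu `[r, (t + r)%R]%classic f.
move=> /(_ _ _ _) h; rewrite -[LHS]h//; last first.
  exact: measurable_funS mf.
apply: eq_measure_integral; first exact: measurable_shift.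
by move=> mS A mA AS; exact: lebesgue_measure_shift.
Qed.

End Translation.

(** * Limits superior and inferior at infinity *)

Section LimitsAtInfinity.
Variable R : realType.
Implicit Types (g : R -> \bar R) (c s : R).

Lemma limsup_pinfty_exists g c (M : R) : (limsup_pinfty g <= c%:E)%E ->
  exists t, M <= t /\ (g t <= (c + 1)%:E)%E.
Proof.
move=> h; have : (limsup_pinfty g < (c + 1)%:E)%E.
  by apply: le_lt_trans h _; rewrite lte_fin ltrDl.
move=> /ereal_inf_lt[_ [N _ <-] hN]; exists (Num.max M N); split; first by rewrite le_max lexx.
by apply: le_trans (ltW hN); apply: ereal_sup_ubound; exists (Num.max M N) => //=; rewrite le_max lexx orbT.
Qed.

Lemma liminf_pinfty_exists_lt g c (e M : R) : (liminf_pinfty g <= c%:E)%E -> 0 < e ->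
  exists t, M <= t /\ (g t < (c + e)%:E)%E.
Proof.
move=> h e0; have : (ereal_inf [set g t | t in [set t : R | (M <= t)%R]] < (c + e)%:E)%E.
  apply: (@le_lt_trans _ _ (liminf_pinfty g)); first by apply: ereal_sup_ubound; exists M.
  by apply: le_lt_trans h _; rewrite lte_fin ltrDl.
by move=> /ereal_inf_lt[_ [t /= Mt <-] ht]; exists t.
Qed.

Lemma liminf_pinfty_exists g c (M : R) : (liminf_pinfty g <= c%:E)%E ->
  exists t, M <= t /\ (g t <= (c + 1)%:E)%E.
Proof. by move=> h; have [t [Mt ht]] := liminf_pinfty_exists_lt M h ltr01; exists t; split=> //; exact: ltW. Qed.

(** A comparison up to a time shift, a relative error and an additive error, respected by limsup and
    by liminf; it lets the two alternatives for the averages share one proof. *)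
Definition eventually_dominated s g1 g2 := forall d : R, 0 < d ->
  exists M, forall t, M <= t -> (g1 t <= (1 + d)%:E * g2 (t + s)%R + d%:E)%E.

Lemma dominated_step c (d : R) : 0 <= c -> 0 < d -> d <= 1 ->
  (1 + d) * (c + d) + d <= c + d * (c + 3).
Proof. by move=> c0 d0 d1; have := ler_wpM2l (ltW d0) d1; lra. Qed.

Lemma small_step c (e : R) : 0 <= c -> 0 < e -> exists d, [/\ 0 < d, d <= 1 & d * (c + 3) <= e].
Proof.
move=> c0 e0; have c3 : 0 < c + 3 by lra.
exists (Num.min 1 (e / (c + 3))); split; first by rewrite lt_min ltr01 divr_gt0.
  by rewrite ge_min lexx.
by rewrite -ler_pdivlMr// ge_min lexx orbT.
Qed.

Lemma limsup_pinfty_dominated g1 g2 s c : 0 <= c -> eventually_dominated s g1 g2 ->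
  (limsup_pinfty g2 <= c%:E)%E -> (limsup_pinfty g1 <= c%:E)%E.
Proof.
move=> c0 dom h; apply/lee_addgt0Pr => e e0.
have [d [d0 d1 de]] := small_step c0 e0.
have : (limsup_pinfty g2 < (c + d)%:E)%E by apply: le_lt_trans h _; rewrite lte_fin ltrDl.
move=> /ereal_inf_lt[_ [N _ <-] hN]; have [M hM] := dom d d0.
pose M' := Num.max M (N - s).
apply: (@le_trans _ _ (ereal_sup [set g1 t | t in [set t | M' <= t]])).
  by apply: ereal_inf_lbound; exists M'.
apply: ge_ereal_sup => _ [t /= + <-]; rewrite ge_max => /andP[t1 t2].
apply: le_trans (hM t t1) _.
have g2t : (g2 (t + s)%R <= (c + d)%:E)%E.
  by apply: le_trans (ltW hN); apply: ereal_sup_ubound; exists (t + s) => //=; lra.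
apply: (@le_trans _ _ ((1 + d)%:E * (c + d)%:E + d%:E)%E).
  by apply: leeD => //; apply: lee_wpmul2l => //; rewrite lee_fin; lra.
rewrite -EFinM -!EFinD lee_fin; have := dominated_step c0 d0 d1; lra.
Qed.

Lemma liminf_pinfty_dominated g1 g2 s c : 0 <= c -> eventually_dominated s g1 g2 ->
  (liminf_pinfty g2 <= c%:E)%E -> (liminf_pinfty g1 <= c%:E)%E.
Proof.
move=> c0 dom h; apply/lee_addgt0Pr => e e0.
have [d [d0 d1 de]] := small_step c0 e0.
have [M hM] := dom d d0.
apply: ge_ereal_sup => _ [N _ <-].
have [t' [t'1 ht']] := liminf_pinfty_exists_lt (Num.max M N + s) h d0.
pose t := t' - s; have tM : M <= t /\ N <= t.
  by move: t'1; rewrite -lerBrDr ge_max => /andP[].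
apply: (@le_trans _ _ (g1 t)).
  by apply: ereal_inf_lbound; exists t => //=; case: tM.
apply: le_trans (hM t (proj1 tM)) _; rewrite /t subrK.
apply: (@le_trans _ _ ((1 + d)%:E * (c + d)%:E + d%:E)%E).
  by apply: leeD => //; apply: lee_wpmul2l; [rewrite lee_fin; lra|exact: ltW].
rewrite -EFinM -!EFinD lee_fin; have := dominated_step c0 d0 d1; lra.
Qed.

Lemma limsup_pinfty_cst g (c : \bar R) : (forall t, 0 < t -> g t = c) -> limsup_pinfty g = c.
Proof.
move=> gc; apply/eqP; rewrite eq_le; apply/andP; split.
  apply: (@le_trans _ _ (ereal_sup [set g t | t in [set t | 1 <= t]])).
    by apply: ereal_inf_lbound; exists 1.
  apply: ge_ereal_sup => _ [t /= t1 <-]; rewrite gc//; exact: lt_le_trans t1.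
apply: le_ereal_inf_tmp => _ [M _ <-]; apply: ereal_sup_ubound; exists (Num.max M 1) => /=.
  by rewrite le_max lexx.
by rewrite gc// lt_max ltr01 orbT.
Qed.

End LimitsAtInfinity.

(** * From time averages to isometries *)

Section AveragesToIsometries.
Variables (R : realType) (H K : hilbertSpace R) (T : R -> H -> H) (C : linop H K).
Local Notation mu := (@lebesgue_measure R).
Hypothesis cT : c0_semigroup T.
Hypothesis denseC : densely_defined C.
Hypothesis domT : forall t h, 0 <= t -> ldom C h -> ldom C (T t h).
Hypothesis measC : forall h, ldom C h ->
  bochner_measurable [set t | 0 <= t] (fun t => lapp C (T t h)).

(** One measurable density [f] serves [h] and all its translates: the semigroup law turns the
    integrand of [T r h] into a shift of that of [h], off a shifted null set. *)
Lemma time_avg_density h : ldom C h -> exists f : R -> \bar R, [/\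
  measurable_fun setT f, forall x, (0 <= f x)%E,
  forall t, time_avg T C h t = (t^-1%:E * \int[mu]_(s in `[0%R, t]) f s)%E &
  forall r t, 0 <= r -> time_avg T C (T r h) t = (t^-1%:E * \int[mu]_(s in `[r, (t + r)%R]) f s)%E].
Proof.
move=> Dh; have mD : measurable [set t : R | 0 <= t].
  have -> : [set t : R | 0 <= t] = `[0, +oo[%classic.
    by apply/seteqP; split=> x /=; rewrite in_itv /= andbT.
  exact: measurable_itv.
have [N [mN N0 sf]] := bochner_cut mD (measC Dh).
set k := cut _ _ in sf; pose f x : \bar R := (rip (k x) (k x))%:E.
have mf : measurable_fun setT f by apply/measurable_EFinP; exact: rip_measurable.
have f0 x : (0 <= f x)%E by rewrite lee_fin rip_ge0.
have fE x : 0 <= x -> ~ N x -> ((hnorm (lapp C (T x h)) ^+ 2)%:E = f x)%E.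
  by move=> x0 Nx; rewrite /f /k cutT// hnorm2.
exists f; split=> // [t|r t r0]; rewrite /time_avg; congr (_ * _)%E.
  apply: (@eq_integral_off_null _ _ _ mu _ N) => //.
  - by move=> x _; rewrite lee_fin sqr_ge0.
  - by move=> x; rewrite /= in_itv /= => /andP[x0 _] Nx; exact: fE.
rewrite -integral_shift//.
have mNr : measurable ((fun x : R => x + r) @^-1` N).
  by have := measurable_shift r measurableT mN; rewrite setTI.
apply: (@eq_integral_off_null _ _ _ mu _ ((fun x : R => x + r) @^-1` N)) => //.
- exact: etrans (lebesgue_measure_shift r mN) N0.
- by move=> x _; rewrite lee_fin sqr_ge0.
- move=> x; rewrite /= in_itv /= => /andP[x0 _] Nx.
  by rewrite -(sgD cT)// fE// addr_ge0.
Qed.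

(** * Orbit bounds for an abstract limit [lim], to be limsup or liminf *)

Section Bounds.
Variable lim : (R -> \bar R) -> \bar R.
Hypothesis lim_exists : forall g c (M : R), (lim g <= c%:E)%E -> exists t, M <= t /\ (g t <= (c + 1)%:E)%E.
Hypothesis lim_dominated : forall g1 g2 s c, 0 <= c -> eventually_dominated s g1 g2 ->
  (lim g2 <= c%:E)%E -> (lim g1 <= c%:E)%E.
Variables alpha beta : R.
Hypotheses (a0 : 0 < alpha) (b0 : 0 < beta).
Hypothesis bounds : forall h, ldom C h ->
  ((alpha * hnorm h ^+ 2)%:E <= lim (time_avg T C h))%E /\
  (lim (time_avg T C h) <= (beta * hnorm h ^+ 2)%:E)%E.

(** The window [[r, t + r]] lies in [[0, t + r]], and conversely [[0, t]] adds only [[0, r]] to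
    [[r, t]]; for long windows the averages of [h] and [T r h] thus agree up to small errors. The
    constants obtained do not depend on [r]. *)
Lemma time_avg_orbit_bounds (r : R) h : 0 <= r -> ldom C h ->
  alpha * rip (T r h) (T r h) <= beta * rip h h /\ alpha * rip h h <= beta * rip (T r h) (T r h).
Proof.
move=> r0 Dh; have DT := domT r0 Dh; rewrite -!hnorm2.
have bh (x : H) : 0 <= beta * hnorm x ^+ 2 by rewrite mulr_ge0 ?sqr_ge0// ltW.
have [lo1 up1] := bounds Dh; have [lo2 up2] := bounds DT.
have [f [mf f0 fE fTE]] := time_avg_density Dh.
have sub (A B : set R) : measurable A -> measurable B -> A `<=` B ->
    (\int[mu]_(x in A) f x <= \int[mu]_(x in B) f x)%E.
  by move=> mA mB AB; apply: ge0_subset_integral => //; exact: measurable_funS mf.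
split; rewrite -lee_fin.
  apply: le_trans lo2 _.
  refine (@lim_dominated (time_avg T C (T r h)) (time_avg T C h) r _ (bh h) _ up1).
  move=> d d0; exists (r / d + 1) => t tM.
  have t0 : 0 < t by apply: lt_le_trans tM; rewrite ltr_wpDl// divr_ge0// ltW.
  have rt : r <= d * t by rewrite mulrC -ler_pdivrMr//; lra.
  rewrite fTE// fE.
  apply: (@le_trans _ _ ((1 + d)%:E * ((t + r)^-1%:E * \int[mu]_(s in `[0%R, (t + r)%R]) f s))%E); last first.
    by rewrite leeDl// lee_fin ltW.
  rewrite muleA -EFinM; apply: lee_pmul.
  - by rewrite lee_fin invr_ge0 ltW.
  - exact: integral_ge0.
  - rewrite lee_fin ler_pdivlMr ?ltr_wpDr// mulrC ler_pdivrMr//; lra.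
  - apply: sub => // x; rewrite /= !in_itv /= => /andP[h1 h2]; rewrite h2 andbT; exact: le_trans h1.
apply: le_trans lo1 _.
refine (@lim_dominated (time_avg T C h) (time_avg T C (T r h)) (- r) _ (bh (T r h)) _ up2).
(* The integral over [[0, r]] is finite because the average over some longer window is; this is
   where [lim_exists] enters. *)
have [t1 [rt1 ht1]] := @lim_exists _ _ (r + 1) up1.
have t10 : 0 < t1 by lra.
have fin : (\int[mu]_(s in `[0%R, r]) f s < +oo)%E.
  apply: (@le_lt_trans _ _ (\int[mu]_(s in `[0%R, t1]) f s)%E).
    apply: sub => // x; rewrite /= !in_itv /= => /andP[-> h2] /=; lra.
  move: ht1; rewrite fE => ht1.
  have : (t1%:E * (t1^-1%:E * \int[mu]_(s in `[0%R, t1]) f s) <= t1%:E * (beta * hnorm h ^+ 2 + 1)%:E)%E.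
    by apply: lee_wpmul2l => //; rewrite lee_fin ltW.
  rewrite muleA -!EFinM mulfV ?lt0r_neq0// mul1e => /le_lt_trans; apply; exact: ltry.
have fin' : (\int[mu]_(s in `[0%R, r]) f s)%E \is a fin_num.
  by rewrite ge0_fin_numE//; exact: integral_ge0.
pose Q := fine (\int[mu]_(s in `[0%R, r]) f s)%E.
have Q0 : 0 <= Q by apply: fine_ge0; exact: integral_ge0.
(* The threshold makes [Q <= d * (t - r)], so the initial piece adds at most [d] to the average. *)
move=> d d0; exists (r + 1 + Q / d) => t tM.
have Qd : 0 <= Q / d by rewrite divr_ge0// ltW.
have tr : 0 < t - r by lra.
have t0 : 0 < t by lra.
have Qt : Q <= d * (t - r) by rewrite mulrC -ler_pdivrMr//; lra.
rewrite fTE// fE subrK.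
have split0 : (\int[mu]_(s in `[0%R, t]) f s <= Q%:E + \int[mu]_(s in `[r, t]) f s)%E.
  rewrite /Q fineK//.
  have -> : `[0%R, t]%classic = `[0%R, r[%classic `|` `[r, t]%classic.
    apply/seteqP; split=> x; rewrite /= !in_itv /=.
      by move=> /andP[h1 h2]; case: (ltP x r) => xr; [left|right]; apply/andP.
    by move=> [/andP[h1 h2]|/andP[h1 h2]]; apply/andP; split; lra.
  rewrite ge0_integral_setU//.
  - apply: leeD => //; apply: sub => // x; rewrite /= !in_itv /= => /andP[-> hx] /=; exact: ltW.
  - exact: measurable_funS mf.
  - apply/disj_setPS => x; rewrite /= !in_itv /= => -[/andP[_ h1] /andP[h2 _]].
    by move: h1; rewrite ltNge h2.
apply: (@le_trans _ _ ((t - r)^-1%:E * (Q%:E + \int[mu]_(s in `[r, t]) f s))%E).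
  apply: lee_pmul => //.
  - by rewrite lee_fin invr_ge0 ltW.
  - exact: integral_ge0.
  - by rewrite lee_fin lef_pV2 ?posrE//; lra.
rewrite ge0_muleDr ?lee_fin//; last exact: integral_ge0.
rewrite addeC; apply: leeD; last first.
  by rewrite -EFinM lee_fin mulrC ler_pdivrMr.
rewrite -[leLHS]mul1e; apply: lee_wpmul2r; last by rewrite lee_fin; lra.
by apply: mule_ge0; [rewrite lee_fin invr_ge0 ltW|exact: integral_ge0].
Qed.

(** Orbit bounds are known on the dense set [ldom C]; boundedness of the single operator [T r]
    extends them to [H]. Its bound [M] may depend on [r], since it only multiplies the approximation
    error. *)
Lemma time_avg_similar : similar_to_isometries T.
Proof.
pose k := Num.sqrt (beta / alpha).
have ba : 0 < beta / alpha by exact: divr_gt0.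
have k0 : 0 < k by rewrite sqrtr_gt0.
have k2 : k ^+ 2 = beta / alpha by rewrite sqr_sqrtr// ltW.
have sq (x y : H) : alpha * rip x x <= beta * rip y y -> hnorm x <= k * hnorm y.
  move=> h; apply: le_hnorm; first by rewrite mulr_ge0 ?hnorm_ge0// ltW.
  by rewrite exprMn hnorm2 k2 mulrAC ler_pdivlMr// mulrC.
have key (r : R) x : 0 <= r -> hnorm (T r x) <= k * hnorm x /\ hnorm x <= k * hnorm (T r x).
  move=> r0; have bT := sg_bop cT r0; have [M [M0 hM]] := bop_bound bT.
  have c1 : 0 < k + M + k * M + 1 by have := mulr_gt0 k0 M0; lra.
  have approx (e : R) : 0 < e -> hnorm (T r x) <= k * hnorm x + e /\ hnorm x <= k * hnorm (T r x) + e.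
    move=> e0; have [z [Dz xz]] := denseC x (divr_gt0 e0 c1).
    rewrite ltr_pdivlMr// in xz.
    have [h1 h2] := time_avg_orbit_bounds r0 Dz.
    have s1 := sq _ _ h1; have s2 := sq _ _ h2.
    have t1 := hnorm_le_add (T r x) (T r z); have t2 := hnorm_le_add z x.
    have t3 := hnorm_le_add x z; have t4 := hnorm_le_add (T r z) (T r x).
    have t5 := hM (x - z); rewrite (bopB bT) in t5.
    rewrite (hnorm_sub z x) in t2; rewrite (hnorm_sub (T r z)) in t4.
    have u0 := hnorm_ge0 (x - z).
    have kM := mulr_ge0 (ltW (mulr_gt0 k0 M0)) u0.
    have k1 := mulr_ge0 (ltW k0) u0; have M1 := mulr_ge0 (ltW M0) u0.
    have s3 : k * hnorm z <= k * (hnorm x + hnorm (x - z)) by apply: ler_wpM2l => //; exact: ltW.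
    have s4 : k * hnorm (T r z) <= k * (hnorm (T r x) + M * hnorm (x - z)).
      by apply: ler_wpM2l; [exact: ltW|lra].
    split; lra.
  by split; apply/ler_addgt0Pr => e /approx[].
have ki : 0 < k ^- 2 by rewrite invr_gt0 exprn_gt0.
have kk : 0 < k ^+ 2 by rewrite exprn_gt0.
apply: (bounded_semigroup_similar cT ki kk) => t x t0.
have [h1 h2] := key t x t0; rewrite -!hnorm2; apply/andP; split.
  rewrite ler_pdivrMl// -exprMn ler_sqr ?nnegrE ?mulr_ge0 ?hnorm_ge0//; exact: ltW.
rewrite -exprMn ler_sqr ?nnegrE ?mulr_ge0 ?hnorm_ge0//; exact: ltW.
Qed.

End Bounds.

End AveragesToIsometries.

(** * From isometries to the resolvent and averaging conditions *)

Section IsometriesToResolvent.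
Variables (R : realType) (H : hilbertSpace R) (E : linop H H) (T : R -> H -> H) (P Q : H -> H).
Local Notation "r %:C" := (real_complex R r) : ring_scope.
Hypotheses (linE : is_linop E) (cT : c0_semigroup T) (gT : generates T E).
Hypotheses (bP : bounded_op P) (bQ : bounded_op Q).
Hypotheses (PQ : forall x, P (Q x) = x) (QP : forall x, Q (P x) = x).
Hypothesis isoT : forall t x, 0 <= t -> hnorm (P (T t (Q x))) = hnorm x.

Let G := conj_linop P Q E.

Lemma isometric_solution : exists U : R -> R -> H -> H, forall e xi y, 0 < e ->
  ldom G (U e xi y) /\ Complex e xi *: U e xi y - lapp G (U e xi y) = y.
Proof.
have cS := conj_semigroup_c0 bP bQ PQ QP cT.
have gS := conj_semigroup_generates bP bQ PQ QP cT gT.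
have linG := conj_linop_linear bP bQ linE.
have /boolp.choice[U UE] : forall p : R * R * H, exists x, 0 < p.1.1 ->
    ldom G x /\ Complex p.1.1 p.1.2 *: x - lapp G x = p.2.
  move=> [[e xi] y]; have [e0|] := boolP (0 < e); last by exists 0.
  by have [x hx] := isometric_range cS gS isoT xi y linG e0; exists x.
by exists (fun e xi y => U (e, xi, y)) => e xi y; exact: UE (e, xi, y).
Qed.

Lemma isometric_dense h (e : R) : 0 < e -> exists x, ldom G x /\ hnorm (h - x) < e.
Proof.
have cS := conj_semigroup_c0 bP bQ PQ QP cT.
have gS := conj_semigroup_generates bP bQ PQ QP cT gT.
have linG := conj_linop_linear bP bQ linE.
have skewG := isometric_generator_skew gS isoT.
apply: dense_of_orthogonal; first exact: (dom0 linG).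
  by move=> *; exact: (dom_lin linG).
move=> y yD; have [U UE] := isometric_solution.
have [Dz zE] := UE 1 0 y ltr01; have := yD _ Dz.
rewrite -{1}zE (skew_numerical skewG)// mul1r => z0.
have zz : U 1 0 y = 0 by apply: rip_eq0; rewrite z0.
by rewrite -zE zz (app0 linG) scaler0 subr0.
Qed.

Lemma isometric_resolvent_set (a b : R) : 0 < a -> resolvent_set E (Complex a b).
Proof.
move=> a0; have [U UE] := isometric_solution.
have gS := conj_semigroup_generates bP bQ PQ QP cT gT.
have linG := conj_linop_linear bP bQ linE.
have skewG := isometric_generator_skew gS isoT.
have spec y : ldom E (Q (U a b (P y))) /\
    Complex a b *: Q (U a b (P y)) - lapp E (Q (U a b (P y))) = y.
  have [D1 E1] := UE a b (P y) a0; split=> //.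
  by have := congr1 Q E1; rewrite (bopB bQ) (bopZ bQ) /= !QP.
exists (fun y => Q (U a b (P y))); split; last first.
  split=> // x Dx; rewrite -[RHS]QP; congr Q; apply/esym.
  apply: (skew_solution_unique linG skewG UE) => //; first by rewrite /= QP.
  by rewrite /= QP (bopB bP) (bopZ bP).
split.
  by move=> c x y; rewrite (bop_lin bP) (solution_lin linG skewG UE)// (bop_lin bQ).
have [M [M0 hM]] := bop_bound bP; have [N [N0 hN]] := bop_bound bQ.
exists (N * (a^-1 * M)) => x; apply: le_trans (hN _) _; rewrite -mulrA ler_pM2l//.
apply: le_trans (solution_bound skewG UE _ _ a0) _; rewrite -mulrA ler_pM2l ?invr_gt0//.
Qed.

Lemma isometric_resolvent U (a b : R) h : (forall e xi y, 0 < e ->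
  ldom G (U e xi y) /\ Complex e xi *: U e xi y - lapp G (U e xi y) = y) -> 0 < a ->
  P (resolvent E (Complex a b) h) = U a b (P h).
Proof.
move=> UE a0; rewrite -[RHS]PQ; congr P.
have [D1 E1] := UE a b (P h) a0.
apply: resolvent_unique => //; first exact: isometric_resolvent_set.
by have := congr1 Q E1; rewrite (bopB bQ) (bopZ bQ) /= !QP.
Qed.

(** The witness is [C = P], defined everywhere, with [K = H]: since [P (l - E)^-1 = (l - G)^-1 P],
    the energy of [h] is that of [P h] for the skew operator [G]. It lies between fixed multiples of
    [rip (P h) (P h)] for every positive eps, not only in the limit. *)
Lemma isometries_to_resolvent :
  spectrum E `<=` [set z | complex.Re z <= 0] /\
  exists (K : hilbertSpace R) (C : linop H K),
    is_linop C /\ densely_defined C /\ ldom E `<=` ldom C /\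
    (forall (eps : R) (h : H), 0 < eps ->
       bochner_measurable [set: R] (fun xi => lapp C (resolvent E (Complex eps xi) h))) /\
    exists alpha beta : R, 0 < alpha /\ 0 < beta /\
      forall h : H,
        (limsup_0plus (resolvent_energy E C h) <= (beta * hnorm h ^+ 2)%:E)%E /\
        ((alpha * hnorm h ^+ 2)%:E <= liminf_0plus (resolvent_energy E C h))%E.
Proof.
have [U UE] := isometric_solution.
have gS := conj_semigroup_generates bP bQ PQ QP cT gT.
have linG := conj_linop_linear bP bQ linE.
have skewG := isometric_generator_skew gS isoT.
have RE (e xi : R) h : 0 < e -> P (resolvent E (Complex e xi) h) = U e xi (P h).
  by move=> e0; exact: isometric_resolvent.
split.
  move=> [a b] h /=; rewrite leNgt; apply/negP => a0; apply: h.
  exact: isometric_resolvent_set.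
exists H, (LinOp setT P); split; first by split=> // a x y _ _; split=> //=; exact: bop_lin.
split; first by move=> h e e0; exists h; rewrite subrr hnorm0.
split=> //; split.
  move=> e h e0; apply: bochner_of_right_continuous => t d _ d0 /=.
  pose c := e^-1 * (e^-1 * hnorm (P h)) + 1.
  have c0 : 0 < c.
    by rewrite /c ltr_wpDl// !mulr_ge0 ?hnorm_ge0// invr_ge0 ltW.
  exists (d / c); split; first exact: divr_gt0.
  move=> s ts; rewrite -ltrBlDl ltr_pdivlMr// => sd.
  rewrite !RE//; apply: le_lt_trans (solution_diff_bound linG skewG UE _ _ _ e0) _.
  apply: le_lt_trans sd; rewrite ltr0_norm ?subr_lt0// opprB; apply: ler_wpM2l.
    by rewrite subr_ge0 ltW.
  by rewrite /c; lra.
have pi0 : 0 < pi :> R by exact: pi_gt0.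
have [M [M0 hM]] := bop_bound bP; have [N [N0 hN]] := bop_bound bQ.
have energyE h (e : R) : 0 < e -> resolvent_energy E (LinOp setT P) h e =
    (\int[@lebesgue_measure R]_(x in [set: R]) (rip (P h) (U e x (P h)))%:E)%E.
  move=> e0; rewrite /resolvent_energy /=.
  have mp : measurable_fun [set: R] (fun x : R => (rip (U e x (P h)) (U e x (P h)))%:E).
    apply/measurable_EFinP; apply: continuous_measurable_fun.
    have -> : (fun x : R => rip (U e x (P h)) (U e x (P h))) = (fun x => e^-1 * rip (P h) (U e x (P h))).
      apply/funext => x; rewrite (solution_energy skewG UE)// mulrA mulVf ?mul1r//; exact: lt0r_neq0.
    by apply: continuousZ_fun; exact: (density_continuous linG skewG UE).
  rewrite (@eq_integral _ (measurableTypeR R) R _ _ (fun x => (rip (U e x (P h)) (U e x (P h)))%:E)); last first.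
    by move=> x _; rewrite RE// hnorm2.
  rewrite -ge0_integralZl_EFin//; last first.
  - exact: ltW.
  - by move=> x _; rewrite lee_fin rip_ge0.
  by apply: eq_integral => x _; rewrite (solution_energy skewG UE).
have main h (e : R) : 0 < e -> ((pi / 32 * rip (P h) (P h))%:E <= resolvent_energy E (LinOp setT P) h e
    <= (9 * pi * rip (P h) (P h))%:E)%E.
  by move=> e0; rewrite energyE//; exact: (skew_energy linG skewG UE isometric_dense).
(* [N] bounds [Q] and [M] bounds [P], so [hnorm h <= N * hnorm (P h)] and
   [hnorm (P h) <= M * hnorm h]. *)
exists (pi / 32 / N ^+ 2), (9 * pi * M ^+ 2).
split; first by rewrite divr_gt0 ?exprn_gt0//; lra.
split; first by rewrite !mulr_gt0 ?exprn_gt0.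
move=> h; split.
  apply: limsup_0plus_le_cst => e e0; have /andP[_ /le_trans] := main h e e0; apply.
  rewrite lee_fin -hnorm2 -(mulrA (9 * pi)) ler_pM2l ?mulr_gt0// -exprMn ler_sqr ?nnegrE ?mulr_ge0 ?hnorm_ge0//; exact: ltW.
apply: liminf_0plus_ge_cst => e e0; have /andP[h1 _] := main h e e0; apply: le_trans h1.
rewrite lee_fin -hnorm2 -(mulrA (pi / 32)) ler_pM2l; last by rewrite divr_gt0.
rewrite ler_pdivrMl ?exprn_gt0// -exprMn ler_sqr ?nnegrE ?mulr_ge0 ?hnorm_ge0 ?(ltW N0)//.
by have := hN (P h); rewrite QP.
Qed.

(** With [C = P] the integrand is constant in time, so the average equals [hnorm (P h) ^+ 2] at
    every positive time. *)
Lemma isometries_to_averages :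
  exists (K : hilbertSpace R) (C : linop H K),
    is_linop C /\ densely_defined C /\
    (forall t h, 0 <= t -> ldom C h -> ldom C (T t h)) /\
    (forall h, ldom C h ->
       bochner_measurable [set t | 0 <= t] (fun t => lapp C (T t h))) /\
    exists alpha beta : R, 0 < alpha /\ 0 < beta /\
      forall h, ldom C h ->
        ((alpha * hnorm h ^+ 2)%:E <= limsup_pinfty (time_avg T C h))%E /\
        (limsup_pinfty (time_avg T C h) <= (beta * hnorm h ^+ 2)%:E)%E.
Proof.
have cS := conj_semigroup_c0 bP bQ PQ QP cT.
have PT (t : R) h : P (T t h) = conj_semigroup P Q T t (P h) by rewrite /conj_semigroup QP.
exists H, (LinOp setT P); split; first by split=> // a x y _ _; split=> //=; exact: bop_lin.
split; first by move=> h e e0; exists h; rewrite subrr hnorm0.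
split=> //; split.
  move=> h _; apply: bochner_of_right_continuous => t e /= t0 e0.
  have [d [d0 hd]] := sg_lim0 cS (P (T t h)) e0.
  exists d; split=> // s ts sd.
  have -> : P (T s h) = conj_semigroup P Q T (s - t) (P (T t h)).
    by rewrite !PT -(sgD cS) ?subrK// subr_ge0 ltW.
  by apply: hd; lra.
have avgE h (t : R) : 0 < t -> time_avg T (LinOp setT P) h t = (hnorm (P h) ^+ 2)%:E.
  move=> t0; rewrite /time_avg /=.
  rewrite (@eq_integral _ (measurableTypeR R) R _ _ (fun=> (hnorm (P h) ^+ 2)%:E)); last first.
    move=> s; rewrite inE /= in_itv /= => /andP[s0 _].
    by rewrite PT /conj_semigroup isoT.
  rewrite integral_cst//= lebesgue_measure_itv /= lte_fin t0 -EFinB subr0 -!EFinM.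
  by congr (_%:E); field; exact: lt0r_neq0.
have [M [M0 hM]] := bop_bound bP; have [N [N0 hN]] := bop_bound bQ.
exists (N ^- 2), (M ^+ 2); split; first by rewrite invr_gt0 exprn_gt0.
split; first by rewrite exprn_gt0.
move=> h _; rewrite (limsup_pinfty_cst (avgE h)) !lee_fin; split.
  rewrite ler_pdivrMl ?exprn_gt0// -exprMn ler_sqr ?nnegrE ?mulr_ge0 ?hnorm_ge0 ?(ltW N0)//.
  by have := hN (P h); rewrite QP.
by rewrite -exprMn ler_sqr ?nnegrE ?mulr_ge0 ?hnorm_ge0 ?(ltW M0).
Qed.

End IsometriesToResolvent.

Lemma similar_of_averages (R : realType) (H K : hilbertSpace R) (T : R -> H -> H) (C : linop H K)
    (alpha beta : R) : c0_semigroup T -> densely_defined C ->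
  (forall t h, 0 <= t -> ldom C h -> ldom C (T t h)) ->
  (forall h, ldom C h -> bochner_measurable [set t | 0 <= t] (fun t => lapp C (T t h))) ->
  0 < alpha -> 0 < beta ->
  ((forall h, ldom C h ->
      ((alpha * hnorm h ^+ 2)%:E <= limsup_pinfty (time_avg T C h))%E /\
      (limsup_pinfty (time_avg T C h) <= (beta * hnorm h ^+ 2)%:E)%E) \/
   (forall h, ldom C h ->
      ((alpha * hnorm h ^+ 2)%:E <= liminf_pinfty (time_avg T C h))%E /\
      (liminf_pinfty (time_avg T C h) <= (beta * hnorm h ^+ 2)%:E)%E)) ->
  similar_to_isometries T.
Proof.
move=> cT dC TC mC a0 b0 [h|h].
  exact: (time_avg_similar cT dC TC mC (@limsup_pinfty_exists R) (@limsup_pinfty_dominated R) a0 b0 h).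
exact: (time_avg_similar cT dC TC mC (@liminf_pinfty_exists R) (@liminf_pinfty_dominated R) a0 b0 h).
Qed.

Theorem theorem8p8 (R : realType) (H : hilbertSpace R) (E : linop H H) :
  is_linop E ->
  let cond_i :=
    exists T : R -> H -> H,
      c0_semigroup T /\ generates T E /\ similar_to_isometries T in
  let cond_ii :=
    exists T : R -> H -> H,
      c0_semigroup T /\ generates T E /\
      exists (K : hilbertSpace R) (C : linop H K),
        is_linop C /\ densely_defined C /\
        (forall t h, 0 <= t -> ldom C h -> ldom C (T t h)) /\
        (forall h, ldom C h ->
           bochner_measurable [set t | 0 <= t] (fun t => lapp C (T t h))) /\
        exists alpha beta : R, 0 < alpha /\ 0 < beta /\
          ((forall h, ldom C h ->
              ((alpha * hnorm h ^+ 2)%:E <= limsup_pinfty (time_avg T C h))%E /\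
              (limsup_pinfty (time_avg T C h) <= (beta * hnorm h ^+ 2)%:E)%E)
           \/
           (forall h, ldom C h ->
              ((alpha * hnorm h ^+ 2)%:E <= liminf_pinfty (time_avg T C h))%E /\
              (liminf_pinfty (time_avg T C h) <= (beta * hnorm h ^+ 2)%:E)%E)) in
  let cond_iii :=
    spectrum E `<=` [set z | complex.Re z <= 0] /\
    exists (K : hilbertSpace R) (C : linop H K),
      is_linop C /\ densely_defined C /\
      ldom E `<=` ldom C /\
      (forall (eps : R) (h : H), 0 < eps ->
         bochner_measurable [set: R]
           (fun xi => lapp C (resolvent E (Complex eps xi) h))) /\
      exists alpha beta : R, 0 < alpha /\ 0 < beta /\
        forall h : H,
          (limsup_0plus (resolvent_energy E C h) <= (beta * hnorm h ^+ 2)%:E)%E /\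
          ((alpha * hnorm h ^+ 2)%:E <= liminf_0plus (resolvent_energy E C h))%E in
  (cond_i <-> cond_ii) /\ (cond_ii <-> cond_iii).
Proof.
move=> linE cond_i cond_ii cond_iii.
have i_ii : cond_i -> cond_ii.
  move=> [T [cT [gT [P [Q [bP [bQ [PQ [QP isoT]]]]]]]]].
  exists T; split=> //; split=> //.
  have [K [C [h1 [h2 [h3 [h4 [al [be [h5 [h6 h7]]]]]]]]]] :=
    isometries_to_averages cT bP bQ PQ QP (fun t x t0 => isoT t x t0).
  exists K, C; do 4 split=> //.
  by exists al, be; do 2 split=> //; left.
have ii_i : cond_ii -> cond_i.
  move=> [T [cT [gT [K [C [_ [dC [TC [mC [al [be [a0 [b0 h]]]]]]]]]]]]].
  by exists T; split=> //; split=> //; exact: similar_of_averages h.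
have i_iii : cond_i -> cond_iii.
  move=> [T [cT [gT [P [Q [bP [bQ [PQ [QP isoT]]]]]]]]].
  exact: (isometries_to_resolvent linE cT gT bP bQ PQ QP isoT).
have iii_i : cond_iii -> cond_i.
  move=> [sE [K [C [linC [_ [dEC [mC [al [be [a0 [b0 h]]]]]]]]]]].
  have [T [cT gT sT]] := resolvent_to_isometries linE linC sE dEC mC a0 b0
    (fun x => proj1 (h x)) (fun x => proj2 (h x)).
  by exists T.
split; first by split; [exact: i_ii|exact: ii_i].
by split=> [/ii_i/i_iii|/iii_i/i_ii].
Qed.
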